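(* Let $k\in\mathbb{Z}$, $N\in\mathbb{N}$, $\psi$ a Dirichlet character modulo $N$, and $f\in H_k(N,\psi)$ with Fourier expansion $f(z)=\sum_{n\ge-n_0'}a(n)e^{2\pi inz}+\sum_{n<0}b(n)\Gamma(1-k,-4\pi ny)e^{2\pi inz}$. Set $g=f|_kW_N$ and let $n_0\in\mathbb{N}$ be such that $f(z)$ and $g(z)$ are $O(e^{2\pi n_0y})$ as $y=\Im z\to\infty$. Suppose $\varphi$ is a non-zero piecewise smooth function such that, for some $\epsilon>0$, $\varphi(x)$ and $\varphi(x^{-1})$ are $o(e^{-2\pi(n_0+\epsilon)x})$ as $x\to\infty$, and that the series $$\sum_{n\ge-n_0}|a(n)|\big((\mathcal{L}|\varphi|^2)(2\pi n)\big)^{1/2}+\sum_{n<0}|b(n)||4\pi n|^{1-k}\int_0^\infty\frac{\big((\mathcal{L}|\varphi_{2-k}|^2)(-2\pi n(2t+1))\big)^{1/2}}{(1+t)^k}\,dt$$ converges. Then $L(s,f,\varphi):=L_f(\varphi_s)$ converges absolutely for $\Re(s)>\frac12$, has an analytic continuation to all $s\in\mathbb{C}$, and satisfies $$L(s,f,\varphi)=N^{-s-\frac k2+1}i^kL(1-s,g,\varphi|_{1-k}W_N).$$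
   Context: $\mathbb{H}$ is the upper half-plane, $z=x+iy$; $\Gamma(r,z)=\int_z^\infty e^{-t}t^{r-1}dt$. For $k\in\mathbb{Z}$ and $\gamma=\begin{pmatrix}a&b\\c&d\end{pmatrix}$, $(f|_k\gamma)(z)=(cz+d)^{-k}f(\gamma z)$; $W_N=\begin{pmatrix}0&-1/\sqrt N\\\sqrt N&0\end{pmatrix}$, so $(f|_kW_N)(z)=(\sqrt Nz)^{-k}f(-1/(Nz))$. $\Delta_k=-4y^2\partial_z\partial_{\bar z}+2iky\partial_{\bar z}$. $H_k(N,\psi)$: smooth $f\colon\mathbb{H}\to\mathbb{C}$ with $f|_k\gamma=\psi(d)f$ for $\gamma=\begin{pmatrix}*&*\\ *&d\end{pmatrix}\in\Gamma_0(N)$, $\Delta_kf=0$, and for every $\gamma=\begin{pmatrix}*&*\\c&d\end{pmatrix}\in\mathrm{SL}_2(\mathbb{Z})$ a polynomial $P\in\mathbb{C}[e^{-2\pi iz}]$ with $f(\gamma z)(cz+d)^{-k}-P(z)=O(e^{-\epsilon y})$ as $y\to\infty$ for some $\epsilon>0$. Laplace transform $(\mathcal{L}\varphi)(s)=\int_0^\infty e^{-st}\varphi(t)dt$; $\varphi_s(x)=\varphi(x)x^{s-1}$; $(\varphi|_aW_N)(x)=(Nx)^{-a}\varphi(1/(Nx))$. For a function $h(z)=\sum_{n\ge-n_0}a(n)e^{2\pi inz}+\sum_{n<0}b(n)\Gamma(1-k,-4\pi ny)e^{2\pi inz}$, $L_h(\varphi)=\sum_{n\ge-n_0}a(n)(\mathcal{L}\varphi)(2\pi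 n)+\sum_{n<0}b(n)(-4\pi n)^{1-k}\int_0^\infty\frac{(\mathcal{L}\varphi_{2-k})(-2\pi n(2t+1))}{(1+t)^k}dt$, defined on the set $\mathcal{F}_h$ of piecewise smooth $\varphi$ for which $\mathcal{L}\varphi(s)$ converges absolutely for $\Re s\ge-2\pi n_0$, $\mathcal{L}\varphi_{2-k}(s)$ converges absolutely for $\Re s>0$, and the same series with $a(n),b(n),\mathcal{L}\varphi,\mathcal{L}\varphi_{2-k}$ replaced by $|a(n)|,|b(n)|,\mathcal{L}|\varphi|,\mathcal{L}|\varphi_{2-k}|$ converges. $L(s,h,\phi)$ denotes $L_h(\phi_s)$ (and its analytic continuation).
   Formalization: L(1-s,g,φ|W_N) is read as an entire function agreeing with the g-series wherever that series converges absolutely; the hypotheses do not force it to converge anywhere (e.g. N=4, pole only at the cusp 1/2), and there the right side is not determined by g. *)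

(* Defs.v *)
From HB Require Import structures.
From mathcomp Require Import all_boot all_order all_algebra.
From mathcomp Require Import all_classical all_reals all_analysis.
From mathcomp Require Import complex.
Import Order.TTheory GRing.Theory Num.Theory.
Import numFieldNormedType.Exports.

Set Implicit Arguments.
Unset Strict Implicit.
Unset Printing Implicit Defensive.

Local Open Scope classical_set_scope.
Local Open Scope ring_scope.
Local Open Scope complex_scope.

Section Defs.
Context {R : realType}.
Local Notation C := R[i].
Local Notation mu := (@lebesgue_measure R).
Implicit Types (f h F : C -> C) (phi : R -> C) (z s : C) (k n : int).

Definition cabs z : R := complex.Re `|z|.

Definition cexp z : C :=
  (expR (complex.Re z))%:C * (cos (complex.Im z) +i* sin (complex.Im z)).

(* The power x ^ s of a positive real x. *)
Definition cpow (x : R) s : C := cexp (s * (ln x)%:C).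

Definition cintegral (D : set R) (u : R -> C) : C :=
  (\int[mu]_(t in D) complex.Re (u t)) +i* (\int[mu]_(t in D) complex.Im (u t)).

(* The topology on C is the one of its regular module C^o. *)
Definition csummable (u : nat -> C) := cvgn (series u : nat -> C^o).
Definition csum (u : nat -> C) : C := limn (series u : nat -> C^o).

Definition entire F := forall s, derivable (F : C^o -> C^o) s 1.

(** ** Functions on the upper half-plane

   They are total functions [C -> C] of which only the values at [z] with
   [0 < Im z] are used. *)

(* Derivative of [f] at [z] along the real direction [v], the real and the
   imaginary part being differentiated separately. *)
Definition dir_derivable (v : C) f z :=
  derivable (fun t : R => complex.Re (f (z + t%:C * v))) 0 1 /\
  derivable (fun t : R => complex.Im (f (z + t%:C * v))) 0 1.

Definition dir_derive (v : C) f z : C :=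
  derive1 (fun t : R => complex.Re (f (z + t%:C * v))) 0 +i*
  derive1 (fun t : R => complex.Im (f (z + t%:C * v))) 0.

Definition d_x := dir_derive 1.
Definition d_y := dir_derive 'i%C.
Definition d_z f z : C := 2^-1 * (d_x f z - 'i%C * d_y f z).
Definition d_zbar f z : C := 2^-1 * (d_x f z + 'i%C * d_y f z).

Definition iter_partial (w : seq bool) f : C -> C :=
  foldr (fun (b : bool) g => if b then d_y g else d_x g) f w.

(* Real smoothness: all iterated partial derivatives exist and are
   continuous. *)
Definition smooth_on_H f := forall (w : seq bool) z, 0 < complex.Im z ->
  [/\ dir_derivable 1 (iter_partial w f) z,
      dir_derivable 'i%C (iter_partial w f) z &
      {for z, continuous (iter_partial w f : C^o -> C^o)}].

Definition Laplacian k f z : C :=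
  - (4 * complex.Im z ^+ 2)%:C * d_z (d_zbar f) z
  + 2 * 'i%C * k%:~R * (complex.Im z)%:C * d_zbar f z.

Definition slash k (gamma : 'M[R]_2) f z : C :=
  let j := (gamma 1 0)%:C * z + (gamma 1 1)%:C in
  j ^ (- k) * f (((gamma 0 0)%:C * z + (gamma 0 1)%:C) / j).

Definition intmx (gamma : 'M[int]_2) : 'M[R]_2 := map_mx (fun m : int => m%:~R) gamma.

Definition W (N : nat) : 'M[R]_2 :=
  \matrix_(i < 2, j < 2)
    if i == j then 0 else if i == 0 then - (Num.sqrt N%:R)^-1 else Num.sqrt N%:R.

Definition SL2Z (gamma : 'M[int]_2) := \det gamma = 1.

Definition Gamma0 (N : nat) (gamma : 'M[int]_2) :=
  SL2Z gamma /\ (N%:Z %| gamma 1%R 0%R)%Z.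

Record dirichlet_character (N : nat) (psi : int -> C) : Prop := {
  dirichlet_mul : forall m n, psi (m * n) = psi m * psi n;
  dirichlet_periodic : forall m, psi (m + N%:Z) = psi m;
  dirichlet_neq0 : forall m, (psi m != 0) = coprimez m N%:Z }.

(* h(z) = O(g(y)) as y = Im z tends to infinity, uniformly in x = Re z. *)
Definition bigO_im h (g : R -> R) := exists M : R,
  \forall y \near +oo, forall x : R, cabs (h (x +i* y)) <= M * g y.

(* phi(x) = o(g(x)) as x tends to infinity. *)
Definition littleo_pinfty phi (g : R -> R) := forall e : R, 0 < e ->
  \forall x \near +oo, cabs (phi x) <= e * g x.

Record harmonic_form k (N : nat) (psi : int -> C) f : Prop := {
  harmonic_form_smooth : smooth_on_H f;
  harmonic_form_modular : forall gamma, Gamma0 N gamma ->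
    forall z, 0 < complex.Im z ->
      slash k (intmx gamma) f z = psi (gamma 1 1) * f z;
  harmonic_form_harmonic : forall z, 0 < complex.Im z -> Laplacian k f z = 0;
  harmonic_form_cusps : forall gamma, SL2Z gamma ->
    exists (P : {poly C}) (eps : R), 0 < eps /\
      bigO_im (fun z => slash k (intmx gamma) f z
                        - P.[cexp (- (2 * pi)%:C * 'i%C * z)])
              (fun y => expR (- (eps * y))) }.

(* Incomplete Gamma function, for an integer r and x > 0. *)
Definition Gamma_inc (r : int) (x : R) : R :=
  \int[mu]_(t in `[x, +oo[) (expR (- t) * t ^ (r - 1)).

(* The m-th index of a sum over n >= - n0, respectively over n < 0. *)
Definition idx_ge (n0 m : nat) : int := m%:Z - n0%:Z.
Definition idx_neg (m : nat) : int := - (m.+1)%:Z.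

Definition qexp n z : C := cexp ((2 * pi * n%:~R)%:C * 'i%C * z).

Definition fourier_hol (n0 : nat) (a : int -> C) z (m : nat) : C :=
  let n := idx_ge n0 m in a n * qexp n z.

Definition fourier_nonhol k (b : int -> C) z (m : nat) : C :=
  let n := idx_neg m in
  b n * (Gamma_inc (1 - k) (- (4 * pi * n%:~R * complex.Im z)))%:C * qexp n z.

(* The coefficients a(n) are extended by 0 to n < - n0; the coefficients b(n)
   matter only for n < 0. *)
Record fourier_expansion k (n0 : nat) (a b : int -> C) h : Prop := {
  fourier_expansion_supp : forall n, n < - n0%:Z -> a n = 0;
  fourier_expansion_cvg_hol : forall z, 0 < complex.Im z ->
    csummable (fourier_hol n0 a z);
  fourier_expansion_cvg_nonhol : forall z, 0 < complex.Im z ->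
    csummable (fourier_nonhol k b z);
  fourier_expansionE : forall z, 0 < complex.Im z ->
    h z = csum (fourier_hol n0 a z)
          + csum (fourier_nonhol k b z) }.

(** ** Test functions

   They are functions on the open half-line: only the values [phi x] with
   [0 < x] are used. *)

Definition smooth (u : R -> C) := forall (n : nat) (x : R),
  derivable (derive1n n (fun t => complex.Re (u t))) x 1 /\
  derivable (derive1n n (fun t => complex.Im (u t))) x 1.

(* Finitely many pieces on every compact subinterval of the half-line, each
   smooth up to the end points; the values at the break points are free. *)
Definition piecewise_smooth phi := forall alpha beta : R,
  0 < alpha -> alpha < beta ->
  exists t : seq R, itv_partition alpha beta t /\
    forall i, (i < size t)%N -> exists u : R -> C, smooth u /\
      forall x, nth beta (alpha :: t) i < x < nth beta t i -> phi x = u x.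

(* phi_s *)
Definition twist s phi (x : R) : C := phi x * cpow x (s - 1).

(* phi |_a W_N *)
Definition slashW k (N : nat) phi (x : R) : C :=
  ((N%:R * x)%:C) ^ (- k) * phi (N%:R * x)^-1.

Definition laplace phi s : C :=
  cintegral `]0, +oo[ (fun t => cexp (- s * t%:C) * phi t).

Definition laplace_abscvg phi s :=
  mu.-integrable `]0, +oo[ (fun t => (cabs (cexp (- s * t%:C) * phi t))%:E).

(* Laplace transform of a nonnegative function at a real point, with values in
   the extended reals. *)
Definition elaplace (u : R -> R) (x : R) : \bar R :=
  (\int[mu]_(t in `]0%R, +oo[) (expR (- (x * t)) * u t)%:E)%E.

Definition L_hol (n0 : nat) (a : int -> C) phi (m : nat) : C :=
  let n := idx_ge n0 m in a n * laplace phi (2 * pi * n%:~R)%:C.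

Definition L_nonhol k (b : int -> C) phi (m : nat) : C :=
  let n := idx_neg m in
  b n * ((- (4 * pi * n%:~R)) ^ (1 - k))%:C *
  cintegral `]0, +oo[ (fun t =>
    laplace (twist (2 - k)%:~R phi) (- (2 * pi * n%:~R * (2 * t + 1)))%:C
    / ((1 + t) ^ k)%:C).

(* L_h(phi), for h with the Fourier coefficients a and b. *)
Definition L k (n0 : nat) (a b : int -> C) phi : C :=
  csum (L_hol n0 a phi) + csum (L_nonhol k b phi).

(* The series of nonnegative terms
     sum_(n >= - n0) |a(n)| A(2 pi n) + sum_(n < 0) |b(n)| |4 pi n|^(1-k)
         int_0^oo B(- 2 pi n (2 t + 1)) / (1 + t)^k dt
   converges, where A and B may take the value +oo; a term whose coefficient
   a(n) or b(n) vanishes is 0. *)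
Definition majorant_cvg k (n0 : nat) (a b : int -> C) (A B : R -> \bar R) :=
  (\sum_(0 <= m <oo) ((cabs (a (idx_ge n0 m)))%:E
       * A (2 * pi * (idx_ge n0 m)%:~R)%R)
   + \sum_(0 <= m <oo) ((cabs (b (idx_neg m))
                         * `|4 * pi * (idx_neg m)%:~R| ^ (1 - k))%:E
       * \int[mu]_(t in `]0%R, +oo[)
           (B (- (2 * pi * (idx_neg m)%:~R * (2 * t + 1)))%R
            * (((1 + t) ^ k)^-1)%:E))
   < +oo)%E.

(* The set F_h, for h with the Fourier coefficients a and b. *)
Record test_function k (n0 : nat) (a b : int -> C) phi : Prop := {
  test_function_smooth : piecewise_smooth phi;
  test_function_laplace : forall s, - (2 * pi * n0%:R) <= complex.Re s ->
    laplace_abscvg phi s;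
  test_function_laplace_twist : forall s, 0 < complex.Re s ->
    laplace_abscvg (twist (2 - k)%:~R phi) s;
  test_function_cvg : majorant_cvg k n0 a b
    (elaplace (fun t => cabs (phi t)))
    (elaplace (fun t => cabs (twist (2 - k)%:~R phi t))) }.

(* F is an analytic continuation to the whole plane of s |-> L_h(phi_s), the
   latter being defined at the points s such that phi_s is in F_h. *)
Definition L_continuation k (n0 : nat) (a b : int -> C) phi F :=
  entire F /\
  forall s, test_function k n0 a b (twist s phi) ->
    F s = L k n0 a b (twist s phi).

End Defs.

(* Main.v *)
(* On the imaginary axis f(iy) has at most exponential growth at both ends
   (by the growth hypotheses at y = oo, and through W_N at y = 0), which the
   decay of phi beats, so that F(s) = int_0^oo f(iy) phi(y) y^(s-1) dy converges
   for every s and is entire.  Integrating the Fourier expansion term by term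
   gives F(s) = L_f(phi_s) for phi_s in F_f: the b(n) Gamma(1-k, -4 pi n y)
   terms follow from Gamma(r, x) e^(x/2) = x^r int_0^oo e^(-x(2t+1)/2) (1+t)^(r-1) dt.
   The growth hypothesis also forces a(n) = 0 for n < -n0.
   The substitution y -> 1/(Ny) turns the integral of f into the one of g and
   gives the functional equation.  For Re s > 1/2 the Cauchy-Schwarz inequality
     L|phi_s|(x)^2 <= L|phi|^2(x) int_0^oo e^(-2 pi t) t^(2 Re s - 2) dt, x >= 2 pi,
   bounds the majorant series of phi_s by the one that is assumed to converge. *)

Require Import Defs.
From HB Require Import structures.
From mathcomp Require Import all_boot all_order all_algebra.
From mathcomp Require Import all_classical all_reals all_analysis.
From mathcomp Require Import measurable_realfun complex.
From mathcomp Require Import ring lra zify.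
Import Order.TTheory GRing.Theory Num.Theory.
Import numFieldNormedType.Exports.

Set Implicit Arguments.
Unset Strict Implicit.
Unset Printing Implicit Defensive.

Local Open Scope classical_set_scope.
Local Open Scope ring_scope.
Local Open Scope complex_scope.

(** The bridge between F and L_f is termwise integration, and its domination is exactly the majorant
    series in the definition of a test function: the terms of that series are the L1 norms of the
    terms of the expansion times phi on the imaginary axis, by Tonelli for the b(n) part. Three
    obstacles shape the rest. The integrand is only as regular as phi, whose values at break points
    are arbitrary, so the substitution y -> 1/(Ny) is proved for measurable functions, by
    identifying an image measure with Lebesgue measure. The pieces of a piecewise smooth function
    are restrictions of functions smooth on all of R, and x^(s-1) is not one, so x is first replaced
    by a positive smooth function equal to x on the interval. The Cauchy-Schwarz bound is uniform
    only for x >= 2 pi, so the terms with -n0 <= n <= 0 are shown to be finite one by one through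
    the decay of phi. The condition Re s > 1/2 is the integrability of t^(2 Re s - 2) at 0. Complex
    integrals and sums are handled through real and imaginary parts, the source of several factors 2
    in the estimates. *)

Section ComplexBasics.
Context {R : realType}.
Local Notation C := R[i].
Local Notation Re := complex.Re.
Local Notation Im := complex.Im.
Implicit Types (z w : C) (x y : R).

(** * Modulus, exponential and powers in [R[i]] *)

Lemma cabsE z : cabs z = Num.sqrt (Re z ^+ 2 + Im z ^+ 2).
Proof. by rewrite /cabs normc_def. Qed.

Lemma normCE z : `|z| = (cabs z)%:C.
Proof. by rewrite cabsE normc_def. Qed.

Lemma cabs_ge0 z : 0 <= cabs z.
Proof. by rewrite cabsE sqrtr_ge0. Qed.

Lemma cabsM z w : cabs (z * w) = cabs z * cabs w.
Proof. by apply: complexI; rewrite rmorphM /= -!normCE normrM. Qed.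

Lemma cabs_eq0 z : (cabs z == 0) = (z == 0).
Proof. by rewrite -(inj_eq (@complexI R)) -normCE normr_eq0. Qed.

Lemma cabs1 : cabs (1 : C) = 1.
Proof. by rewrite /cabs normr1. Qed.

Lemma cabsD z w : cabs (z + w) <= cabs z + cabs w.
Proof. by rewrite -lecR rmorphD /= -!normCE ler_normD. Qed.

Lemma cabsN z : cabs (- z) = cabs z.
Proof. by rewrite /cabs normrN. Qed.

Lemma cabsV z : cabs z^-1 = (cabs z)^-1.
Proof. by apply: complexI; rewrite fmorphV /= -!normCE normfV. Qed.

Lemma cabsX z n : cabs (z ^+ n) = cabs z ^+ n.
Proof. by elim: n => [|n IH]; rewrite ?cabs1// !exprS cabsM IH. Qed.

Lemma cabsXz z (n : int) : cabs (z ^ n) = cabs z ^ n.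
Proof. by case: n => n; rewrite ?NegzE -?exprnP -?exprnN ?cabsV cabsX. Qed.

Lemma cabs_real x : cabs x%:C = `|x|.
Proof. by rewrite cabsE /= expr0n addr0 sqrtr_sqr. Qed.

Lemma cabsi : cabs ('i : C) = 1.
Proof. by rewrite cabsE /= expr0n add0r expr1n sqrtr1. Qed.

Lemma Re_le_cabs z : `|Re z| <= cabs z.
Proof.
by rewrite cabsE -sqrtr_sqr ler_sqrt ?lerDl ?sqr_ge0// addr_ge0 ?sqr_ge0.
Qed.

Lemma Im_le_cabs z : `|Im z| <= cabs z.
Proof.
by rewrite cabsE -sqrtr_sqr ler_sqrt ?lerDr ?sqr_ge0// addr_ge0 ?sqr_ge0.
Qed.

Lemma cabs_le_ReIm z : cabs z <= `|Re z| + `|Im z|.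
Proof.
case: z => x y /=; rewrite cabsE /=.
rewrite -(ger0_norm (addr_ge0 (normr_ge0 x) (normr_ge0 y))) -sqrtr_sqr ler_sqrt ?sqr_ge0//.
rewrite sqrrD !real_normK ?num_real//.
by rewrite -addrA (addrC (_ *+ 2)) addrA lerDl mulrn_wge0 // mulr_ge0.
Qed.

Lemma ReD z w : Re (z + w) = Re z + Re w. Proof. by case: z w => [? ?] []. Qed.
Lemma ImD z w : Im (z + w) = Im z + Im w. Proof. by case: z w => [? ?] []. Qed.
Lemma ReN z : Re (- z) = - Re z. Proof. by case: z. Qed.
Lemma ImN z : Im (- z) = - Im z. Proof. by case: z. Qed.
Lemma Re_mul z w : Re (z * w) = Re z * Re w - Im z * Im w.
Proof. by case: z w => [? ?] []. Qed.
Lemma Im_mul z w : Im (z * w) = Re z * Im w + Im z * Re w.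
Proof. by case: z w => [? ?] []. Qed.
Lemma Re_realM x z : Re (x%:C * z) = x * Re z.
Proof. by rewrite Re_mul /= mul0r subr0. Qed.
Lemma Im_realM x z : Im (x%:C * z) = x * Im z.
Proof. by rewrite Im_mul /= mul0r addr0. Qed.
Lemma complexP z w : Re z = Re w -> Im z = Im w -> z = w.
Proof. by case: z w => [? ?] [? ?] /= -> ->. Qed.

Lemma expz_real x (n : int) : (x%:C) ^ n = (x ^ n)%:C :> C.
Proof. by rewrite fmorphXz. Qed.

Lemma Re_sum n (u : nat -> C) :
  Re (\sum_(0 <= i < n) u i) = \sum_(0 <= i < n) Re (u i).
Proof. exact: (big_morph _ ReD (erefl : Re (0 : C) = 0)). Qed.

Lemma Im_sum n (u : nat -> C) :
  Im (\sum_(0 <= i < n) u i) = \sum_(0 <= i < n) Im (u i).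
Proof. exact: (big_morph _ ImD (erefl : Im (0 : C) = 0)). Qed.

Lemma cabs_cexp z : cabs (cexp z) = expR (Re z).
Proof.
rewrite /cexp cabsM cabs_real ger0_norm ?expR_ge0// cabsE /= cos2Dsin2.
by rewrite sqrtr1 mulr1.
Qed.

Lemma cexpD z w : cexp (z + w) = cexp z * cexp w.
Proof.
case: z w => a b [c d]; rewrite /cexp /= expRD rmorphM /= mulrACA.
congr (_ * _); apply: complexP; rewrite ?Re_mul ?Im_mul /=.
  exact: cosD.
by rewrite sinD; ring.
Qed.

Lemma cexp_real x : cexp x%:C = (expR x)%:C :> C.
Proof. by rewrite /cexp /= cos0 sin0 mulr1. Qed.

Lemma cexp0 : cexp 0 = 1 :> C.
Proof. by rewrite (_ : 0 = (0 : R)%:C)// cexp_real expR0. Qed.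

Lemma cpow_real x y : 0 < x -> cpow x y%:C = (x `^ y)%:C :> C.
Proof. by move=> x0; rewrite /cpow -rmorphM/= cexp_real /powR gt_eqF. Qed.

Lemma cabs_cpow x z : 0 < x -> cabs (cpow x z) = x `^ Re z.
Proof.
by move=> x0; rewrite /cpow cabs_cexp mulrC Re_realM mulrC /powR gt_eqF.
Qed.

Lemma cpowD x z w : cpow x (z + w) = cpow x z * cpow x w :> C.
Proof. by rewrite /cpow mulrDl cexpD. Qed.

Lemma cpow_int x (n : int) : 0 < x -> cpow x n%:~R = (x ^ n)%:C :> C.
Proof.
move=> x0; rewrite (_ : n%:~R = (n%:~R : R)%:C); last by rewrite rmorph_int.
by rewrite cpow_real// powR_intmul// ltW.
Qed.

Lemma cpowM x y z : 0 < x -> 0 < y -> cpow (x * y) z = cpow x z * cpow y z :> C.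
Proof.
by move=> x0 y0; rewrite /cpow lnM ?posrE// rmorphD/= mulrDr cexpD.
Qed.

Lemma cpowV x z : 0 < x -> cpow x^-1 z = cpow x (- z) :> C.
Proof. by move=> x0; rewrite /cpow lnV ?posrE// rmorphN/= mulrN mulNr. Qed.

End ComplexBasics.

(** * Complex series through real and imaginary parts *)

Section ComplexSeries.
Context {R : realType}.
Local Notation C := R[i].
Local Notation Re := complex.Re.
Local Notation Im := complex.Im.
Implicit Types (u : nat -> C) (l : C).

Lemma cvg_ReIm u l : (fun n => Re (u n)) @ \oo --> Re l ->
  (fun n => Im (u n)) @ \oo --> Im l -> (u : nat -> C^o) @ \oo --> (l : C^o).
Proof.
move=> /cvgrPdist_lt hr /cvgrPdist_lt hi; apply/cvgrPdist_lt => e.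
(* In the order of [R[i]], [0 < e] forces [e] to be real, so its real part is an ordinary radius. *)
rewrite ltcE /= => /andP[/eqP ie re].
have e2 : 0 < Re e / 2 by rewrite divr_gt0.
near=> n; rewrite normCE ltcE /= ie eqxx /=.
apply: (le_lt_trans (cabs_le_ReIm _)); rewrite ReD ImD ReN ImN (splitr (Re e)).
apply: ltrD; [near: n; exact: hr | near: n; exact: hi].
Unshelve. all: by end_near. Qed.

Lemma ReIm_cvg u l : (u : nat -> C^o) @ \oo --> (l : C^o) ->
  (fun n => Re (u n)) @ \oo --> Re l /\ (fun n => Im (u n)) @ \oo --> Im l.
Proof.
move=> /cvgrPdist_lt h; split; apply/cvgrPdist_lt => e e0.
  have := h e%:C; rewrite ltcR => /(_ e0); apply: filterS => n.
  rewrite normCE ltcR; apply: le_lt_trans.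
  by rewrite -ReN -ReD Re_le_cabs.
have := h e%:C; rewrite ltcR => /(_ e0); apply: filterS => n.
rewrite normCE ltcR; apply: le_lt_trans.
by rewrite -ImN -ImD Im_le_cabs.
Qed.

Lemma csumE u l : series (fun n => Re (u n)) @ \oo --> Re l ->
  series (fun n => Im (u n)) @ \oo --> Im l -> csum u = l.
Proof.
move=> hr hi; apply: (@cvg_lim C^o) => //.
apply: cvg_ReIm; [move: hr|move: hi]; apply: cvg_trans; apply: near_eq_cvg;
  near=> n; rewrite /series /= ?Re_sum ?Im_sum//.
Unshelve. all: by end_near. Qed.

Lemma csummable_cvg u : csummable u ->
  series (fun n => Re (u n)) @ \oo --> Re (csum u) /\
  series (fun n => Im (u n)) @ \oo --> Im (csum u).
Proof.
move=> /ReIm_cvg[hr hi]; split.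
  by move: hr; under eq_fun do rewrite /series /= Re_sum.
by move: hi; under eq_fun do rewrite /series /= Im_sum.
Qed.

End ComplexSeries.

(** * The substitution y -> 1/(cy) for measurable functions *)

Section InversionMeasure.
Import HBNNSimple.
Context {R : realType}.
Local Notation mu := (@lebesgue_measure R).
Local Notation D := (`]0%R, +oo[%classic : set R).
Local Notation RT := (measurableTypeR R).
Variable (c : R) (c_gt0 : 0 < c).

(** The Jacobian of [inversion], whose derivative is -1/(c x^2). *)
Definition inversion_weight (x : R) : R := (c * x ^+ 2)^-1.
Definition inversion (x : R) : R := (c * x)^-1.

Lemma inversion_weight_ge0 x : 0 <= inversion_weight x.
Proof. by rewrite /inversion_weight invr_ge0 mulr_ge0 ?sqr_ge0// ltW. Qed.

Lemma measurable_inversion : measurable_fun D inversion.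
Proof.
apply: open_continuous_measurable_fun; first exact: interval_open.
move=> x /[!inE]/=; rewrite in_itv/= andbT => x0.
apply: cvgV; first by rewrite mulf_neq0 ?gt_eqF.
by apply: cvgM; [exact: cvg_cst|exact: cvg_id].
Qed.

Lemma measurable_inversion_weight : measurable_fun D inversion_weight.
Proof.
apply: open_continuous_measurable_fun; first exact: interval_open.
move=> x /[!inE]/=; rewrite in_itv/= andbT => x0.
apply: cvgV; first by rewrite mulf_neq0 ?expf_neq0 ?gt_eqF.
by apply: cvgM; [exact: cvg_cst|exact: exprn_continuous].
Qed.

(** The image under [inversion] of the measure with density [inversion_weight] on [D]. Once it is
    known to be Lebesgue measure on [D], the change of variables holds for every nonnegative
    measurable integrand. *)
Definition inversion_measure (A : set RT) : \bar R :=
  (\int[mu]_(x in D) ((inversion_weight x)%:E * (\1_A (inversion x))%:E))%E.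

Let mF (h : RT -> \bar R) : measurable_fun setT h ->
  measurable_fun (D : set RT) (fun x : RT => ((inversion_weight x)%:E * h (inversion x))%E).
Proof.
move=> mh; apply: emeasurable_funM.
  by apply/measurable_EFinP; exact: measurable_inversion_weight.
apply: (measurable_comp (F := setT)) => //; exact: measurable_inversion.
Qed.

Let mI (A : set RT) : measurable A ->
  measurable_fun (D : set RT) (fun x : RT => ((inversion_weight x)%:E * (\1_A (inversion x))%:E)%E).
Proof. by move=> mA; apply: (@mF (EFin \o \1_A)); apply/measurable_EFinP. Qed.

Let inversion_measure0 : inversion_measure set0 = 0%E.
Proof.
by rewrite /inversion_measure integral0_eq// => x _; rewrite indic0 mule0.
Qed.

Let inversion_measure_ge0 A : (0 <= inversion_measure A)%E.
Proof.
apply: integral_ge0 => x _.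
by rewrite -EFinM lee_fin mulr_ge0// inversion_weight_ge0.
Qed.

Let inversion_measure_sigma_additive : semi_sigma_additive inversion_measure.
Proof.
move=> A mA tA mbA.
rewrite /inversion_measure.
have -> : (\int[mu]_(x in D) ((inversion_weight x)%:E *
   (\1_(\bigcup_n A n) (inversion x))%:E) = \sum_(n <oo) inversion_measure (A n))%E.
  rewrite -integral_nneseries//; last 2 first.
  - by move=> n; exact: mI.
  - by move=> n x _; rewrite -EFinM lee_fin mulr_ge0// inversion_weight_ge0.
  apply: eq_integral => x _.
  rewrite nneseriesZl//.
  by rewrite indic_bigcup.
apply: is_cvg_nneseries => n _ _.
exact: inversion_measure_ge0.
Qed.

HB.instance Definition _ := isMeasure.Build _ _ _ inversion_measure
  inversion_measure0 inversion_measure_ge0 inversion_measure_sigma_additive.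

(** True by definition for indicators; linearity gives simple functions, and monotone convergence
    along [nnsfun_approx], on both sides of the equation, gives the rest. *)
Lemma integral_inversion_measure (h : RT -> \bar R) :
  measurable_fun setT h -> (forall x, 0 <= h x)%E ->
  (\int[inversion_measure]_x h x =
   \int[mu]_(x in D) ((inversion_weight x)%:E * h (inversion x)))%E.
Proof.
move=> mh h0.
pose f_ := nnsfun_approx measurableT mh.
have w0 x : (0 <= (inversion_weight x)%:E :> \bar R)%E.
  by rewrite lee_fin inversion_weight_ge0.
transitivity (limn (fun n => \int[inversion_measure]_x (f_ n x)%:E))%E.
  rewrite -monotone_convergence//.
  - by apply: eq_integral => y _; apply/esym/cvg_lim => //; exact: cvg_nnsfun_approx.
  - by move=> n; exact/measurable_EFinP.
  - by move=> n y _; rewrite lee_fin.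
  - by move=> y _ m n mn; rewrite lee_fin; exact/lefP/nd_nnsfun_approx.
transitivity (limn (fun n => \int[mu]_(x in D)
    ((inversion_weight x)%:E * (f_ n (inversion x))%:E)))%E; last first.
  rewrite -monotone_convergence//.
  - apply: eq_integral => y _; apply/cvg_lim => //.
    by apply: cvgeZl => //; exact: cvg_nnsfun_approx.
  - by move=> n; apply: (@mF (EFin \o f_ n)); exact/measurable_EFinP.
  - by move=> n y _; rewrite mule_ge0// lee_fin.
  - move=> y _ m n mn; rewrite lee_pmul// ?lee_fin//.
    by have /lefP/(_ (inversion y)) := nd_nnsfun_approx measurableT mh mn.
congr (limn _); apply/funext => n.
transitivity (\sum_(k \in range (f_ n)) \int[mu]_(x in D)
   (k%:E * ((inversion_weight x)%:E * (\1_(f_ n @^-1` [set k]) (inversion x))%:E)))%E.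
  under eq_integral do rewrite fimfunE -fsumEFin//.
  rewrite ge0_integral_fsum//; last 2 first.
  - by move=> y; exact/measurable_EFinP/measurable_funM.
  - by move=> y x _; rewrite nnfun_muleindic_ge0.
  apply: eq_fsbigr => r _; rewrite integralZl_indic_nnsfun// integral_indic//= setIT.
  (* A nonnegative simple function takes no negative value: for r < 0 the level set is empty and
     both sides vanish. *)
  have [r0|r0] := leP 0 r.
    rewrite ge0_integralZl//; last 2 first.
      exact: mI.
      by move=> x _; rewrite mule_ge0// lee_fin.
  rewrite preimage_nnfun0// measure0 mule0 integral0_eq// => x _.
  by rewrite indic0 !mule0.
rewrite -ge0_integral_fsum//.
- apply: eq_integral => x _; rewrite [in RHS]fimfunE -fsumEFin// ge0_mule_fsumr.
    by apply: eq_fsbigr => r _; rewrite EFinM muleCA.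
  by move=> r; rewrite EFinM nnfun_muleindic_ge0.
- by move=> r; apply: emeasurable_funM => //; exact: mI.
- move=> r x _; rewrite muleCA mule_ge0// nnfun_muleindic_ge0//.
Qed.

Lemma inversion_gt0 x : 0 < x -> 0 < inversion x.
Proof. by move=> x0; rewrite invr_gt0 mulr_gt0. Qed.

(** For x > 0, 1/(cy) < x means y > a = 1/(cx), and the weight has primitive -1/(cy), so its
    integral from a to infinity is 1/(ca) = x. For x <= 0 both sides are 0, since [inversion] is
    positive on [D]. *)
Let inversion_measure_ray x :
  inversion_measure `]-oo, x[%classic = mu (`]-oo, x[%classic `&` D).
Proof.
have [x0|x0] := leP x 0.
  rewrite (_ : _ `&` D = set0); last first.
    apply/seteqP; split => // y /=; rewrite !in_itv/= andbT => -[yx y0].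
    by have := lt_trans (lt_le_trans yx x0) y0; rewrite ltxx.
  rewrite measure0 /inversion_measure integral0_eq// => y /=.
  rewrite in_itv/= andbT => y0; rewrite indicE memNset ?mule0//=.
  by apply/negP; rewrite in_itv/= -leNgt (le_trans x0)// ltW// inversion_gt0.
rewrite (_ : _ `&` D = `]0, x[%classic); last first.
  apply/seteqP; split=> y /=; rewrite !in_itv/= andbT; first by move=> [-> ->].
  by move=> /andP[-> ->].
rewrite lebesgue_measure_itv/= lte_fin x0 sube0.
pose a := (c * x)^-1; have a0 : 0 < a by rewrite invr_gt0 mulr_gt0.
have -> : inversion_measure `]-oo, x[%classic =
    (\int[mu]_(y in `[a, +oo[) (inversion_weight y)%:E)%E.
  rewrite -integral_itv_obnd_cbnd; last first.
    apply/measurable_EFinP; apply: measurable_funS measurable_inversion_weight => //.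
    by move=> y /=; rewrite !in_itv/= !andbT; apply: lt_trans.
  rewrite /inversion_measure integral_mkcond [RHS]integral_mkcond.
  apply: eq_integral => y _; rewrite !patchE !mem_setE !in_itv/= !andbT.
  case: ifPn => [y0|y0]; last first.
    by rewrite ifN// -leNgt (le_trans _ (ltW a0))// leNgt.
  rewrite indicE mem_setE in_itv/= /inversion /a.
  rewrite (_ : ((c * y)^-1 < x) = ((c * x)^-1 < y)); last first.
    by rewrite -[(c * y)^-1]div1r -[(c * x)^-1]div1r !ltr_pdivrMr ?mulr_gt0// mulrCA [in RHS]mulrCA (mulrC x).
  by case: ifP => _; rewrite ?mule1 ?mule0.
pose G (y : R) := - (c * y)^-1.
have dG (y : R) : 0 < y -> is_derive y (1 : R) G (inversion_weight y).
  move=> y0; have cy0 : c * y != 0 by rewrite mulf_neq0 ?gt_eqF.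
  have dc : is_derive y (1 : R) (fun y : R => c * y) c.
    have := is_deriveZ c (is_derive_id y (1 : R)).
    by move/is_derive_eq; apply; rewrite /GRing.scale/= mulr1.
  have dV := is_deriveV cy0 dc.
  have := is_deriveN dV; rewrite /G; move/is_derive_eq; apply.
  rewrite /inversion_weight scaleNr opprK /GRing.scale/= -exprVn !invfM.
  by field; rewrite !gt_eqF.
have cG (y : R) : 0 < y -> {for y, continuous G}.
  move=> y0; apply: differentiable_continuous; apply/derivable1_diffP.
  exact: (@ex_derive _ _ _ _ _ _ _ (dG y y0)).
have cw (y : R) : 0 < y -> {for y, continuous inversion_weight}.
  move=> y0; apply: cvgV; first by rewrite mulf_neq0 ?expf_neq0 ?gt_eqF.
  by apply: cvgM; [exact: cvg_cst|exact: exprn_continuous].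
rewrite (@ge0_continuous_FTC2y _ _ G _ 0).
- rewrite /G /a sub0e /= opprK; congr (_%:E).
  by field; rewrite !gt_eqF.
- by move=> y _; rewrite inversion_weight_ge0.
- apply/continuous_within_itvcyP; split.
    by move=> y; rewrite in_itv/= andbT => ay; apply: cw; exact: lt_trans ay.
  by apply: cvg_at_right_filter; exact: cw.
- apply/cvgrPdist_lt => e e0; near=> y.
  have y0 : 0 < y by near: y; exact: nbhs_pinfty_gt.
  rewrite sub0r /G opprK ger0_norm ?invr_ge0 ?mulr_ge0 ?ltW//.
  rewrite -div1r ltr_pdivrMr ?mulr_gt0// mulrA mulrC -ltr_pdivrMr ?mulr_gt0//.
  by near: y; apply: nbhs_pinfty_gt; rewrite num_real.
- move=> y ay; apply: (@ex_derive _ _ _ _ _ _ _ (dG y _)); exact: lt_trans ay.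
- by apply: cvg_at_right_filter; exact: cG.
- move=> y; rewrite in_itv/= andbT => ay; rewrite derive1E.
  by have /(@derive_val _ _ _ _ _ _ _) := dG y (lt_trans a0 ay).
Unshelve. all: by end_near. Qed.

(** Uniqueness of measures: the rays are stable under intersection and generate the Borel sets, and
    those ending at a natural number cover the line and have finite measure. *)
Lemma inversion_measureE A : measurable A -> A `<=` D -> inversion_measure A = mu A.
Proof.
move=> mA AD.
have mD : measurable D by [].
suff : inversion_measure A = mrestr mu mD A by rewrite /= /mrestr setIidl.
apply: (@measure_unique _ R RT (@RGenInftyO.G R)
  (fun n => `]-oo, n%:R[%classic) _ _ _ _ inversion_measure (mrestr mu mD)) => //.
- exact: RGenInftyO.measurableE.
- move=> _ _ [x ->] [y ->]; exists (Num.min x y).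
  apply/seteqP; split => z /=; rewrite !in_itv/= lt_min; first by move=> [-> ->].
  by move=> /andP[-> ->].
- by move=> n; exists n%:R.
- rewrite -subTset => x _; exists (Num.truncn `|x|).+1 => //=.
  by rewrite in_itv/= (le_lt_trans (ler_norm x))// truncnS_gt.
- by move=> _ [x ->]; exact: inversion_measure_ray.
- move=> n; suff : (mu (`]-oo, n%:R[%classic `&` D) < +oo)%E.
    by rewrite -inversion_measure_ray.
  apply: (@le_lt_trans _ _ (mu `]0, n%:R[%classic)).
    rewrite le_measure ?inE//; first exact: measurableI.
    by move=> y /=; rewrite !in_itv/= andbT => -[-> ->].
  by rewrite lebesgue_measure_itv/=; case: ifP => _; rewrite ltey.
Qed.

Lemma ge0_integral_inversion (h : R -> \bar R) : measurable_fun D h ->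
  (forall x, (0 < x)%R -> 0 <= h x)%E ->
  (\int[mu]_(x in D) h x =
   \int[mu]_(x in D) ((inversion_weight x)%:E * h (inversion x)))%E.
Proof.
move=> mh h0.
have -> : (\int[mu]_(x in D) h x = \int[inversion_measure]_(x in D) h x)%E.
  by apply: eq_measure_integral => A mA AD; apply/esym/inversion_measureE.
rewrite integral_mkcond integral_inversion_measure; last 2 first.
- by apply/(measurable_restrictT _ _).1.
- move=> x; rewrite patchE; case: ifPn => // /[!inE]/=.
  by rewrite in_itv/= andbT; exact: h0.
apply: eq_integral => x /[!inE]/=; rewrite in_itv/= andbT => x0.
by rewrite patchE mem_set//= in_itv/= andbT inversion_gt0.
Qed.

End InversionMeasure.

(** * Integration of complex functions over the half-line *)

Section HalfLine.
Context {R : realType}.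
Local Notation C := R[i].
Local Notation mu := (@lebesgue_measure R).
Local Notation D := (`]0%R, +oo[%classic : set (measurableTypeR R)).
Local Notation Re := complex.Re.
Local Notation Im := complex.Im.
Implicit Types (u v : R -> C).

Lemma in_half_line (x : R) : D x = (0 < x) :> Prop.
Proof. by rewrite /= in_itv/= andbT. Qed.

Lemma measurable_half_line : measurable D.
Proof. by []. Qed.

(** Dominated convergence for the partial sums. The dominating function is the sum of the absolute
    values, which may be +oo at some points and is therefore kept in the extended reals; the last
    hypothesis and Tonelli for series make it integrable. *)
Lemma cvg_series_Rintegral (u : nat -> R -> R) (v : R -> R) :
  (forall m, measurable_fun D (u m)) ->
  (forall y, 0 < y -> series (u^~ y) @ \oo --> v y) ->
  (\sum_(0 <= m <oo) \int[mu]_(y in D) `|u m y|%:E < +oo)%E ->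
  mu.-integrable D (EFin \o v) /\
  series (fun m => \int[mu]_(y in D) u m y) @ \oo --> \int[mu]_(y in D) v y.
Proof.
move=> mu_ cv fin.
pose g y : \bar R := (\sum_(0 <= m <oo) `|u m y|%:E)%E.
have mabs m : measurable_fun D (fun y => `|u m y|%:E).
  by apply/measurable_EFinP; exact: measurableT_comp.
have iu m : mu.-integrable D (EFin \o u m).
  apply/integrableP; split; first by apply/measurable_EFinP; exact: mu_.
  apply: le_lt_trans fin => /=.
  apply: le_trans (nneseries_lim_ge m.+1 _); last first.
    by move=> n _ _; apply: integral_ge0 => y _; rewrite lee_fin.
  rewrite big_nat_recr//= leeDr// sume_ge0// => n _.
  by apply: integral_ge0 => y _; rewrite lee_fin.
have ig : mu.-integrable D g.
  apply/integrableP; split; first by apply: ge0_emeasurable_sum.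
  under eq_integral.
    move=> y _; rewrite gee0_abs; last by apply: nneseries_ge0.
    over.
  by rewrite integral_nneseries.
pose f_ n y := series (u^~ y) n.
have mf_ n : measurable_fun D (f_ n) by apply: measurable_sum.
have mv : measurable_fun D v.
  by apply: (measurable_fun_cvg (h := f_)) => // y /[!in_half_line]; exact: cv.
have [iv _ cvg_int] : [/\ mu.-integrable D (EFin \o v),
    [sequence \int[mu]_(y in D) (`|(f_ n y)%:E - (v y)%:E|)]_n @ \oo --> 0 &
    [sequence \int[mu]_(y in D) (f_ n y)%:E]_n @ \oo --> \int[mu]_(y in D) (v y)%:E]%E.
  apply: (@dominated_convergence _ _ _ mu D _ (fun n => EFin \o f_ n) (EFin \o v) g) => //.
  - by move=> n; apply/measurable_EFinP; exact: mf_.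
  - by apply/measurable_EFinP; exact: mv.
  - apply: aeW => y /[!in_half_line] y0.
    by apply: cvg_EFin; [exact: nearW|exact: cv].
  - apply: aeW => y n _; rewrite /f_ /series/=; apply: (@le_trans _ _ (\sum_(0 <= m < n) `|u m y|)%:E).
      by rewrite lee_fin ler_norm_sum.
    by rewrite -sumEFin; apply: nneseries_lim_ge.
split => //.
have : (series (fun m => \int[mu]_(y in D) u m y) n)%:E @[n --> \oo] -->
    (\int[mu]_(y in D) v y)%:E.
  rewrite /Rintegral fineK; last exact: integrable_fin_num.
  move: cvg_int; apply: cvg_trans; apply: near_eq_cvg; near=> n.
  rewrite /= /f_ /series/= -sumEFin.
  rewrite [RHS](eq_bigr (fun i => (\int[mu]_(x in D) (u i x)%:E)%E)); last first.
    by move=> i _; rewrite fineK//; apply: integrable_fin_num => //; exact: iu.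
  rewrite -integral_sum//=.
  by apply: eq_integral => y _; rewrite sumEFin.
by move/fine_cvg.
Unshelve. all: by end_near. Qed.

Definition cmeasurable u :=
  measurable_fun D (fun t => Re (u t)) /\ measurable_fun D (fun t => Im (u t)).

Lemma measurable_cabs u : cmeasurable u -> measurable_fun D (fun t => cabs (u t)).
Proof.
move=> [mr mi]; apply: (eq_measurable_fun (fun t => Num.sqrt (Re (u t) ^+ 2 + Im (u t) ^+ 2))).
  by move=> t _; rewrite cabsE.
apply: (@measurableT_comp _ _ _ _ _ _ (@Num.sqrt R)).
  by apply: continuous_measurable_fun; exact: sqrt_continuous.
by apply: measurable_funD; exact: measurable_funX.
Qed.

Lemma cmeasurableM u v : cmeasurable u -> cmeasurable v ->
  cmeasurable (fun t => u t * v t).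
Proof.
move=> [ur ui] [vr vi]; split.
  apply: (eq_measurable_fun (fun t => Re (u t) * Re (v t) - Im (u t) * Im (v t))).
    by move=> t _; rewrite Re_mul.
  by apply: measurable_funB; apply: measurable_funM.
apply: (eq_measurable_fun (fun t => Re (u t) * Im (v t) + Im (u t) * Re (v t))).
  by move=> t _; rewrite Im_mul.
by apply: measurable_funD; apply: measurable_funM.
Qed.

Lemma cmeasurableD u v : cmeasurable u -> cmeasurable v ->
  cmeasurable (fun t => u t + v t).
Proof.
move=> [ur ui] [vr vi]; split.
  apply: (eq_measurable_fun (fun t => Re (u t) + Re (v t))).
    by move=> t _; rewrite ReD.
  exact: measurable_funD.
apply: (eq_measurable_fun (fun t => Im (u t) + Im (v t))).
  by move=> t _; rewrite ImD.
exact: measurable_funD.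
Qed.

Lemma cmeasurable_real (f : R -> R) : measurable_fun D f ->
  cmeasurable (fun t => (f t)%:C).
Proof. by move=> mf; split => //; exact: measurable_cst. Qed.

Lemma cmeasurable_cst (c : C) : cmeasurable (fun=> c).
Proof. by split; exact: measurable_cst. Qed.

Lemma eq_cmeasurable u v : (forall t, 0 < t -> u t = v t) ->
  cmeasurable u -> cmeasurable v.
Proof.
move=> uv [ur ui]; split.
  by apply: eq_measurable_fun ur => t /[!inE]; rewrite in_half_line => /uv ->.
by apply: eq_measurable_fun ui => t /[!inE]; rewrite in_half_line => /uv ->.
Qed.

Lemma open_half_line : open (`]0%R, +oo[%classic : set R).
Proof. exact: interval_open. Qed.

Lemma measurable_continuous (f : R -> R) : (forall x : R, 0 < x -> {for x, continuous f}) ->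
  measurable_fun D f.
Proof.
move=> cf; apply: open_continuous_measurable_fun; first exact: open_half_line.
by move=> x /[!inE]; rewrite in_half_line; exact: cf.
Qed.

Lemma measurable_lnD : measurable_fun D (@ln R).
Proof. by apply: measurable_continuous => x; exact: continuous_ln. Qed.

Lemma cmeasurable_cexp u : cmeasurable u -> cmeasurable (fun t => cexp (u t)).
Proof.
move=> [ur ui]; rewrite /cexp; apply: cmeasurableM.
  apply: (@cmeasurable_real (fun t => expR (Re (u t)))).
  by apply: (@measurableT_comp _ _ _ _ _ _ (@expR R)).
split => /=.
  apply: (@measurableT_comp _ _ _ _ _ _ (@cos R)) => //.
  by apply: continuous_measurable_fun; exact: continuous_cos.
apply: (@measurableT_comp _ _ _ _ _ _ (@sin R)) => //.
by apply: continuous_measurable_fun; exact: continuous_sin.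
Qed.

Lemma cmeasurable_cpow (s : C) : cmeasurable (fun t => cpow t s).
Proof.
apply: cmeasurable_cexp; apply: cmeasurableM; first exact: cmeasurable_cst.
by apply: cmeasurable_real; exact: measurable_lnD.
Qed.

Definition cintegrable u := cmeasurable u /\
  (\int[mu]_(t in D) (cabs (u t))%:E < +oo)%E.

Lemma cintegrable_Re u : cintegrable u -> mu.-integrable D (fun t => (Re (u t))%:E).
Proof.
move=> [mu_ fu]; apply/integrableP; split.
  by apply/measurable_EFinP; exact: mu_.1.
apply: le_lt_trans fu; apply: ge0_le_integral => //.
- by apply/measurable_EFinP; apply: measurableT_comp => //; exact: mu_.1.
- by apply/measurable_EFinP; exact: measurable_cabs.
- by move=> t _; rewrite lee_fin Re_le_cabs.
Qed.

Lemma cintegrable_Im u : cintegrable u -> mu.-integrable D (fun t => (Im (u t))%:E).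
Proof.
move=> [mu_ fu]; apply/integrableP; split.
  by apply/measurable_EFinP; exact: mu_.2.
apply: le_lt_trans fu; apply: ge0_le_integral => //.
- by apply/measurable_EFinP; apply: measurableT_comp => //; exact: mu_.2.
- by apply/measurable_EFinP; exact: measurable_cabs.
- by move=> t _; rewrite lee_fin Im_le_cabs.
Qed.

Lemma cintegrable_cabs u : cintegrable u -> mu.-integrable D (fun t => (cabs (u t))%:E).
Proof.
move=> [mu_ fu]; apply/integrableP; split.
  by apply/measurable_EFinP; exact: measurable_cabs.
by under eq_integral do rewrite gee0_abs ?lee_fin ?cabs_ge0//.
Qed.

Lemma cintegrable_ReIm u : mu.-integrable D (fun t => (Re (u t))%:E) ->
  mu.-integrable D (fun t => (Im (u t))%:E) -> cintegrable u.
Proof.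
move=> iR iI; have mu_ : cmeasurable u.
  split; apply/measurable_EFinP; first exact: measurable_int iR.
  exact: measurable_int iI.
split => //.
have i2 := integrableD measurable_half_line (integrable_abse iR) (integrable_abse iI).
have /integrableP[_] := i2; apply: le_lt_trans.
apply: ge0_le_integral => //.
- by move=> t _; rewrite lee_fin cabs_ge0.
- by apply/measurable_EFinP; exact: measurable_cabs.
- by apply: measurableT_comp => //; exact: measurable_int i2.
- by move=> t _; apply: le_trans (lee_abs _); rewrite lee_fin cabs_le_ReIm.
Qed.

Lemma cintegrable_le u (g : R -> R) : cmeasurable u ->
  mu.-integrable D (fun t => (g t)%:E) ->
  (forall t, 0 < t -> cabs (u t) <= g t) -> cintegrable u.
Proof.
move=> mu_ /integrableP[mg gfin] ug; split => //.
apply: le_lt_trans gfin; apply: ge0_le_integral => //.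
- by move=> t _; rewrite lee_fin cabs_ge0.
- by apply/measurable_EFinP; exact: measurable_cabs.
- exact: measurableT_comp.
- move=> t; rewrite in_half_line => t0; rewrite lee_fin.
  exact: le_trans (ug _ t0) (ler_norm _).
Qed.

Lemma eq_cintegral u v : (forall t, 0 < t -> u t = v t) ->
  cintegral D u = cintegral D v.
Proof.
move=> uv; rewrite /cintegral; congr (_ +i* _); apply: eq_Rintegral => t;
  by rewrite inE in_half_line => /uv ->.
Qed.

Lemma cintegralD u v : cintegrable u -> cintegrable v ->
  cintegral D (fun t => u t + v t) = cintegral D u + cintegral D v.
Proof.
move=> iu iv; apply: complexP; rewrite ?ReD ?ImD /=.
  under eq_Rintegral do rewrite ReD.
  by apply: RintegralD => //; exact: cintegrable_Re.
under eq_Rintegral do rewrite ImD.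
by apply: RintegralD => //; exact: cintegrable_Im.
Qed.

Lemma cintegralZ (c : C) u : cintegrable u ->
  cintegral D (fun t => c * u t) = c * cintegral D u.
Proof.
move=> iu; have iR := cintegrable_Re iu; have iI := cintegrable_Im iu.
have iRZ k := integrableZl measurable_half_line k iR.
have iIZ k := integrableZl measurable_half_line k iI.
apply: complexP; rewrite ?Re_mul ?Im_mul /=.
  under eq_Rintegral do rewrite Re_mul.
  rewrite (@RintegralB _ _ _ mu D (fun x => Re c * Re (u x)) (fun x => Im c * Im (u x)))//;
    [|exact: iRZ|exact: iIZ].
  by congr (_ - _); rewrite RintegralZl.
under eq_Rintegral do rewrite Im_mul.
rewrite (@RintegralD _ _ _ mu D (fun x => Re c * Im (u x)) (fun x => Im c * Re (u x)))//;
  [|exact: iIZ|exact: iRZ].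
by congr (_ + _); rewrite RintegralZl.
Qed.

Lemma cintegrableZ (c : C) u : cintegrable u -> cintegrable (fun t => c * u t).
Proof.
move=> [mu_ fu]; split.
  by apply: cmeasurableM => //; exact: cmeasurable_cst.
under eq_integral do rewrite cabsM EFinM.
rewrite ge0_integralZl_EFin ?cabs_ge0//.
- by apply: lte_mul_pinfty; rewrite ?lee_fin ?cabs_ge0.
- by move=> t _; rewrite lee_fin cabs_ge0.
- by apply/measurable_EFinP; exact: measurable_cabs.
Qed.

Lemma cvg_series_cintegral (u : nat -> R -> C) v :
  (forall m, cmeasurable (u m)) ->
  (forall t, 0 < t -> csummable (u^~ t) /\ csum (u^~ t) = v t) ->
  (\sum_(0 <= m <oo) \int[mu]_(t in D) (cabs (u m t))%:E < +oo)%E ->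
  cintegrable v /\ csum (fun m => cintegral D (u m)) = cintegral D v.
Proof.
move=> mu_ sv fin.
have bnd (p : nat -> R -> R) : (forall m, measurable_fun D (p m)) ->
    (forall m t, `|p m t| <= cabs (u m t)) ->
    (\sum_(0 <= m <oo) \int[mu]_(t in D) `|p m t|%:E < +oo)%E.
  move=> mp pu; apply: le_lt_trans fin; apply: lee_nneseries => m _.
    by move=> _; apply: integral_ge0 => t _; rewrite lee_fin.
  apply: ge0_le_integral => //.
  - by apply/measurable_EFinP; apply: measurableT_comp => //; exact: mp.
  - by apply/measurable_EFinP; exact: measurable_cabs.
  - by move=> t _; rewrite lee_fin.
have [iR cR] : mu.-integrable D (EFin \o (fun t => Re (v t))) /\
    series (fun m => \int[mu]_(y in D) Re (u m y)) @ \oo --> \int[mu]_(y in D) Re (v y).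
  apply: (@cvg_series_Rintegral (fun m t => Re (u m t))).
  - by move=> m; exact: (mu_ m).1.
  - by move=> t /sv[/csummable_cvg[h _] <-].
  - by apply: bnd => [m|m t]; [exact: (mu_ m).1|exact: Re_le_cabs].
have [iI cI] : mu.-integrable D (EFin \o (fun t => Im (v t))) /\
    series (fun m => \int[mu]_(y in D) Im (u m y)) @ \oo --> \int[mu]_(y in D) Im (v y).
  apply: (@cvg_series_Rintegral (fun m t => Im (u m t))).
  - by move=> m; exact: (mu_ m).2.
  - by move=> t /sv[/csummable_cvg[_ h] <-].
  - by apply: bnd => [m|m t]; [exact: (mu_ m).2|exact: Im_le_cabs].
by split; [exact: cintegrable_ReIm|exact: csumE].
Qed.

(** Comparison with M / (1 + x^2), whose integral over the half-line is finite. The decay estimates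
    below become integrability through this bound. *)
Lemma integrable_bounded_oneDsqr (f : R -> R) (M : R) : measurable_fun D f ->
  (forall x, 0 < x -> `|f x| * (1 + x ^+ 2) <= M) ->
  mu.-integrable D (fun t => (f t)%:E).
Proof.
move=> mf fM.
have i1 : mu.-integrable D (fun t => (M * (oneDsqr t)^-1)%:E).
  apply: (@integrableZl _ _ _ mu D _ M (fun t => ((oneDsqr t)^-1)%:E)) => //.
  apply: (@integrableS _ _ _ mu `[0%R, +oo[%classic) => //.
    by move=> x /=; rewrite !in_itv/= !andbT; exact: ltW.
  apply/integrableP; split.
    apply/measurable_EFinP; apply: measurable_funTS; apply: continuous_measurable_fun.
    exact: continuous_oneDsqrV.
  under eq_integral do rewrite gee0_abs ?lee_fin ?invr_ge0 ?addr_ge0 ?sqr_ge0//.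
  by rewrite integral0y_oneDsqr ltey.
apply: le_integrable i1 => //; first by apply/measurable_EFinP; exact: mf.
move=> x; rewrite in_half_line => x0; rewrite lee_fin.
apply: le_trans (ler_norm _); rewrite ler_pdivlMr//; exact: fM.
Qed.

End HalfLine.

(** * The kernel of the incomplete Gamma function and its Fubini theorem *)

Section Kernel.
Context {R : realType}.
Local Notation mu := (@lebesgue_measure R).
Local Notation RT := (measurableTypeR R).
Local Notation D := (`]0%R, +oo[%classic : set (measurableTypeR R)).

(** With d <= 1 and d <= c/(n+1), one has d (1 + t) <= 1 + ct/(n+1) <= exp(ct/(n+1)); the n-th power
    is at most exp(ct), which leaves the constant d^(-n). Using n + 1 keeps the quotient meaningful
    at n = 0. *)
Lemma exprn_le_expR (n : nat) (c : R) : 0 < c ->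
  exists2 M : R, 0 < M & forall t : R, 0 <= t -> (1 + t) ^+ n <= M * expR (c * t).
Proof.
move=> c0; have n0 : (0 : R) < n.+1%:R by rewrite ltr0n.
pose d : R := Num.min 1 (c / n.+1%:R).
have d0 : 0 < d by rewrite lt_min ltr01 divr_gt0.
exists (d^-1 ^+ n); first by rewrite exprn_gt0// invr_gt0.
move=> t t0; apply: (@le_trans _ _ ((d^-1 * expR (c / n.+1%:R * t)) ^+ n)).
  apply: lerXn2r; rewrite ?nnegrE ?addr_ge0 ?mulr_ge0 ?invr_ge0 ?expR_ge0 ?(ltW d0)//.
  rewrite ler_pdivlMl//; apply: le_trans (expR_ge1Dx _).
  rewrite mulrDr mulr1 lerD ?ge_min ?lexx// ler_wpM2r// ge_min lexx orbT.
  by [].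
rewrite exprMn ler_wpM2l ?exprn_ge0 ?invr_ge0 ?(ltW d0)//.
rewrite -expRM_natl ler_expR mulrA ler_wpM2r// mulrCA -[leRHS]mulr1.
by rewrite ler_wpM2l ?(ltW c0)// ler_pdivrMr// mul1r ler_nat.
Qed.

Lemma exprz_le_exprn (x : R) (k : int) : 1 <= x -> x ^ k <= x ^+ `|k|%N.
Proof.
move=> x1; case: k => n; rewrite ?absz_nat// NegzE abszN absz_nat -exprnN.
apply: (@le_trans _ _ 1); first by rewrite invf_le1 ?exprn_gt0 ?exprn_ege1 ?(lt_le_trans ltr01).
by rewrite exprn_ege1.
Qed.

Lemma exprz_continuous (k : int) (x : R) : 0 < x -> {for x, continuous (fun y : R => y ^ k)}.
Proof.
move=> x0; case: k => n; first exact: exprn_continuous.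
rewrite NegzE; have -> : (fun y : R => y ^ (- n.+1%:Z)) = (fun y => (y ^+ n.+1)^-1).
  by apply/funext => y; rewrite -exprnN.
by apply: cvgV; [rewrite expf_neq0 ?gt_eqF | exact: exprn_continuous].
Qed.

Lemma measurable_exprz_1D (k : int) : measurable_fun D (fun t : R => (1 + t) ^ k).
Proof.
apply: measurable_continuous => x x0.
apply: (@continuous_comp R R R (fun t : R => 1 + t) (fun y : R => y ^ k)).
  by apply: cvgD; [exact: cvg_cst|exact: cvg_id].
by apply: exprz_continuous; rewrite addr_gt0.
Qed.

(** As a function of t, the integrand of the incomplete Gamma function after a substitution; as a
    function of y, the Laplace kernel at A (2t + 1) with the weight of the b(n) series. Exchanging t
    and y passes from the Fourier term to the term of L_f. *)
Definition kern (A : R) (k : int) (t y : R) : R :=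
  expR (- (A * (2 * t + 1) * y)) * ((1 + t) ^ k)^-1.

Definition kern_integral (A : R) (k : int) (y : R) : R := \int[mu]_(t in D) kern A k t y.

Lemma kern_ge0 A k t y : 0 < t -> 0 <= kern A k t y.
Proof. by move=> t0; rewrite mulr_ge0 ?expR_ge0// invr_ge0 exprz_ge0// addr_ge0// ltW. Qed.

Lemma measurable_kern A k y : measurable_fun D (fun t => kern A k t y).
Proof.
apply: measurable_funM.
  apply: (@measurableT_comp _ _ _ _ _ _ (@expR R)) => //.
  apply: measurable_continuous => t _; apply: cvgN; apply: cvgM; last exact: cvg_cst.
  apply: cvgM; first exact: cvg_cst.
  by apply: cvgD; [apply: cvgM; [exact: cvg_cst|exact: cvg_id]|exact: cvg_cst].
apply: (eq_measurable_fun (fun t : R => (1 + t) ^ (- k))); first by move=> t _; rewrite invr_expz.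
exact: measurable_exprz_1D.
Qed.

Lemma integrable_kern (A : R) k (y : R) : 0 < A -> 0 < y ->
  mu.-integrable D (fun t => (kern A k t y)%:E).
Proof.
move=> A0 y0; have Ay0 : 0 < 2 * (A * y) by rewrite !mulr_gt0.
(* |k| powers of 1 + t bound (1 + t)^(-k) and two more bound 1 + t^2; the factor exp(-2Aty) of the
   kernel absorbs them all. *)
have [M M0 HM] := exprn_le_expR (`|(- k)%R| + 2)%N Ay0.
apply: (@integrable_bounded_oneDsqr _ _ M) => [|t t0]; first exact: measurable_kern.
rewrite ger0_norm ?kern_ge0// /kern invr_expz.
have t1 : 1 <= 1 + t by rewrite lerDl ltW.
apply: (@le_trans _ _ (expR (- (A * (2 * t + 1) * y)) * (M * expR (2 * (A * y) * t)))).
  rewrite -[leLHS]mulrA ler_wpM2l ?expR_ge0//; apply: le_trans (HM t (ltW t0)).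
  rewrite exprD ler_pM ?exprz_ge0 ?addr_ge0 ?sqr_ge0 ?(ltW t0) ?exprz_le_exprn//.
  by rewrite sqrrD expr1n mul1r lerD2r lerDl mulrn_wge0// ltW.
rewrite mulrCA -expRD -[leRHS]mulr1 ler_wpM2l ?(ltW M0)// -[leRHS]expR0 ler_expR.
rewrite (_ : _ + _ = - (A * y)); last by ring.
by rewrite oppr_le0 ltW// mulr_gt0.
Qed.

Lemma kern_integralE (A : R) k (y : R) : 0 < A -> 0 < y ->
  (\int[mu]_(t in D) (kern A k t y)%:E = (kern_integral A k y)%:E)%E.
Proof.
move=> A0 y0; rewrite /kern_integral /Rintegral fineK//.
by apply: integrable_fin_num => //; exact: integrable_kern.
Qed.

Lemma kern_integral_ge0 A k y : 0 <= kern_integral A k y.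
Proof. by apply: Rintegral_ge0 => t; rewrite in_half_line => t0; exact: kern_ge0. Qed.

(** The substitution u = x (1 + t) sends [0, oo[ to [x, oo[; then exp(-x (1 + t)) exp(x/2) =
    exp(-(x/2) (2t + 1)), which is the exponential of the kernel with A = x/2 and y = 1. *)
Lemma Gamma_inc_kern (k : int) (x : R) : 0 < x ->
  Gamma_inc (1 - k) x * expR (x / 2) = x ^ (1 - k) * kern_integral (x / 2) k 1.
Proof.
move=> x0; rewrite /Gamma_inc /kern_integral (_ : 1 - k - 1 = - k); last by ring.
pose G u : R := expR (- u) * u ^ (- k).
pose F t : R := x * (1 + t).
have cG (u : R) : 0 < u -> {for u, continuous G}.
  move=> u0; apply: cvgM; last exact: exprz_continuous.
  apply: (@continuous_comp R R R (fun u => - u) (@expR R)); last exact: continuous_expR.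
  exact: opp_continuous.
have dF (t : R) : is_derive t (1 : R) F x.
  have := is_deriveZ x (is_deriveD (is_derive_cst (1 : R) t (1 : R)) (is_derive_id t (1 : R))).
  by move/is_derive_eq; apply; rewrite add0r /GRing.scale/= mulr1.
have F'E : derive1 F = cst x.
  by apply/funext => t; rewrite derive1E; exact: (@derive_val _ _ _ _ _ _ _ (dF t)).
have F0 : F 0 = x by rewrite /F addr0 mulr1.
have cF : continuous F.
  move=> t; apply: differentiable_continuous; apply/derivable1_diffP.
  exact: (@ex_derive _ _ _ _ _ _ _ (dF t)).
have H : (\int[mu]_(u in `[F 0%R, +oo[) (G u)%:E =
          \int[mu]_(t in `[0%R, +oo[) (((G \o F) * derive1 F) t)%:E)%E.
  apply: increasing_ge0_integration_by_substitutiony.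
  - by move=> s t _ _ st; rewrite /F ltr_pM2l// ltrD2l.
  - by move=> t _; rewrite F'E; exact: cvg_cst.
  - by rewrite F'E; exact: is_cvg_cst.
  - by rewrite F'E; exact: is_cvg_cst.
  - split; last by apply: cvg_at_right_filter; exact: cF.
    by move=> t _; exact: (@ex_derive _ _ _ _ _ _ _ (dF t)).
  - apply/cvgryPge => M; near=> t; rewrite /F -ler_pdivrMl// -lerBlDl.
    by near: t; apply: nbhs_pinfty_ge; rewrite num_real.
  - rewrite F0; apply/continuous_within_itvcyP; split.
      by move=> u; rewrite in_itv/= andbT => xu; apply: cG; exact: lt_trans xu.
    by apply: cvg_at_right_filter; exact: cG.
  - move=> u; rewrite F0 in_itv/= andbT => xu.
    by rewrite /G mulr_ge0 ?expR_ge0// exprz_ge0// ltW// (lt_trans x0).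
rewrite F0 in H.
have -> : \int[mu]_(t in `[x, +oo[) (expR (- t) * t ^ (- k)) =
   fine (\int[mu]_(u in `[x, +oo[) (G u)%:E) by [].
rewrite H F'E.
have Ei (t : R) : 0 < t -> ((G \o F) * cst x) t =
    (expR (- (x / 2)) * x ^ (1 - k)) * kern (x / 2) k t 1.
  move=> t0; have -> : ((G \o F) * cst x) t = G (F t) * x by [].
  rewrite /kern /G /F expfzMl expfzDr ?gt_eqF// expr1z invr_expz.
  rewrite (_ : - (x * (1 + t)) = - (x / 2) + - (x / 2 * (2 * t + 1) * 1)); last by field.
  by rewrite expRD; ring.
have c0 : 0 <= expR (- (x / 2)) * x ^ (1 - k).
  by rewrite mulr_ge0 ?expR_ge0// exprz_ge0// ltW.
have mk := measurable_kern (x / 2) k 1.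
rewrite -integral_itv_obnd_cbnd; last first.
  apply/measurable_EFinP.
  apply: (eq_measurable_fun (fun t : R => (expR (- (x / 2)) * x ^ (1 - k)) * kern (x / 2) k t 1)).
    by move=> t; rewrite inE in_half_line => t0; rewrite -Ei.
  exact: measurable_funM.
have -> : (\int[mu]_(t in `]0%R, +oo[) (((G \o F) * cst x) t)%:E =
    (expR (- (x / 2)) * x ^ (1 - k) * kern_integral (x / 2) k 1)%:E)%E.
  rewrite EFinM -kern_integralE ?divr_gt0//.
  rewrite -ge0_integralZl_EFin//.
  - by apply: eq_integral => t; rewrite inE in_half_line => t0; rewrite Ei// EFinM.
  - by move=> t; rewrite in_half_line => t0; rewrite lee_fin kern_ge0.
  - by apply/measurable_EFinP; exact: mk.
rewrite -/(kern_integral _ _ _) [fine _]/(expR (- (x / 2)) * x ^ (1 - k) * kern_integral (x / 2) k 1).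
by rewrite mulrC !mulrA -expRD addrN expR0 mul1r.
Unshelve. all: by end_near. Qed.

Lemma kern_integral_scale A k y : kern_integral A k y = kern_integral (A * y) k 1.
Proof.
rewrite /kern_integral; apply: eq_Rintegral => t _; rewrite /kern.
by congr (expR _ * _); ring.
Qed.

Section Fubini.
Variables (A : R) (k : int) (A0 : 0 < A).

Let DD : set (RT * RT) := D `*` D.

Let mDD : measurable DD.
Proof. exact: measurableX. Qed.

Let measurable_kernM (p : R -> R) : measurable_fun D p ->
  measurable_fun setT ((fun z : RT * RT => (kern A k z.1 z.2 * p z.2)%:E) \_ DD).
Proof.
move=> mp; apply/(measurable_restrictT _ _).1 => //.
have fstD (g : RT -> R) : measurable_fun D g -> measurable_fun DD (fun z => g z.1).
  move=> mg; apply: (measurable_comp (F := D)) => //.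
    by move=> _ [z [z1 z2] <-].
  exact: measurable_funTS measurable_fst.
have sndD (g : RT -> R) : measurable_fun D g -> measurable_fun DD (fun z => g z.2).
  move=> mg; apply: (measurable_comp (F := D)) => //.
    by move=> _ [z [z1 z2] <-].
  exact: measurable_funTS measurable_snd.
apply/measurable_EFinP; apply: measurable_funM; last exact: sndD.
apply: measurable_funM.
  apply: (@measurableT_comp _ _ _ _ _ _ (@expR R)) => //.
  apply: (eq_measurable_fun (fun z : RT * RT => - (A * (2 * z.1 + 1)) * z.2)).
    by move=> t _ /=; ring.
  apply: measurable_funM; last exact: (sndD id).
  apply: (fstD (fun t => - (A * (2 * t + 1)))).
  apply: measurable_continuous => t _; apply: cvgN; apply: cvgM; first exact: cvg_cst.
  by apply: cvgD; [apply: cvgM; [exact: cvg_cst|exact: cvg_id]|exact: cvg_cst].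
apply: (fstD (fun t => ((1 + t) ^ k)^-1)).
apply: (eq_measurable_fun (fun t : R => (1 + t) ^ (- k))); first by move=> t _; rewrite invr_expz.
exact: measurable_exprz_1D.
Qed.

(** Tonelli and Fubini are applied on the whole plane to functions extended by 0 outside [DD]; this
    and [patch_snd] translate iterated integrals over [D] into that form. *)
Let patch_fst (f : RT * RT -> \bar R) t :
  ((fun t => (\int[mu]_(y in D) f (t, y))%E) \_ D) t = (\int[mu]_y (f \_ DD) (t, y))%E.
Proof.
rewrite [LHS]patchE; case: ifPn => tD.
  rewrite integral_mkcond; apply: eq_integral => y _; rewrite !patchE.
  rewrite (_ : ((t, y) \in DD) = (y \in D))//; move: tD; rewrite inE => tD.
  by apply/idP/idP => /[!inE]; [case|split].
apply/esym; apply: integral0_eq => y _; rewrite patchE ifN//.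
by apply: contra tD; rewrite !inE => -[].
Qed.

Let patch_snd (f : RT * RT -> \bar R) y :
  ((fun y => (\int[mu]_(t in D) f (t, y))%E) \_ D) y = (\int[mu]_t (f \_ DD) (t, y))%E.
Proof.
rewrite [LHS]patchE; case: ifPn => yD.
  rewrite integral_mkcond; apply: eq_integral => t _; rewrite !patchE.
  rewrite (_ : ((t, y) \in DD) = (t \in D))//; move: yD; rewrite inE => yD.
  by apply/idP/idP => /[!inE]; [case|split].
apply/esym; apply: integral0_eq => t _; rewrite patchE ifN//.
by apply: contra yD; rewrite !inE => -[].
Qed.

Lemma kern_tonelli (p : R -> R) : measurable_fun D p -> (forall y, 0 <= p y) ->
  (\int[mu]_(t in D) \int[mu]_(y in D) (kern A k t y * p y)%:E =
   \int[mu]_(y in D) (kern_integral A k y * p y)%:E)%E.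
Proof.
move=> mp p0; rewrite integral_mkcond.
rewrite (eq_integral _ _ (fun t _ => patch_fst (fun z => (kern A k z.1 z.2 * p z.2)%:E) t)).
rewrite (fubini_tonelli ((fun z : RT * RT => (kern A k z.1 z.2 * p z.2)%:E) \_ DD)); last 2 first.
- exact: measurable_kernM.
- move=> z; rewrite patchE; case: ifPn => // /[!inE] -[/= z1 z2].
  by rewrite lee_fin mulr_ge0// kern_ge0 -?in_half_line.
rewrite -(eq_integral _ _ (fun y _ => patch_snd (fun z => (kern A k z.1 z.2 * p z.2)%:E) y)).
rewrite -integral_mkcond; apply: eq_integral => y; rewrite inE in_half_line => y0.
under eq_integral do rewrite EFinM.
rewrite /= ge0_integralZr ?lee_fin//.
- by rewrite kern_integralE.
- by apply/measurable_EFinP; exact: measurable_kern.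
- by move=> t; rewrite in_half_line => t0; rewrite lee_fin kern_ge0.
Qed.

Lemma measurable_kern_integral : measurable_fun D (kern_integral A k).
Proof.
have m1 : measurable_fun D (cst 1 : R -> R) by exact: measurable_cst.
have := measurable_fun_fubini_tonelli_G (m1 := mu)
  ((fun z : RT * RT => (kern A k z.1 z.2 * cst 1 z.2)%:E) \_ DD) (measurable_kernM m1).
have H0 (z : RT * RT) : (0 <= ((fun z => (kern A k z.1 z.2 * cst 1 z.2)%:E) \_ DD) z)%E.
  rewrite patchE; case: ifPn => // /[!inE] -[/= z1 z2].
  by rewrite lee_fin mulr1 kern_ge0 -?in_half_line.
move=> /(_ H0) mG; apply/measurable_EFinP.
apply: (eq_measurable_fun _ _ (measurable_funTS mG)) => y.
rewrite inE => yD; rewrite /fubini_G -patch_snd patchE mem_set//.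
under eq_integral do rewrite /= mulr1.
by rewrite kern_integralE// -in_half_line.
Qed.

(** Used with k = 0, where the kernel is exp(-A (2t + 1) y): it makes the Laplace transform of [p]
    at A (2t + 1) measurable in t. *)
Lemma measurable_kern_integral_fst (p : R -> R) : measurable_fun D p -> (forall y, 0 <= p y) ->
  measurable_fun D (fun t => (\int[mu]_(y in D) (kern A k t y * p y)%:E)%E).
Proof.
move=> mp p0.
have H0 (z : RT * RT) : (0 <= ((fun z => (kern A k z.1 z.2 * p z.2)%:E) \_ DD) z)%E.
  rewrite patchE; case: ifPn => // /[!inE] -[/= z1 z2].
  by rewrite lee_fin mulr_ge0// kern_ge0 -?in_half_line.
have := measurable_fun_fubini_tonelli_F (m2 := mu)
  ((fun z : RT * RT => (kern A k z.1 z.2 * p z.2)%:E) \_ DD) (measurable_kernM mp) H0.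
move=> mG; apply: (eq_measurable_fun _ _ (measurable_funTS mG)) => t.
rewrite inE => tD.
by rewrite /fubini_F -(patch_fst (fun z => (kern A k z.1 z.2 * p z.2)%:E)) patchE mem_set.
Qed.

Lemma kern_fubini (p : R -> R) : measurable_fun D p ->
  (\int[mu]_(y in D) (kern_integral A k y * `|p y|)%:E < +oo)%E ->
  (\int[mu]_(t in D) \int[mu]_(y in D) (kern A k t y * p y)%:E =
   \int[mu]_(y in D) (kern_integral A k y * p y)%:E)%E.
Proof.
move=> mp fin; rewrite integral_mkcond.
have mabs : measurable_fun D (fun y => `|p y|) by exact: measurableT_comp.
rewrite (eq_integral _ _ (fun t _ => patch_fst (fun z => (kern A k z.1 z.2 * p z.2)%:E) t)).
(* Integrability on the product is Tonelli applied to |p|, which turns [fin] into a bound for the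
   double integral. *)
rewrite (@Fubini _ _ _ _ _ mu mu ((fun z : RT * RT => (kern A k z.1 z.2 * p z.2)%:E) \_ DD)); last first.
  apply/integrable12ltyP; first exact: measurable_kernM.
  rewrite -kern_tonelli// integral_mkcond in fin.
  rewrite (eq_integral _ _ (fun t _ => patch_fst (fun z => (kern A k z.1 z.2 * `|p z.2|)%:E) t)) in fin.
  apply: le_lt_trans fin; rewrite le_eqVlt; apply/orP; left; apply/eqP.
  apply: eq_integral => t _; apply: eq_integral => y _; rewrite !patchE.
  case: ifPn => [/[!inE] -[/= t0 _]|_]; last exact: abse0.
  by rewrite /= normrM ger0_norm// kern_ge0 -?in_half_line.
rewrite -(eq_integral _ _ (fun y _ => patch_snd (fun z => (kern A k z.1 z.2 * p z.2)%:E) y)).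
rewrite -integral_mkcond; apply: eq_integral => y; rewrite inE in_half_line => y0.
under eq_integral do rewrite EFinM.
by rewrite /= integralZr ?kern_integralE//; exact: integrable_kern.
Qed.

End Fubini.
End Kernel.

(** * Local boundedness and measurability of piecewise smooth functions *)

Section PiecewiseSmooth.
Context {R : realType}.
Local Notation C := R[i].
Local Notation RT := (measurableTypeR R).
Local Notation D := (`]0%R, +oo[%classic : set (measurableTypeR R)).
Local Notation Re := complex.Re.
Local Notation Im := complex.Im.

Lemma smooth_continuous (u : R -> C) : smooth u ->
  continuous (fun t => Re (u t)) /\ continuous (fun t => Im (u t)).
Proof.
by move=> su; split=> x; apply: differentiable_continuous; apply/derivable1_diffP;
  have [] := su 0%N x.
Qed.

Lemma continuous_bounded (f : R -> R) (a b : R) : a <= b -> continuous f ->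
  exists M : R, forall x, a <= x <= b -> `|f x| <= M.
Proof.
move=> ab cf.
have cn : continuous (fun x => `|f x|) by move=> x; apply: cvg_norm; exact: cf.
have [c _ Hc] := EVT_max ab (continuous_subspaceT cn).
by exists `|f c| => x xab; apply: Hc; rewrite in_itv.
Qed.

Section Pieces.
Variables (phi : R -> C) (beta : R).

Let pieces (alpha : R) (t : seq R) := forall i, (i < size t)%N ->
  exists u : R -> C, smooth u /\
    forall x, nth beta (alpha :: t) i < x < nth beta t i -> phi x = u x.

(** Induction on the partition. On an open piece the function agrees with some [u] continuous up to
    the end points; the value at a break point is free and enters the maximum by itself. *)
Lemma pieces_bounded (t : seq R) (alpha : R) : path <%R alpha t ->
  last alpha t = beta -> pieces alpha t ->
  exists M : R, forall x, alpha <= x <= beta -> cabs (phi x) <= M.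
Proof.
elim: t alpha => [alpha _ /= <- _|c t IH alpha /= /andP[ac pt] lt H].
  by exists (cabs (phi alpha)) => x /le_anti ->.
have [M HM] : exists M : R, forall x, c <= x <= beta -> cabs (phi x) <= M.
  by apply: (IH c pt lt) => i it; exact: (H i.+1 it).
have [u [su Hu]] := H 0%N isT.
have [cr ci] := smooth_continuous su.
have [M1 HM1] := continuous_bounded (ltW ac) cr.
have [M2 HM2] := continuous_bounded (ltW ac) ci.
exists (Num.max M (Num.max (cabs (phi alpha)) (M1 + M2))) => x /andP[ax xb].
rewrite !le_max; have [cx|xc] := leP c x; first by rewrite HM ?cx// orTb.
move: ax; rewrite le_eqVlt => /predU1P[<-|ax]; first by rewrite lexx orbT.
rewrite (Hu x) /=; last by rewrite ax xc.
apply/orP; right; apply/orP; right; apply: (le_trans (cabs_le_ReIm _)).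
by rewrite lerD ?HM1 ?HM2 ?(ltW ax) ?(ltW xc).
Qed.

Lemma pieces_measurable (t : seq R) (alpha : R) : path <%R alpha t ->
  last alpha t = beta -> pieces alpha t ->
  measurable_fun (`[alpha, beta]%classic : set RT) (fun x : RT => Re (phi x)) /\
  measurable_fun (`[alpha, beta]%classic : set RT) (fun x : RT => Im (phi x)).
Proof.
elim: t alpha => [alpha _ /= <- _|c t IH alpha /= /andP[ac pt] lt H].
  by rewrite set_itv1; split; exact: measurable_fun_set1.
have [mr mi] : measurable_fun (`[c, beta]%classic : set RT) (fun x : RT => Re (phi x)) /\
    measurable_fun (`[c, beta]%classic : set RT) (fun x : RT => Im (phi x)).
  by apply: (IH c pt lt) => i it; exact: (H i.+1 it).
have [u [su Hu]] := H 0%N isT.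
have [cr ci] := smooth_continuous su.
have cb : c <= beta.
  rewrite -lt; elim: t c pt {IH lt H ac mr mi Hu} => //= c' t IH c /andP[cc' pt].
  exact: le_trans (ltW cc') (IH _ pt).
have -> : `[alpha, beta]%classic = `[alpha, alpha]%classic `|` (`]alpha, c[%classic `|` `[c, beta]%classic) :> set RT.
  apply/seteqP; split=> x /=; rewrite !in_itv/=.
    move=> /andP[ax xb]; have [cx|xc] := leP c x; first by right; right; rewrite xb.
    have [xa|xa] := eqVneq alpha x; first by left; rewrite xa lexx.
    by right; left; rewrite lt_neqAle xa ax.
  move=> [/andP[ax xa]|[/andP[ax xc]|/andP[cx xb]]].
  - by rewrite ax (le_trans xa)// (le_trans (ltW ac)).
  - by rewrite (ltW ax) (le_trans (ltW xc)).
  - by rewrite xb (le_trans (ltW ac)).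
have piece (p q : R -> R) : (forall x, alpha < x < c -> p x = q x) -> continuous q ->
    measurable_fun (`]alpha, c[%classic : set RT) p.
  move=> pq cq; apply: (@eq_measurable_fun _ _ _ _ _ q).
    by move=> x; rewrite inE/= in_itv/= => /pq ->.
  by apply: measurable_funTS; exact: continuous_measurable_fun.
have mU : measurable (`]alpha, c[%classic `|` `[c, beta]%classic : set RT).
  exact: measurableU.
split.
  apply/measurable_funU => //; split; first by rewrite set_itv1; exact: measurable_fun_set1.
  apply/measurable_funU => //; split => //.
  by apply: (piece _ (fun t => Re (u t))) => // x /Hu /= ->.
apply/measurable_funU => //; split; first by rewrite set_itv1; exact: measurable_fun_set1.
apply/measurable_funU => //; split => //.
by apply: (piece _ (fun t => Im (u t))) => // x /Hu /= ->.
Qed.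

End Pieces.

Lemma piecewise_smooth_bounded (phi : R -> C) (alpha beta : R) :
  piecewise_smooth phi -> 0 < alpha -> alpha < beta ->
  exists M : R, forall x, alpha <= x <= beta -> cabs (phi x) <= M.
Proof.
move=> ps a0 ab; have [t [[pt /eqP lt] H]] := ps _ _ a0 ab.
exact: (pieces_bounded pt lt H).
Qed.

Lemma piecewise_smooth_measurable (phi : R -> C) :
  piecewise_smooth phi -> cmeasurable phi.
Proof.
move=> ps.
(* The shift by 2 keeps the end points distinct already at n = 0, as [piecewise_smooth] demands. *)
pose I (n : nat) : set RT := `[(n.+2%:R)^-1, n.+2%:R]%classic.
have DE : D = \bigcup_n I n.
  apply/seteqP; split=> x /=; rewrite in_itv/= andbT.
    move=> x0; exists (maxn (Num.truncn x) (Num.truncn x^-1)) => //=.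
    rewrite /I/= in_itv/=; apply/andP; split.
      rewrite -[leRHS]invrK lef_pV2 ?posrE ?invr_gt0//.
      rewrite (le_trans (ltW (truncnS_gt _)))// ler_nat ltnS.
      by rewrite leqW ?leq_maxr.
    rewrite (le_trans (ltW (truncnS_gt _)))// ler_nat ltnS.
    by rewrite leqW ?leq_maxl.
  by move=> [n _]; rewrite /I/= in_itv/= => /andP[+ _]; apply: lt_le_trans; rewrite invr_gt0.
have mI n : measurable_fun (I n) (fun x : RT => Re (phi x)) /\
            measurable_fun (I n) (fun x : RT => Im (phi x)).
  have n0 : (0 : R) < (n.+2%:R)^-1 by rewrite invr_gt0.
  have n1 : (n.+2%:R)^-1 < n.+2%:R :> R.
    by rewrite (@lt_trans _ _ 1)// ?ltr1n// invf_lt1// ltr1n.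
  have [t [[pt /eqP lt] H]] := ps _ _ n0 n1.
  exact: (pieces_measurable pt lt H).
have mmI n : measurable (I n) by exact: measurable_itv.
split; rewrite DE.
  by apply/(measurable_fun_bigcup _ mmI) => n; exact: (mI n).1.
by apply/(measurable_fun_bigcup _ mmI) => n; exact: (mI n).2.
Qed.

End PiecewiseSmooth.

(** * Linearity and reindexing of complex series *)

Section ComplexSums.
Context {R : realType}.
Local Notation C := R[i].
Local Notation Re := complex.Re.
Local Notation Im := complex.Im.

Lemma cvg_csum (u : nat -> C) (l : C) : (series u : nat -> C^o) @ \oo --> (l : C^o) ->
  csummable u /\ csum u = l.
Proof. by move=> h; split; [apply/cvg_ex; exists l|exact: (@cvg_lim C^o)]. Qed.

Lemma csumZ (c : C) (u : nat -> C) : csummable u ->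
  csummable (fun m => c * u m) /\ csum (fun m => c * u m) = c * csum u.
Proof.
move=> /csummable_cvg[hr hi]; apply: cvg_csum; apply: cvg_ReIm.
- rewrite (_ : (fun n => Re _) = (fun n => Re c * series (fun n => Re (u n)) n -
     Im c * series (fun n => Im (u n)) n)); last first.
    by apply/funext => n; rewrite /series /= -mulr_sumr Re_mul Re_sum Im_sum.
  by rewrite Re_mul; apply: cvgB; apply: cvgM => //; exact: cvg_cst.
- rewrite (_ : (fun n => Im _) = (fun n => Re c * series (fun n => Im (u n)) n +
     Im c * series (fun n => Re (u n)) n)); last first.
    by apply/funext => n; rewrite /series /= -mulr_sumr Im_mul Re_sum Im_sum.
  by rewrite Im_mul; apply: cvgD; apply: cvgM => //; exact: cvg_cst.
Qed.

Lemma series_shift (d : nat) (u v : nat -> C) : (forall m, v (m + d)%N = u m) ->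
  (forall m, (m < d)%N -> v m = 0) ->
  forall n, series v (n + d)%N = series u n.
Proof.
move=> vu v0 n; rewrite /series /= (big_cat_nat (n := d))//= ?leq_addl//.
rewrite big_nat_cond big1 ?add0r; last by move=> i; rewrite andbT => /andP[_ /v0].
by rewrite -{1}[d]add0n big_addn addnK; apply: eq_bigr => i _; rewrite vu.
Qed.

Lemma csum_shift (d : nat) (u v : nat -> C) : (forall m, v (m + d)%N = u m) ->
  (forall m, (m < d)%N -> v m = 0) ->
  (csummable u -> csummable v /\ csum v = csum u) /\
  (csummable v -> csummable u /\ csum u = csum v).
Proof.
move=> vu v0; have E := series_shift vu v0.
have Ef : (fun n => series v (n + d)%N) = series u by exact/funext.
have S (l : C^o) : ((series u : nat -> C^o) @ \oo --> l) = ((series v : nat -> C^o) @ \oo --> l).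
  by rewrite -Ef; exact: (@cvg_shiftn d C^o (series v) (nbhs l)).
split=> h; apply: cvg_csum; first by rewrite -S.
by rewrite S.
Qed.

(** The two indexings differ by leading zero terms; both are compared with the series that starts at
    -(n0 + n1). *)
Lemma fourier_hol_index (n0 n1 : nat) (a : int -> C) z :
  (forall n, n < - n0%:Z -> a n = 0) -> (forall n, n < - n1%:Z -> a n = 0) ->
  csummable (fourier_hol n1 a z) ->
  csummable (fourier_hol n0 a z) /\
  csum (fourier_hol n0 a z) = csum (fourier_hol n1 a z).
Proof.
move=> a0 a1 s1.
have E (p q : nat) : (forall n, n < - p%:Z -> a n = 0) ->
    (forall m, fourier_hol (p + q) a z (m + q)%N = fourier_hol p a z m) /\
    (forall m, (m < q)%N -> fourier_hol (p + q) a z m = 0).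
  move=> ap; split=> m; rewrite /fourier_hol /idx_ge.
    by rewrite !PoszD opprD addrACA subrr addr0.
  by move=> mq; rewrite ap ?mul0r//; rewrite PoszD opprD addrCA -[ltRHS]addr0 ltrD2l subr_lt0 ltz_nat.
have [E1 E2] := E n0 n1 a0; have [E3 E4] := E n1 n0 a1.
have [sN cN] := (csum_shift E3 E4).1 s1.
rewrite addnC in sN cN.
have [s0 c0] := (csum_shift E1 E2).2 sN.
by split => //; rewrite c0 cN.
Qed.

End ComplexSums.

(** * Terms of the L-series as integrals along the imaginary axis *)

Section LIntegral.
Context {R : realType}.
Local Notation C := R[i].
Local Notation mu := (@lebesgue_measure R).
Local Notation D := (`]0%R, +oo[%classic : set (measurableTypeR R)).
Local Notation Re := complex.Re.
Local Notation Im := complex.Im.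
Implicit Types (k : int) (phi : R -> C).

Lemma qexp_imag (n : int) (y : R) :
  qexp n (0 +i* y) = (expR (- (2 * pi * n%:~R * y)))%:C.
Proof.
rewrite /qexp -cexp_real; congr cexp; apply: complexP; rewrite ?Re_mul ?Im_mul /=; ring.
Qed.

Lemma cintegral0 : cintegral D (fun=> 0) = 0 :> C.
Proof. by apply: complexP => /=; rewrite /Rintegral integral0_eq. Qed.

Lemma twist_int k phi (y : R) : 0 < y ->
  twist (2 - k)%:~R phi y = (y ^ (1 - k))%:C * phi y.
Proof.
move=> y0; rewrite /twist mulrC -cpow_int//; congr (cpow _ _ * _).
by rewrite !rmorphB /=; ring.
Qed.

(** This is 2 pi |n| for n = [idx_neg m], so that -4 pi n is twice it. *)
Definition freq (m : nat) : R := 2 * pi * m.+1%:R.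

Lemma freq_gt0 m : 0 < freq m.
Proof. by rewrite !mulr_gt0 ?pi_gt0. Qed.

Lemma idx_negE m : (idx_neg m)%:~R = - m.+1%:R :> R.
Proof. by rewrite /idx_neg mulrNz. Qed.

(** With x = -4 pi n y the exponential factor at z = iy is exp(x/2), so [Gamma_inc_kern] applies.
    The power y^(1-k) that comes out is the one in [twist (2 - k)%:~R]. *)
Lemma fourier_nonhol_imag k b m (y : R) : 0 < y ->
  fourier_nonhol k b (0 +i* y) m =
  b (idx_neg m) * ((2 * freq m) ^ (1 - k) * (y ^ (1 - k) * kern_integral (freq m) k y))%:C.
Proof.
move=> y0; have f0 := freq_gt0 m.
rewrite /fourier_nonhol qexp_imag -mulrA -rmorphM /=; congr (_ * _%:C).
have -> : - (4 * pi * (idx_neg m)%:~R * y) = 2 * freq m * y.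
  by rewrite idx_negE /freq; ring.
have -> : - (2 * pi * (idx_neg m)%:~R * y) = 2 * freq m * y / 2.
  by rewrite idx_negE /freq; field.
have x0 : 0 < 2 * freq m * y by rewrite mulr_gt0// mulr_gt0.
rewrite Gamma_inc_kern//.
rewrite (_ : 2 * freq m * y / 2 = freq m * y); last by field.
by rewrite -kern_integral_scale expfzMl mulrA.
Qed.

Lemma laplace_real phi (x : R) : laplace phi x%:C =
  cintegral D (fun t => (expR (- (x * t)))%:C * phi t).
Proof.
rewrite /laplace; congr cintegral; apply/funext => t.
by rewrite -rmorphN -rmorphM /= cexp_real mulNr.
Qed.

Lemma measurable_expRM (x : R) : measurable_fun D (fun t => expR (- (x * t))).
Proof.
apply: measurable_continuous => t _.
apply: (@continuous_comp R R R (fun t => - (x * t)) (@expR R)); last exact: continuous_expR.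
by apply: cvgN; apply: cvgM; [exact: cvg_cst|exact: cvg_id].
Qed.

Lemma laplace_nonneg_scale phi (c : C) (x : R) : cmeasurable phi ->
  (\int[mu]_(t in D) (cabs (c * ((expR (- (x * t)))%:C * phi t)))%:E =
   (cabs c)%:E * elaplace (fun t => cabs (phi t)) x)%E.
Proof.
move=> mphi; rewrite /elaplace -ge0_integralZl_EFin ?cabs_ge0//.
- by apply: eq_integral => t _; rewrite !cabsM cabs_real ger0_norm ?expR_ge0// EFinM.
- by move=> t _; rewrite lee_fin mulr_ge0 ?expR_ge0 ?cabs_ge0.
- apply/measurable_EFinP; apply: measurable_funM; first exact: measurable_expRM.
  exact: measurable_cabs.
Qed.

Lemma L_hol_integral (n0 : nat) (a : int -> C) phi m : cmeasurable phi ->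
  ((cabs (a (idx_ge n0 m)))%:E *
    elaplace (fun t => cabs (phi t)) (2 * pi * (idx_ge n0 m)%:~R)%R < +oo)%E ->
  cintegral D (fun y => fourier_hol n0 a (0 +i* y) m * phi y) = L_hol n0 a phi m.
Proof.
move=> mphi fin; rewrite /L_hol laplace_real.
pose x := 2 * pi * (idx_ge n0 m)%:~R : R.
rewrite (@eq_cintegral _ _ (fun y => a (idx_ge n0 m) * ((expR (- (x * y)))%:C * phi y))); last first.
  by move=> y _; rewrite /fourier_hol /= qexp_imag mulrA.
(* When the coefficient vanishes the transform may diverge, which the convention 0 * oo = 0 in [fin]
   hides; otherwise [fin] forces the transform to be finite. *)
have [->|an0] := eqVneq (a (idx_ge n0 m)) 0.
  by rewrite mul0r (@eq_cintegral _ _ (fun=> 0)) ?cintegral0// => y _; rewrite mul0r.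
rewrite cintegralZ//; split.
  by apply: cmeasurableM => //; apply: cmeasurable_real; exact: measurable_expRM.
under eq_integral do rewrite cabsM cabs_real ger0_norm ?expR_ge0//.
rewrite -/(elaplace (fun t => cabs (phi t)) _).
move: fin; set E := elaplace _ _.
have E0 : (0 <= E)%E.
  by apply: integral_ge0 => t _; rewrite lee_fin mulr_ge0 ?expR_ge0 ?cabs_ge0.
rewrite !ltey; apply: contra => /eqP ->.
by rewrite gt0_muley// lte_fin lt0r cabs_eq0 an0 cabs_ge0.
Qed.

(** Tonelli in t and y. It shows that the b(n) part of the majorant consists, up to constant
    factors, of L1 norms of terms along the imaginary axis. *)
Lemma elaplace_kern k phi m : cmeasurable phi ->
  (\int[mu]_(t in D) (elaplace (fun t => cabs (phi t))
      (- (2 * pi * (idx_neg m)%:~R * (2 * t + 1)))%R * (((1 + t) ^ k)^-1)%:E) =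
   \int[mu]_(y in D) (kern_integral (freq m) k y * cabs (phi y))%:E)%E.
Proof.
move=> mphi; rewrite -kern_tonelli ?freq_gt0//; last 2 first.
- exact: measurable_cabs.
- by move=> y; exact: cabs_ge0.
apply: eq_integral => t; rewrite inE in_half_line => t0.
have k0 : 0 <= ((1 + t) ^ k)^-1 :> R by rewrite invr_ge0 exprz_ge0// addr_ge0// ltW.
rewrite /elaplace -ge0_integralZr ?lee_fin//; last 2 first.
- apply/measurable_EFinP; apply: measurable_funM; first exact: measurable_expRM.
  exact: measurable_cabs.
- by move=> y _; rewrite lee_fin mulr_ge0 ?expR_ge0 ?cabs_ge0.
apply: eq_integral => y _; rewrite -EFinM; congr (_%:E).
rewrite /kern mulrAC; congr (expR _ * _ * _).
by rewrite idx_negE /freq; ring.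
Qed.

Lemma L_nonhol_integral k (b : int -> C) phi m : cmeasurable phi ->
  (forall s, 0 < complex.Re s -> laplace_abscvg (twist (2 - k)%:~R phi) s) ->
  ((cabs (b (idx_neg m)) * `|4 * pi * (idx_neg m)%:~R| ^ (1 - k))%:E *
    \int[mu]_(t in D) (elaplace (fun t => cabs (twist (2 - k)%:~R phi t))
      (- (2 * pi * (idx_neg m)%:~R * (2 * t + 1)))%R * (((1 + t) ^ k)^-1)%:E) < +oo)%E ->
  cintegral D (fun y => fourier_nonhol k b (0 +i* y) m * phi y) = L_nonhol k b phi m.
Proof.
move=> mphi abscvg fin; have f0 := freq_gt0 m.
pose tw := twist (2 - k)%:~R phi.
have mtw : cmeasurable tw by apply: cmeasurableM => //; exact: cmeasurable_cpow.
have mK := measurable_kern_integral k f0.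
pose c := b (idx_neg m) * ((2 * freq m) ^ (1 - k))%:C.
rewrite (@eq_cintegral _ _ (fun y => c * ((kern_integral (freq m) k y)%:C * tw y))); last first.
  move=> y y0; rewrite fourier_nonhol_imag// /tw twist_int// /c !rmorphM /=; ring.
rewrite /L_nonhol /= (_ : - (4 * pi * (idx_neg m)%:~R) = 2 * freq m); last first.
  by rewrite idx_negE /freq; ring.
rewrite -/c.
have [c0|c0] := eqVneq c 0.
  by rewrite c0 mul0r (@eq_cintegral _ _ (fun=> 0)) ?cintegral0// => y _; rewrite mul0r.
have fin' : (\int[mu]_(y in D) (kern_integral (freq m) k y * cabs (tw y))%:E < +oo)%E.
  move: fin; rewrite elaplace_kern//; set E := integral _ _ _.
  have E0 : (0 <= E)%E.
    by apply: integral_ge0 => t _; rewrite lee_fin mulr_ge0 ?kern_integral_ge0 ?cabs_ge0.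
  rewrite !ltey; apply: contra => /eqP ->.
  rewrite gt0_muley// lte_fin mulr_gt0//.
    by rewrite lt0r cabs_ge0 cabs_eq0 andbT; apply: contra c0; rewrite /c => /eqP ->; rewrite mul0r.
  by rewrite exprz_gt0// normr_gt0 idx_negE mulrN oppr_eq0 gt_eqF// !mulr_gt0 ?pi_gt0.
rewrite cintegralZ; last first.
  split; first by apply: cmeasurableM => //; exact: cmeasurable_real.
  under eq_integral do rewrite cabsM cabs_real ger0_norm ?kern_integral_ge0//.
  exact: fin'.
congr (c * _).
have itw (x : R) : 0 < x -> cintegrable (fun y => (expR (- (x * y)))%:C * tw y).
  move=> x0; split.
    by apply: cmeasurableM => //; apply: cmeasurable_real; exact: measurable_expRM.
  have /integrableP[_] := abscvg x%:C x0; apply: le_lt_trans.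
  rewrite le_eqVlt; apply/orP; left; apply/eqP; apply: eq_integral => t _.
  rewrite gee0_abs ?lee_fin ?cabs_ge0//; congr ((cabs (_ * _))%:E).
  by rewrite -rmorphN -rmorphM /= cexp_real mulNr.
(* Fubini for a real function bounded by |tw|, later its real and imaginary parts. Integrability at
   each x > 0 allows the weight (1 + t)^(-k) to leave the inner integral. *)
have fubini_real (p : R -> R) : measurable_fun D p -> (forall y, `|p y| <= cabs (tw y)) ->
    (forall x, 0 < x -> mu.-integrable D (fun y => (expR (- (x * y)) * p y)%:E)) ->
    \int[mu]_(y in D) (kern_integral (freq m) k y * p y) =
    \int[mu]_(t in D) ((\int[mu]_(y in D) (expR (- ((freq m * (2 * t + 1)) * y)) * p y)) / (1 + t) ^ k).
  move=> mp pt ip; rewrite [LHS]/Rintegral -kern_fubini//; last first.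
    apply: le_lt_trans fin'; apply: ge0_le_integral => //.
    - by move=> y _; rewrite lee_fin mulr_ge0 ?kern_integral_ge0.
    - by apply/measurable_EFinP; apply: measurable_funM => //; exact: measurableT_comp.
    - by apply/measurable_EFinP; apply: measurable_funM => //; exact: measurable_cabs.
    - by move=> y _; rewrite lee_fin ler_wpM2l ?kern_integral_ge0.
  congr fine; apply: eq_integral => t; rewrite inE in_half_line => t0.
  have x0 : 0 < freq m * (2 * t + 1) by rewrite mulr_gt0// addr_gt0// mulr_gt0.
  rewrite EFinM fineK; last by apply: integrable_fin_num => //; exact: ip.
  rewrite -integralZr//; last exact: ip.
  by apply: eq_integral => y _; rewrite /kern -EFinM mulrAC.
have LE t : - (2 * pi * (idx_neg m)%:~R * (2 * t + 1)) = freq m * (2 * t + 1).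
  by rewrite idx_negE /freq; ring.
rewrite /cintegral; congr (_ +i* _).
- under eq_Rintegral do rewrite Re_realM.
  rewrite fubini_real; last 3 first.
  + exact: mtw.1.
  + by move=> y; exact: Re_le_cabs.
  + move=> x x0; apply: eq_integrable (cintegrable_Re (itw x x0)) => // y _.
    by rewrite Re_realM.
  apply: eq_Rintegral => t _; rewrite LE laplace_real -fmorphV [X in Re X]mulrC Re_realM [RHS]mulrC.
  congr (_ / _); apply: eq_Rintegral => y _.
  by rewrite Re_realM.
- under eq_Rintegral do rewrite Im_realM.
  rewrite fubini_real; last 3 first.
  + exact: mtw.2.
  + by move=> y; exact: Im_le_cabs.
  + move=> x x0; apply: eq_integrable (cintegrable_Im (itw x x0)) => // y _.
    by rewrite Im_realM.
  apply: eq_Rintegral => t _; rewrite LE laplace_real -fmorphV [X in Im X]mulrC Im_realM [RHS]mulrC.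
  congr (_ / _); apply: eq_Rintegral => y _.
  by rewrite Im_realM.
Qed.

End LIntegral.

(** * Termwise integration, and vanishing of coefficients by growth *)

Section LSeries.
Context {R : realType}.
Local Notation C := R[i].
Local Notation mu := (@lebesgue_measure R).
Local Notation D := (`]0%R, +oo[%classic : set (measurableTypeR R)).
Local Notation Im := complex.Im.

Lemma nneseries_term_lty (u : nat -> \bar R) : (forall m, 0 <= u m)%E ->
  (\sum_(0 <= m <oo) u m < +oo)%E -> forall m, (u m < +oo)%E.
Proof.
move=> u0 fin m; apply: le_lt_trans fin.
apply: le_trans (nneseries_lim_ge m.+1 _); last by [].
by rewrite big_nat_recr//= leeDr// sume_ge0.
Qed.

Lemma csumZr (c : C) (u : nat -> C) : csummable u ->
  csummable (fun m => u m * c) /\ csum (fun m => u m * c) = csum u * c.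
Proof.
move=> /(csumZ c); rewrite mulrC (_ : (fun m => c * u m) = (fun m => u m * c))//.
by apply/funext => m; rewrite mulrC.
Qed.

(** Finiteness of the majorant is the domination hypothesis of [cvg_series_cintegral] for both
    series. The expansion starts at -n1 while L starts at -n0; the vanishing of [a] below -n0 makes
    the two sums equal. *)
Lemma L_integral (k : int) (n0 n1 : nat) (a b : int -> C) (h : C -> C) (phi : R -> C) :
  fourier_expansion k n1 a b h -> (forall n, n < - n0%:Z -> a n = 0) ->
  test_function k n0 a b phi ->
  L k n0 a b phi = cintegral D (fun y => h (0 +i* y) * phi y).
Proof.
move=> [a1 ch cn hE] a0 [ps _ lt].
have mphi := piecewise_smooth_measurable ps.
have mtw : cmeasurable (twist (2 - k)%:~R phi).
  by apply: cmeasurableM => //; exact: cmeasurable_cpow.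
rewrite /majorant_cvg; set S1 := limn _; set S2 := limn _ => fin.
have e0 (p : R -> C) x : (0 <= elaplace (fun t => cabs (p t)) x)%E.
  by apply: integral_ge0 => t _; rewrite lee_fin mulr_ge0 ?expR_ge0 ?cabs_ge0.
have t1_ge0 m : (0 <= (cabs (a (idx_ge n0 m)))%:E *
    elaplace (fun t => cabs (phi t)) (2 * pi * (idx_ge n0 m)%:~R)%R)%E.
  by rewrite mule_ge0// lee_fin cabs_ge0.
have t2_ge0 m : (0 <= (cabs (b (idx_neg m)) * `|4 * pi * (idx_neg m)%:~R| ^ (1 - k))%:E *
    \int[mu]_(t in D) (elaplace (fun t => cabs (twist (2 - k)%:~R phi t))
      (- (2 * pi * (idx_neg m)%:~R * (2 * t + 1)))%R * (((1 + t) ^ k)^-1)%:E))%E.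
  rewrite mule_ge0// ?lee_fin ?mulr_ge0 ?cabs_ge0 ?exprz_ge0//.
  apply: integral_ge0 => t; rewrite in_half_line => t0.
  by rewrite mule_ge0// lee_fin invr_ge0 exprz_ge0// addr_ge0// ltW.
have S10 : (0 <= S1)%E by apply: nneseries_ge0.
have S20 : (0 <= S2)%E by apply: nneseries_ge0.
have fin1 : (S1 < +oo)%E by apply: le_lt_trans fin; rewrite leeDl.
have fin2 : (S2 < +oo)%E by apply: le_lt_trans fin; rewrite leeDr.
have y0H (y : R) : 0 < y -> 0 < Im (0 +i* y) by [].
have [i1 E1] : cintegrable (fun y => csum (fourier_hol n0 a (0 +i* y)) * phi y) /\
    csum (fun m => cintegral D (fun y => fourier_hol n0 a (0 +i* y) m * phi y)) =
    cintegral D (fun y => csum (fourier_hol n0 a (0 +i* y)) * phi y).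
  apply: cvg_series_cintegral.
  - move=> m; apply: (@eq_cmeasurable _ (fun y => a (idx_ge n0 m) *
        ((expR (- (2 * pi * (idx_ge n0 m)%:~R * y)))%:C * phi y))).
      by move=> y _; rewrite /fourier_hol /= qexp_imag mulrA.
    apply: cmeasurableM; first exact: cmeasurable_cst.
    by apply: cmeasurableM => //; apply: cmeasurable_real; exact: measurable_expRM.
  - move=> y y0; apply: csumZr.
    exact: (fourier_hol_index a0 a1 (ch _ (y0H _ y0))).1.
  - apply: le_lt_trans fin1; rewrite le_eqVlt; apply/orP; left; apply/eqP.
    apply: eq_eseriesr => m _; rewrite -laplace_nonneg_scale//.
    by apply: eq_integral => y _; rewrite /fourier_hol /= qexp_imag mulrA.
have [i2 E2] : cintegrable (fun y => csum (fourier_nonhol k b (0 +i* y)) * phi y) /\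
    csum (fun m => cintegral D (fun y => fourier_nonhol k b (0 +i* y) m * phi y)) =
    cintegral D (fun y => csum (fourier_nonhol k b (0 +i* y)) * phi y).
  have E m y : 0 < y -> fourier_nonhol k b (0 +i* y) m * phi y =
      (b (idx_neg m) * ((2 * freq m) ^ (1 - k))%:C) *
      ((kern_integral (freq m) k y)%:C * twist (2 - k)%:~R phi y).
    move=> y0; rewrite fourier_nonhol_imag// twist_int// !rmorphM /=; ring.
  apply: cvg_series_cintegral.
  - move=> m; apply: eq_cmeasurable => [y y0|]; first by rewrite E.
    apply: cmeasurableM; first exact: cmeasurable_cst.
    apply: cmeasurableM => //; apply: cmeasurable_real.
    exact: measurable_kern_integral (freq_gt0 m).
  - by move=> y y0; apply: csumZr; exact: cn.
  - apply: le_lt_trans fin2; rewrite le_eqVlt; apply/orP; left; apply/eqP.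
    apply: eq_eseriesr => m _; rewrite elaplace_kern//.
    have c0 : 0 < 2 * freq m :> R by rewrite mulr_gt0// freq_gt0.
    have -> : `|4 * pi * (idx_neg m)%:~R| = 2 * freq m :> R.
      by rewrite -normrN idx_negE -[RHS](ger0_norm (ltW c0)); congr (`|_|); rewrite /freq; ring.
    rewrite -ge0_integralZl_EFin//; last 3 first.
    + by move=> y _; rewrite lee_fin mulr_ge0 ?kern_integral_ge0 ?cabs_ge0.
    + apply/measurable_EFinP; apply: measurable_funM; last exact: measurable_cabs.
      exact: measurable_kern_integral (freq_gt0 m).
    + by rewrite mulr_ge0 ?cabs_ge0 ?exprz_ge0 ?(ltW c0).
    apply: eq_integral => y; rewrite inE in_half_line => y0.
    rewrite E// !cabsM !cabs_real -EFinM ger0_norm ?exprz_ge0 ?(ltW c0)//.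
    by rewrite ger0_norm ?kern_integral_ge0.
rewrite /L; transitivity (csum (fun m => cintegral D (fun y => fourier_hol n0 a (0 +i* y) m * phi y)) +
    csum (fun m => cintegral D (fun y => fourier_nonhol k b (0 +i* y) m * phi y))).
  congr (csum _ + csum _); apply/funext => m.
    by rewrite L_hol_integral//; exact: (nneseries_term_lty t1_ge0 fin1 m).
  by rewrite L_nonhol_integral//; exact: (nneseries_term_lty t2_ge0 fin2 m).
rewrite E1 E2 -cintegralD//; apply: eq_cintegral => y y0; rewrite hE; last exact: y0H.
by rewrite -mulrDl (fourier_hol_index a0 a1 (ch _ (y0H _ y0))).2.
Qed.

Lemma csum_recl (u : nat -> C) : csummable u ->
  csummable (fun m => u m.+1) /\ csum u = u 0%N + csum (fun m => u m.+1).
Proof.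
move=> su; suff [s1 e1] : csummable (fun m => u m.+1) /\ csum (fun m => u m.+1) = csum u - u 0%N.
  by split => //; rewrite e1 addrC subrK.
apply: cvg_csum.
have -> : series (fun m => u m.+1) = (fun n => series u n.+1 - u 0%N).
  by apply/funext => n; rewrite /series /= big_nat_recl// addrC addKr.
apply: (@cvgB _ C^o); last exact: cvg_cst.
have -> : (fun n => series u n.+1) = (fun n => series u (n + 1)%N).
  by apply/funext => n; rewrite addn1.
by rewrite (@cvg_shiftn 1 C^o (series u) (nbhs (csum u : C^o))).
Qed.

Lemma csummable_bounded (u : nat -> C) : csummable u ->
  exists2 B : R, 0 <= B & forall m, cabs (u m) <= B.
Proof.
move=> /csummable_cvg[hr hi].
have bnd (p : nat -> R) (l : R) : series p @ \oo --> l -> exists M : R, forall m, `|p m| <= M.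
  move=> cp; have cvgp : cvgn p.
    by apply/cvg_ex; exists 0; apply: cvg_series_cvg_0; apply/cvg_ex; exists l.
  by have [M [_ /(_ (M + 1))]] := cvg_seq_bounded cvgp; rewrite ltrDl ltr01 => /(_ isT) H;
    exists (M + 1) => m; exact: H.
have [M1 H1] := bnd _ _ hr; have [M2 H2] := bnd _ _ hi.
exists (M1 + M2); first by apply: le_trans (lerD (H1 0%N) (H2 0%N)); rewrite addr_ge0.
by move=> m; apply: le_trans (cabs_le_ReIm _) _; exact: lerD.
Qed.

(** The geometric bound sums to B for the real and for the imaginary part separately, hence the
    factor 2. *)
Lemma cabs_csum_le (u : nat -> C) (B : R) : csummable u ->
  (forall m, cabs (u m) <= B * 2^-1 ^+ m.+1) -> cabs (csum u) <= 2 * B.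
Proof.
move=> /csummable_cvg[hr hi] uB.
have B0 : 0 <= B.
  have := le_trans (cabs_ge0 _) (uB 0%N); rewrite expr1 pmulr_lge0// invr_gt0//.
have bnd (p : nat -> R) (l : R) : (forall m, `|p m| <= cabs (u m)) ->
    series p @ \oo --> l -> `|l| <= B.
  move=> pu /cvg_norm cp; rewrite -(cvg_lim _ cp)//; apply: limr_le.
    by apply/cvg_ex; exists `|l|.
  apply: nearW => n; rewrite /series /=; apply: le_trans (ler_norm_sum _ _ _) _.
  apply: (@le_trans _ _ (B * (1 - 2^-1 ^+ n))).
    elim: n => [|n IH]; first by rewrite big_geq// expr0 subrr mulr0.
    rewrite big_nat_recr//=; apply: (le_trans (lerD IH (le_trans (pu n) (uB n)))).
    by rewrite -mulrDr ler_wpM2l// exprS; lra.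
  by rewrite -[leRHS]mulr1 ler_wpM2l// gerBl exprn_ge0// invr_ge0.
rewrite mulr_natl mulr2n; apply: (le_trans (cabs_le_ReIm _)); apply: lerD.
  by apply: bnd hr => m; exact: Re_le_cabs.
by apply: bnd hi => m; exact: Im_le_cabs.
Qed.

(** The integrands compare pointwise: (2t + 1) y - (2t + 1) - (y - 1) = 2t (y - 1), which is
    nonnegative for y >= 1. *)
Lemma kern_integral_decay (A : R) k (y : R) : 0 < A -> 1 <= y ->
  kern_integral A k y <= expR (- (A * (y - 1))) * kern_integral A k 1.
Proof.
move=> A0 y1; have y0 : 0 < y by exact: lt_le_trans y1.
rewrite /kern_integral -RintegralZl//; last exact: integrable_kern.
apply: le_Rintegral => //; first exact: integrable_kern.
  by apply: (@integrableZl _ _ _ mu D _ _ (fun t => (kern A k t 1)%:E)) => //; exact: integrable_kern.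
move=> t; rewrite in_half_line => t0.
rewrite /kern mulrA -expRD ler_wpM2r ?invr_ge0 ?exprz_ge0 ?addr_ge0 ?(ltW t0)//.
rewrite ler_expR -subr_ge0.
rewrite (_ : _ - _ = A * (2 * t) * (y - 1)); last by ring.
by rewrite !mulr_ge0 ?subr_ge0 ?(ltW A0) ?(ltW t0).
Qed.

(** exp(-x) <= 1/2 because exp(x) >= 1 + x >= 2; this is used on m of the m + 1 factors, and one
    full exp(-x) is kept. *)
Lemma half_expR_le (x : R) (m : nat) : 1 <= x ->
  expR (- (x * m.+1%:R)) <= expR (- x) * 2 * 2^-1 ^+ m.+1.
Proof.
move=> x1; rewrite exprS mulrA mulfK// -addn1 natrD mulrDr mulr1 addrC opprD expRD.
rewrite ler_wpM2l ?expR_ge0// -mulNr mulrC expRM_natl lerXn2r ?nnegrE ?expR_ge0 ?invr_ge0//.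
rewrite expRN lef_pV2 ?posrE ?expR_gt0//; apply: le_trans (expR_ge1Dx _); lra.
Qed.

Lemma exprz_le_1D (y : R) (n : int) : 1 <= y -> y ^ n <= (1 + y) ^+ `|n|%N.
Proof.
move=> y1; apply: (le_trans (exprz_le_exprn _ y1)).
have y0 : 0 <= y := le_trans ler01 y1.
by rewrite lerXn2r ?nnegrE ?addr_ge0// lerDr.
Qed.

(** Exponential decay beats even one power more, (1 + y)^(N+1), so x (1 + y) stays below the
    constant L; taking y >= L/x contradicts this when x > 0. *)
Lemma expR_growth_eq0 (x K Y : R) (N : nat) : 0 <= x -> 0 <= K ->
  (forall y, Y <= y -> 2 <= y -> x <= K * (1 + y) ^+ N * expR (- (y - 1))) -> x = 0.
Proof.
move=> x0 K0 H; have [M M0 HM] := @exprn_le_expR R N.+1 1 ltr01.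
apply/eqP; rewrite eq_le x0 andbT leNgt; apply/negP => xp.
pose L := K * M * expR 1.
have L0 : 0 <= L by rewrite !mulr_ge0 ?expR_ge0// ltW.
pose y := Num.max (Num.max Y 2) (L / x).
have yY : Y <= y by rewrite !le_max lexx.
have y2 : 2 <= y by rewrite !le_max lexx orbT.
have yL : L / x <= y by rewrite !le_max lexx !orbT.
have y0 : 0 <= y := le_trans (ler0n _ 2) y2.
have y1 : 0 < 1 + y by rewrite ltr_pwDl.
suff : x * (1 + y) <= L.
  apply/negP; rewrite -ltNge mulrDr mulr1; apply: (le_lt_trans (y := x * y)).
    by rewrite mulrC -ler_pdivrMr.
  by rewrite ltrDr.
apply: (le_trans (ler_wpM2r (ltW y1) (H y yY y2))).
rewrite (_ : _ * (1 + y) = K * ((1 + y) ^+ N.+1 * expR (- (y - 1)))); last first.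
  by rewrite exprSr; ring.
rewrite /L -mulrA ler_wpM2l//; apply: (le_trans (ler_wpM2r (expR_ge0 _) (HM y y0))).
by rewrite mul1r -mulrA -expRD (_ : y + - (y - 1) = 1)//; ring.
Qed.

(** If [a] vanishes below -d with d > n0, the term at -d is [h] minus the other terms, all small
    compared with exp(2 pi d y), so a(-d) = 0. Finitely many d have to be treated, because the
    expansion starts at -n1. *)
Lemma fourier_support (k : int) (n0 n1 : nat) (a b : int -> C) (h : C -> C) :
  fourier_expansion k n1 a b h -> bigO_im h (fun y => expR (2 * pi * n0%:R * y)) ->
  forall n, n < - n0%:Z -> a n = 0.
Proof.
move=> [a1 ch cn hE] [M hM].
suff key (d : nat) : (n0 < d)%N -> (forall n, n < - d%:Z -> a n = 0) -> a (- d%:Z) = 0.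
  (* The induction counts in j how far -d may still lie above -n1; for j = 0 the support of the
     expansion concludes. *)
  have down (j d : nat) : (n0 < d)%N -> (n1 < d + j)%N -> forall n, n <= - d%:Z -> a n = 0.
    elim: j d => [|j IH] d n0d n1d n nd; first by apply: a1; lia.
    have ad m : m < - d%:Z -> a m = 0 by move=> md; apply: (IH d.+1) => //; lia.
    have [->|nd'] := eqVneq n (- d%:Z); first exact: key.
    by apply: ad; lia.
  by move=> n nn0; apply: (down n1 n0.+1); lia.
move=> n0d ad.
have y0H (y : R) : 0 < y -> 0 < Im (0 +i* y) by [].
have hd (y : R) (y0 : 0 < y) := fourier_hol_index ad a1 (ch _ (y0H y y0)).
(* Coefficients are controlled through the bounded terms at y = 1; passing to y brings an explicit
   exponential factor, and for the second series also y^(1-k). *)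
have [C1 C1_ge0 HC1] := csummable_bounded (hd 1 ltr01).1.
have [C2 C2_ge0 HC2] := csummable_bounded (cn _ (y0H 1 ltr01)).
have [Y [_ HY]] := hM.
pose N := `|(1 - k)%R|%N.
apply/eqP; rewrite -cabs_eq0; apply/eqP.
apply: (@expR_growth_eq0 _ (`|M| + 4 * C1 + 4 * C2) (Y + 1) N); first exact: cabs_ge0.
  by rewrite !addr_ge0 ?mulr_ge0.
move=> y yY y2; set q := expR _.
have y0 : 0 < y by apply: lt_le_trans y2.
have y1 : 1 <= y by apply: le_trans y2; rewrite ler1n.
have p2 : 2 <= pi :> R by exact: pi_ge2.
(* Here y >= 2 enters: with 2 pi (y - 1) >= 1 the tails are dominated by a geometric series of ratio
   1/2. *)
have py1 : 1 <= 2 * pi * (y - 1) by nra.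
have q0 : 0 <= q by exact: expR_ge0.
have pN : 1 <= (1 + y) ^+ N by rewrite exprn_ege1// lerDl ltW.
have rq (m : nat) : expR (- (2 * pi * m.+1%:R * (y - 1))) <= 2 * q * 2^-1 ^+ m.+1.
  rewrite mulrAC; apply: (le_trans (half_expR_le _ py1)).
  rewrite [2 * q]mulrC ler_wpM2r ?exprn_ge0 ?invr_ge0// ler_wpM2r// ler_expR lerN2.
  rewrite -[leLHS]mul1r ler_wpM2r ?subr_ge0//; lra.
pose E := expR (2 * pi * d%:R * y).
have E0 : 0 < E by exact: expR_gt0.
have [sT eT] := csum_recl (hd y y0).1.
have tail : cabs (csum (fun m => fourier_hol d a (0 +i* y) m.+1)) <= 2 * (C1 * E * (2 * q)).
  apply: cabs_csum_le => // m.
  rewrite -mulrA; apply: (@le_trans _ _ (C1 * E * expR (- (2 * pi * m.+1%:R * (y - 1))))); last first.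
    by rewrite ler_wpM2l ?mulr_ge0// ltW.
  have := HC1 m.+1; rewrite /fourier_hol /= !qexp_imag !cabsM !cabs_real !ger0_norm ?expR_ge0//.
  move=> HC; rewrite (_ : expR (- (2 * pi * (idx_ge d m.+1)%:~R * y)) =
     expR (- (2 * pi * (idx_ge d m.+1)%:~R * 1)) *
     (expR (2 * pi * d%:R * (y - 1)) * expR (- (2 * pi * m.+1%:R * (y - 1))))); last first.
    by rewrite -!expRD /idx_ge intrD mulrNz /=; congr expR; rewrite -!pmulrn; ring.
  rewrite [leLHS]mulrA -[leRHS]mulrA; apply: ler_pM; rewrite ?mulr_ge0 ?cabs_ge0 ?expR_ge0//.
  rewrite ler_wpM2r ?expR_ge0// ler_expR ler_wpM2l ?gerBl//.
  by rewrite !mulr_ge0 ?pi_ge0.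
have nonhol : cabs (csum (fourier_nonhol k b (0 +i* y))) <= 2 * (C2 * (1 + y) ^+ N * (2 * q)).
  apply: cabs_csum_le => [|m]; first exact: cn.
  have := HC2 m; rewrite !fourier_nonhol_imag// !cabsM !cabs_real.
  rewrite exp1rz mul1r => HC.
  have f0 := @freq_gt0 R m.
  have c0 : 0 <= (2 * @freq R m) ^ (1 - k) by rewrite exprz_ge0// mulr_ge0// ltW.
  have z0 : 0 <= y ^ (1 - k) by rewrite exprz_ge0// ltW.
  rewrite ger0_norm ?mulr_ge0 ?kern_integral_ge0//.
  rewrite ger0_norm ?mulr_ge0 ?kern_integral_ge0// in HC.
  apply: (@le_trans _ _ (C2 * ((1 + y) ^+ N * expR (- (@freq R m * (y - 1)))))); last first.
    rewrite [leLHS]mulrA -[leRHS]mulrA; apply: ler_wpM2l; last by rewrite /freq; exact: rq.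
    by rewrite mulr_ge0 ?exprn_ge0 ?addr_ge0 ?(ltW y0).
  apply: (@le_trans _ _ (cabs (b (idx_neg m)) * ((2 * @freq R m) ^ (1 - k) * kern_integral (@freq R m) k 1) *
      (y ^ (1 - k) * expR (- (@freq R m * (y - 1)))))); last first.
    apply: ler_pM; rewrite ?mulr_ge0 ?cabs_ge0 ?kern_integral_ge0 ?expR_ge0//.
    by apply: ler_wpM2r; rewrite ?expR_ge0// exprz_le_1D.
  have KD : kern_integral (@freq R m) k y <=
      kern_integral (@freq R m) k 1 * expR (- (@freq R m * (y - 1))).
    by rewrite mulrC; exact: kern_integral_decay.
  rewrite -[leRHS]mulrA; apply: ler_wpM2l; first exact: cabs_ge0.
  rewrite -[leRHS]mulrA; apply: ler_wpM2l => //; rewrite [leRHS]mulrCA.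
  exact: ler_wpM2l.
have hb : cabs (h (0 +i* y)) <= `|M| * q * E.
  apply: (@le_trans _ _ (M * expR (2 * pi * n0%:R * y))).
    by apply: HY; apply: lt_le_trans yY; rewrite ltrDl.
  apply: (@le_trans _ _ (`|M| * expR (2 * pi * n0%:R * y))).
    by rewrite ler_wpM2r ?expR_ge0// ler_norm.
  rewrite -[leRHS]mulrA; apply: ler_wpM2l => //; rewrite -expRD ler_expR.
  have : n0%:R + 1 <= d%:R :> R by rewrite natr1 ler_nat.
  by move=> dn; nra.
have a0E : cabs (fourier_hol d a (0 +i* y) 0) = cabs (a (- d%:Z)) * E.
  rewrite /fourier_hol /= qexp_imag cabsM cabs_real ger0_norm ?expR_ge0//.
  rewrite /idx_ge add0r; congr (_ * expR _); rewrite mulrNz /=; by rewrite -pmulrn; ring.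
(* After multiplication by E the left side is the modulus of the term at -d, which the expansion
   expresses by h and the two remaining sums. *)
rewrite -(ler_pM2r E0) -a0E.
have -> : fourier_hol d a (0 +i* y) 0 = h (0 +i* y) -
    csum (fun m => fourier_hol d a (0 +i* y) m.+1) - csum (fourier_nonhol k b (0 +i* y)).
  by rewrite hE// -(hd y y0).2 eT; ring.
apply: (le_trans (cabsD _ _)); rewrite cabsN.
apply: (le_trans (lerD (cabsD _ _) (lexx _))); rewrite cabsN.
apply: (le_trans (lerD (lerD hb tail) nonhol)).
have E1 : 1 <= E by rewrite -[leLHS]expR0 ler_expR !mulr_ge0 ?pi_ge0// ltW.
set P := (1 + y) ^+ N in pN *.
have P0 : 0 <= P := le_trans ler01 pN.
(* Each bound is padded with the factors P >= 1 and E >= 1 it lacks, to reach the common shape K P q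
   E. *)
rewrite [leRHS](_ : _ = `|M| * q * E * P + 4 * C1 * q * E * P + 4 * C2 * P * q * E); last by ring.
apply: lerD; [apply: lerD|].
- by rewrite ler_peMr// !mulr_ge0// ltW.
- rewrite (_ : 2 * _ = 4 * C1 * q * E); last by ring.
  by rewrite ler_peMr// !mulr_ge0// ltW.
- rewrite (_ : 2 * _ = 4 * C2 * P * q); last by ring.
  by rewrite ler_peMr// !mulr_ge0.
Qed.

End LSeries.

(** * Mellin transforms are entire *)

Section Entire.
Context {R : realType}.
Local Notation C := R[i].
Local Notation mu := (@lebesgue_measure R).
Local Notation D := (`]0%R, +oo[%classic : set (measurableTypeR R)).
Local Notation Re := complex.Re.

Lemma cintegrableD (u v : R -> C) : cintegrable u -> cintegrable v ->
  cintegrable (fun t => u t + v t).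
Proof.
move=> iu iv; have i2 := integrableD measurable_half_line (cintegrable_cabs iu) (cintegrable_cabs iv).
apply: (cintegrable_le (cmeasurableD iu.1 iv.1) i2) => t _; exact: cabsD.
Qed.

Lemma is_derive_cexp_line (c z : C) (t : R) :
  is_derive t (1 : R) (fun t : R => Re (c * cexp (t%:C * z))) (Re (c * z * cexp (t%:C * z))).
Proof.
case: c z => [c1 c2] [x y].
have E (d1 d2 t' : R) : Re ((d1 +i* d2) * cexp (t'%:C * (x +i* y))) =
    expR (t' * x) * (d1 * cos (t' * y) - d2 * sin (t' * y)).
  by rewrite /cexp Re_mul Re_realM Im_realM Re_realM Im_realM /=; ring.
have -> : (fun t' : R => Re ((c1 +i* c2) * cexp (t'%:C * (x +i* y)))) =
   (fun t' : R => expR (t' * x) * (c1 * cos (t' * y) - c2 * sin (t' * y))).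
  by apply/funext => t'; rewrite E.
have dl (a : R) : is_derive t (1 : R) (fun t : R => t * a) a.
  have := is_deriveZ a (is_derive_id t (1 : R)); move/is_derive_eq => H.
  rewrite (_ : (fun t : R => t * a) = (a \*: id)); last by apply/funext => r; rewrite mulrC.
  by apply: H; rewrite /GRing.scale/= mulr1.
have de := @is_derive1_comp _ expR (fun t : R => t * x) t _ _ (is_derive_expR _) (dl x).
have dc := @is_derive1_comp _ cos (fun t : R => t * y) t _ _ (is_derive_cos _) (dl y).
have ds := @is_derive1_comp _ sin (fun t : R => t * y) t _ _ (is_derive_sin _) (dl y).
have := is_deriveM de (is_deriveB (is_deriveZ c1 dc) (is_deriveZ c2 ds)).
move/is_derive_eq; apply.
rewrite (_ : (c1 +i* c2) * (x +i* y) = (c1 * x - c2 * y) +i* (c1 * y + c2 * x))//.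
rewrite E /GRing.scale/= [(_ - _) t](_ : _ = c1 * cos (t * y) - c2 * sin (t * y))//; ring.
Qed.

(** The mean value theorem twice, on [0, 1] and on [0, c]; the factor c <= 1 is discarded, so B
    stands in place of the sharper B/2. *)
Lemma taylor2_bound (u u' u'' : R -> R) (B : R) :
  (forall t : R, is_derive t (1 : R) u (u' t)) ->
  (forall t : R, is_derive t (1 : R) u' (u'' t)) ->
  (forall t : R, 0 <= t <= 1 -> `|u'' t| <= B) ->
  `|u 1 - u 0 - u' 0| <= B.
Proof.
move=> du du' HB.
have cont (f f' : R -> R) : (forall t : R, is_derive t (1 : R) f (f' t)) -> continuous f.
  move=> df t; apply: differentiable_continuous; apply/derivable1_diffP.
  exact: (@ex_derive _ _ _ _ _ _ _ (df t)).
have [c + ->] := @MVT R u u' 0 1 ltr01 (fun x _ => du x)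
  (continuous_subspaceT (cont _ _ du)).
rewrite in_itv/= => /andP[c0 c1]; rewrite subr0 mulr1.
have [d + ->] := @MVT R u' u'' 0 c c0 (fun x _ => du' x)
  (continuous_subspaceT (cont _ _ du')).
rewrite in_itv/= => /andP[d0 dc]; rewrite subr0 normrM [`|c|]ger0_norm ?(ltW c0)//.
have dB : `|u'' d| <= B by apply: HB; rewrite (ltW d0) (ltW (lt_trans dc c1)).
by apply: (le_trans _ dB); rewrite ler_piMr ?(ltW c1).
Qed.

(** [taylor2_bound] along the segment t z, where the second derivative is the real part of c z^2
    exp(tz), at most |c| |z|^2 exp(|z|). The free factor c lets one statement serve both parts. *)
Lemma Re_cexp_taylor (c z : C) :
  `|Re (c * (cexp z - 1 - z))| <= cabs c * cabs z ^+ 2 * expR (cabs z).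
Proof.
pose u (c : C) (t : R) := Re (c * cexp (t%:C * z)).
have := @taylor2_bound (u c) (u (c * z)) (u (c * z * z)) (cabs c * cabs z ^+ 2 * expR (cabs z))
  (is_derive_cexp_line c z) (is_derive_cexp_line (c * z) z).
rewrite /u mul1r mul0r cexp0 !mulr1.
rewrite (_ : Re (c * cexp z) - Re c - Re (c * z) = Re (c * (cexp z - 1 - z))); last first.
  by rewrite !mulrBr mulr1 !ReD !ReN.
apply => t /andP[t0 t1]; apply: (le_trans (Re_le_cabs _)).
rewrite cabsM cabs_cexp !cabsM expr2 -!mulrA; do 3 (apply: ler_wpM2l; first exact: cabs_ge0).
rewrite ler_expR Re_realM; apply: (@le_trans _ _ (t * cabs z)).
  by apply: ler_wpM2l => //; exact: le_trans (ler_norm _) (Re_le_cabs _).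
by rewrite ler_piMl// cabs_ge0.
Qed.

Lemma cexp_taylor (z : C) : cabs (cexp z - 1 - z) <= 2 * (cabs z ^+ 2 * expR (cabs z)).
Proof.
apply: (le_trans (cabs_le_ReIm _)); rewrite mulr_natl mulr2n; apply: lerD.
  by have := Re_cexp_taylor 1 z; rewrite mul1r cabs1 mul1r.
(* Multiplication by -i turns the imaginary part into a real part. *)
have := Re_cexp_taylor (- 'i) z; rewrite cabsN cabsi mul1r Re_mul /=.
by rewrite oppr0 mul0r add0r mulN1r opprK.
Qed.

Lemma cabs_cintegral (u : R -> C) : cintegrable u ->
  cabs (cintegral D u) <= 2 * \int[mu]_(t in D) cabs (u t).
Proof.
move=> iu; apply: (le_trans (cabs_le_ReIm _)); rewrite mulr_natl mulr2n /=.
have iR := cintegrable_Re iu; have iI := cintegrable_Im iu; have iC := cintegrable_cabs iu.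
apply: lerD; apply: (le_trans (le_normr_Rintegral measurable_half_line _)) => //.
  apply: le_Rintegral => //; first exact: (integrable_norm iR).
  by move=> t _; exact: Re_le_cabs.
apply: le_Rintegral => //; first exact: (integrable_norm iI).
by move=> t _; exact: Im_le_cabs.
Qed.

Section Mellin.
Variables (w : R -> C) (mw : cmeasurable w).
Hypothesis iw : forall s : C, cintegrable (fun y => w y * cpow y s).

Let F (s : C) := cintegral D (fun y => w y * cpow y (s - 1)).
(** The derivative expected from differentiation under the integral sign: y^(s-1) has derivative
    y^(s-1) ln y in s. *)
Let F' (s : C) := cintegral D (fun y => w y * cpow y (s - 1) * (ln y)%:C).

(** exp(3 |ln y|) is y^3 or y^(-3) according to the sign of ln y. A loss of exp(3 |ln y|) thus only
    shifts s - 1 by 3 either way, to the exponents s + 2 and s - 4 in [K]. *)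
Let expR3 (y : R) : 0 < y -> expR (3 * `|ln y|) <= y `^ 3 + y `^ (-3).
Proof.
move=> y0; rewrite /powR gt_eqF//.
have [l0|l0] := leP 0 (ln y); first by rewrite ger0_norm// lerDl expR_ge0.
by rewrite ltr0_norm// mulrN -mulNr lerDr expR_ge0.
Qed.

Let K (s : C) := \int[mu]_(y in D) (cabs (w y * cpow y (s + 2)) + cabs (w y * cpow y (s - 4))).

Let iK (s : C) : mu.-integrable D
  (fun y => (cabs (w y * cpow y (s + 2)) + cabs (w y * cpow y (s - 4)))%:E).
Proof.
apply: (@integrableD _ _ _ mu D _ (fun y => (cabs (w y * cpow y (s + 2)))%:E)
  (fun y => (cabs (w y * cpow y (s - 4)))%:E)) => //; exact: cintegrable_cabs.
Qed.

Let cabs_expR3 (s : C) (y : R) : 0 < y ->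
  cabs (w y * cpow y (s - 1)) * expR (3 * `|ln y|) <=
  cabs (w y * cpow y (s + 2)) + cabs (w y * cpow y (s - 4)).
Proof.
move=> y0; apply: (le_trans (ler_wpM2l (cabs_ge0 _) (expR3 y0))).
rewrite mulrDr ![cabs (w y * _)]cabsM !cabs_cpow// -!mulrA -!powRD ?(gt_eqF y0) ?implybT//.
rewrite !ReD !ReN (_ : Re s - Re 1 + 3 = Re s + Re 2)//; last by rewrite /=; lra.
by rewrite (_ : Re s - Re 1 + -3 = Re s - Re 4)//=; lra.
Qed.

Let sqr_le_expR (x : R) : 0 <= x -> x ^+ 2 <= 4 * expR x.
Proof.
move=> x0; have h : 1 + x / 2 <= expR (x / 2) by exact: expR_ge1Dx.
have -> : expR x = expR (x / 2) ^+ 2 by rewrite expr2 -expRD -splitr.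
have : (1 + x / 2) ^+ 2 <= expR (x / 2) ^+ 2.
  by rewrite lerXn2r ?nnegrE ?expR_ge0 ?addr_ge0 ?divr_ge0.
nra.
Qed.

Let il (s : C) : cintegrable (fun y => w y * cpow y (s - 1) * (ln y)%:C).
Proof.
apply: (cintegrable_le _ (iK s)).
  apply: cmeasurableM; first by apply: cmeasurableM => //; exact: cmeasurable_cpow.
  by apply: cmeasurable_real; exact: measurable_lnD.
move=> y y0; apply: (le_trans _ (cabs_expR3 s y0)).
rewrite cabsM cabs_real ler_wpM2l ?cabs_ge0//.
apply: le_trans (expR_ge1Dx _); have := normr_ge0 (ln y); lra.
Qed.

(** The left side is the modulus of the integral of w(y) y^(s-1) (exp(h ln y) - 1 - h ln y), which
    [cexp_taylor] bounds quadratically in h. The loss in ln y fits in exp(3 |ln y|): one unit for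
    |ln y|^2, two for exp(|h| |ln y|). The constant 16 is 2 * 4 * 2, from [cexp_taylor],
    [sqr_le_expR] and [cabs_cintegral]. *)
Let increment (s h : C) : cabs h <= 1 ->
  cabs (F (h + s) - F s - h * F' s) <= cabs h ^+ 2 * (16 * K s).
Proof.
move=> h1.
have i2 : cintegrable (fun y => - h * (w y * cpow y (s - 1) * (ln y)%:C)) by exact: cintegrableZ.
have i1 : cintegrable (fun y => - 1 * (w y * cpow y (s - 1))) by exact: cintegrableZ.
pose v y := w y * cpow y (s - 1) * (cexp (h * (ln y)%:C) - 1 - h * (ln y)%:C).
have mv : cmeasurable v.
  apply: cmeasurableM; first by apply: cmeasurableM => //; exact: cmeasurable_cpow.
  apply: cmeasurableD; last first.
    apply: (@eq_cmeasurable _ (fun y => - h * (ln y)%:C)); first by move=> y _; rewrite mulNr.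
    apply: cmeasurableM; first exact: cmeasurable_cst.
    by apply: cmeasurable_real; exact: measurable_lnD.
  by apply: cmeasurableD; [exact: (cmeasurable_cpow h)|exact: cmeasurable_cst].
have vle y : 0 < y -> cabs (v y) <= 8 * cabs h ^+ 2 *
    (cabs (w y * cpow y (s + 2)) + cabs (w y * cpow y (s - 4))).
  move=> y0; rewrite /v cabsM.
  apply: (@le_trans _ _ (cabs (w y * cpow y (s - 1)) * (8 * cabs h ^+ 2 * expR (3 * `|ln y|)))).
    apply: ler_wpM2l; first exact: cabs_ge0.
    apply: (le_trans (cexp_taylor _)); rewrite cabsM cabs_real exprMn.
    rewrite (_ : 2 * (_ * _) = cabs h ^+ 2 * (2 * (`|ln y| ^+ 2 * expR (cabs h * `|ln y|)))); last by ring.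
    rewrite (_ : 8 * _ * _ = cabs h ^+ 2 * (8 * expR (3 * `|ln y|))); last by ring.
    apply: ler_wpM2l; first exact: exprn_ge0 (cabs_ge0 _).
    rewrite (_ : 8 * _ = 2 * (4 * expR `|ln y| * expR (2 * `|ln y|))); last first.
      by rewrite (_ : 3 * `|ln y| = `|ln y| + 2 * `|ln y|) ?expRD; ring.
    apply: ler_wpM2l => //; apply: ler_pM; rewrite ?sqr_ge0 ?expR_ge0 ?sqr_le_expR//.
    rewrite ler_expR; apply: ler_wpM2r => //; lra.
  rewrite mulrCA; apply: ler_wpM2l; first by rewrite mulr_ge0 ?exprn_ge0 ?cabs_ge0.
  exact: cabs_expR3.
have iKZ : mu.-integrable D (fun y => (8 * cabs h ^+ 2 *
    (cabs (w y * cpow y (s + 2)) + cabs (w y * cpow y (s - 4))))%:E).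
  exact: (@integrableZl _ _ _ mu D _ _ (fun y =>
    (cabs (w y * cpow y (s + 2)) + cabs (w y * cpow y (s - 4)))%:E)).
have iv : cintegrable v by exact: (cintegrable_le mv iKZ).
have -> : F (h + s) - F s - h * F' s = cintegral D v.
  have -> : F (h + s) - F s - h * F' s =
      cintegral D (fun y => w y * cpow y (h + s - 1)) +
      cintegral D (fun y => - 1 * (w y * cpow y (s - 1))) +
      cintegral D (fun y => - h * (w y * cpow y (s - 1) * (ln y)%:C)).
    by rewrite !cintegralZ// mulN1r mulNr.
  rewrite -cintegralD// -cintegralD//; last first.
    exact: (cintegrableD (iw (h + s - 1)) i1).
  apply: eq_cintegral => y y0; rewrite /v -[h + s - 1]addrA (cpowD y h (s - 1)) -[cexp (h * _)]/(cpow y h); ring.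
apply: (le_trans (cabs_cintegral iv)).
rewrite (_ : cabs h ^+ 2 * (16 * K s) = 2 * (8 * cabs h ^+ 2 * K s)); last by ring.
apply: ler_wpM2l => //; rewrite /K -RintegralZl//; last exact: iK.
apply: le_Rintegral => //; first exact: cintegrable_cabs.
by move=> y; rewrite in_half_line; exact: vle.
Qed.

Lemma entire_mellin : entire F.
Proof.
move=> s; apply/cvg_ex; exists (F' s); apply/cvgrPdist_le => e.
rewrite ltcE /= => /andP[/eqP e0 ep].
have K0 : 0 <= K s by apply: Rintegral_ge0 => y _; rewrite addr_ge0 ?cabs_ge0.
(* The second bound gives |h| * 16 K <= Re e, the added 1 keeping the denominator positive; the
   first lets [increment] apply. *)
pose d : R := Num.min 1 (Re e / (16 * K s + 1)).
have kp : 0 < 16 * K s + 1 by rewrite ltr_pwDr// mulr_ge0.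
have d0 : 0 < d by rewrite lt_min ltr01 divr_gt0.
near=> h.
have hn0 : h != 0 by near: h; exact: (@nbhs_dnbhs_neq C^o 0).
have hd : cabs h <= d.
  rewrite -lecR -normCE; near: h; apply: (@dnbhs0_le C C^o d%:C); by rewrite ltcR.
rewrite normCE lecE /= e0 eqxx /=.
rewrite (_ : h *: (1 : C^o) + s = h + s); last by rewrite /GRing.scale/= mulr1.
rewrite -cabsN opprB.
have -> : h^-1 *: (F (h + s) - F s : C^o) - F' s = h^-1 * (F (h + s) - F s - h * F' s).
  by rewrite /GRing.scale/= [RHS]mulrBr mulrA mulVf// mul1r.
rewrite cabsM cabsV ler_pdivrMl ?lt0r ?cabs_eq0 ?hn0 ?cabs_ge0//.
have h1 : cabs h <= 1 by apply: le_trans hd _; rewrite ge_min lexx.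
apply: (le_trans (increment s h1)).
rewrite expr2 -mulrA; apply: ler_wpM2l; first exact: cabs_ge0.
apply: (@le_trans _ _ (d * (16 * K s + 1))).
  by apply: ler_pM => //; rewrite ?cabs_ge0 ?mulr_ge0// lerDl.
by rewrite -ler_pdivlMr// ge_min lexx orbT.
Unshelve. all: by end_near. Qed.

End Mellin.
End Entire.

(** * Exponential decay at 0 and at infinity *)

Section Decay.
Context {R : realType}.
Local Notation C := R[i].
Local Notation Re := complex.Re.

(** Decay at both ends in one bound; since y + 1/y is invariant under y -> 1/y, the class survives
    inversion. *)
Definition exp_decay (w : R -> C) := exists M d : R,
  [/\ 0 <= M, 0 < d & forall y, 0 < y -> cabs (w y) <= M * expR (- (d * (y + y^-1)))].

(** For y >= 1, y^a is at most (1 + y)^n; for y < 1 it is (1/y)^(-a), at most (1 + 1/y)^n. The other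
    factor is at least 1. *)
Lemma powR_le_exprn (y a : R) (n : nat) : 0 < y -> `|a| <= n%:R ->
  y `^ a <= (1 + y) ^+ n * (1 + y^-1) ^+ n.
Proof.
move=> y0 an; have yi : 0 < y^-1 by rewrite invr_gt0.
have p1 (z : R) : 0 < z -> 1 <= (1 + z) ^+ n by move=> z0; rewrite exprn_ege1// lerDl ltW.
have gen (z b : R) : 1 <= z -> b <= n%:R -> z `^ b <= (1 + z) ^+ n.
  move=> z1 bn; apply: (@le_trans _ _ (z `^ n%:R)); first exact: ler_powR.
  have z0 : 0 <= z := le_trans ler01 z1.
  by rewrite powR_mulrn// lerXn2r ?nnegrE ?addr_ge0// lerDr.
have [y1|y1] := leP 1 y.
  apply: (@le_trans _ _ ((1 + y) ^+ n)); first by apply: gen => //; exact: le_trans (ler_norm _) an.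
  by rewrite ler_peMr ?p1// exprn_ge0// addr_ge0// ltW.
apply: (@le_trans _ _ ((1 + y^-1) ^+ n)).
  have -> : y `^ a = (y^-1) `^ (- a) by rewrite /powR !gt_eqF// lnV ?posrE// mulrNN.
  apply: gen; first by rewrite invf_ge1// ltW.
  by apply: le_trans an; rewrite -normrN ler_norm.
by rewrite ler_peMl ?p1// exprn_ge0// addr_ge0// ltW.
Qed.

(** The modulus of y^s is at most (1 + y)^n (1 + 1/y)^n and 1 + y^2 adds two powers of 1 + y;
    exp(-dy) and exp(-d/y) absorb the two factors separately. *)
Lemma exp_decay_cintegrable (w : R -> C) (s : C) : cmeasurable w -> exp_decay w ->
  cintegrable (fun y => w y * cpow y s).
Proof.
move=> mw [M [d [M0 d0 Hw]]].
pose n := (Num.truncn `|Re s|).+1.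
have sn : `|Re s| <= n%:R by rewrite ltW// truncnS_gt.
have [M1 M1_gt0 HM1] := exprn_le_expR (n + 2) d0.
have [M2 M2_gt0 HM2] := exprn_le_expR n d0.
have mv : cmeasurable (fun y => w y * cpow y s).
  by apply: cmeasurableM => //; exact: cmeasurable_cpow.
apply: (cintegrable_le mv (g := fun y => cabs (w y * cpow y s))) => //.
apply: (@integrable_bounded_oneDsqr _ _ (M * (M1 * M2))); first exact: measurable_cabs.
move=> y y0; have yi : 0 < y^-1 by rewrite invr_gt0.
rewrite ger0_norm ?cabs_ge0// cabsM cabs_cpow// -mulrA.
apply: (@le_trans _ _ (M * expR (- (d * (y + y^-1))) * (M1 * expR (d * y) * (M2 * expR (d * y^-1))))).
  apply: ler_pM; rewrite ?cabs_ge0 ?mulr_ge0 ?powR_ge0 ?addr_ge0 ?sqr_ge0 ?Hw//.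
  apply: (@le_trans _ _ ((1 + y) ^+ (n + 2) * (1 + y^-1) ^+ n)).
    rewrite exprD mulrAC; apply: ler_pM; rewrite ?powR_ge0 ?addr_ge0 ?sqr_ge0 ?powR_le_exprn//.
    by rewrite sqrrD expr1n mul1r lerD2r lerDl mulrn_wge0// ltW.
  by apply: ler_pM; rewrite ?exprn_ge0 ?addr_ge0 ?(ltW y0) ?(ltW yi) ?HM1 ?HM2 ?(ltW y0) ?(ltW yi).
rewrite (_ : _ * _ = M * (M1 * M2) * (expR (- (d * (y + y^-1))) * (expR (d * y) * expR (d * y^-1)))); last by ring.
by rewrite -!expRD mulrDr addNr expR0 mulr1.
Qed.

Section TestFunction.
Variables (phi : R -> C) (n0 : nat) (eps : R).
Hypotheses (eps_gt0 : 0 < eps) (ps : piecewise_smooth phi).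
Hypothesis phi_oo : littleo_pinfty phi (fun x => expR (- (2 * pi * (n0%:R + eps) * x))).
Hypothesis phi_0 : littleo_pinfty (fun x => phi x^-1)
  (fun x => expR (- (2 * pi * (n0%:R + eps) * x))).

Let c : R := 2 * pi * (n0%:R + eps).

Let c_gt0 : 0 < c.
Proof. by rewrite !mulr_gt0 ?pi_gt0// ltr_wpDl. Qed.

(** The two decay hypotheses, taken with constant 1, cover y > Y and 1/y > Y; in between phi is
    bounded by B, and B exp(cY) exp(-cz) >= B for z <= Y. *)
Let bound_oo : exists2 M : R, 0 <= M &
  (forall y, 1 <= y -> cabs (phi y) <= M * expR (- (c * y))) /\
  (forall y, 0 < y <= 1 -> cabs (phi y) <= M * expR (- (c * y^-1))).
Proof.
have [Y1 [_ H1]] := phi_oo ltr01; have [Y2 [_ H2]] := phi_0 ltr01.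
pose Y := Num.max (Num.max Y1 Y2) 1 + 1.
have Y1Y : Y1 < Y by rewrite ltr_pwDr// !le_max lexx.
have Y2Y : Y2 < Y by rewrite ltr_pwDr// !le_max lexx orbT.
have Y_gt1 : 1 < Y by rewrite ltr_pwDr// !le_max lexx orbT.
have Y0 : 0 < Y := lt_trans ltr01 Y_gt1.
have Yi : Y^-1 < Y by apply: (@lt_trans _ _ 1) => //; rewrite invf_lt1.
have Yi0 : 0 < Y^-1 by rewrite invr_gt0.
have [B HB] := piecewise_smooth_bounded ps Yi0 Yi.
have B0 : 0 <= B.
  by apply: le_trans (HB 1 _); rewrite ?cabs_ge0// (ltW Y_gt1) andbT invf_le1// ltW.
exists (1 + B * expR (c * Y)); first by rewrite addr_ge0 ?mulr_ge0 ?expR_ge0.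
have big z (x : R) : z <= Y -> x <= B -> x <= (1 + B * expR (c * Y)) * expR (- (c * z)).
  move=> zY xB; rewrite mulrDl mul1r -mulrA -expRD; apply: (le_trans xB).
  apply: (@le_trans _ _ (B * 1)); first by rewrite mulr1.
  rewrite ler_wpDl ?expR_ge0//; apply: ler_wpM2l => //.
  by rewrite -[leLHS]expR0 ler_expR -mulrBr mulr_ge0 ?subr_ge0// ltW.
have small z (x : R) : x <= 1 * expR (- (c * z)) -> x <= (1 + B * expR (c * Y)) * expR (- (c * z)).
  move=> /le_trans; apply; apply: ler_wpM2r; first exact: expR_ge0.
  by rewrite lerDl mulr_ge0 ?expR_ge0.
split=> y.
  move=> y1; have [yY|Yy] := leP y Y; last by apply: small; apply: H1; exact: lt_trans Yy.
  apply: big => //; apply: HB; rewrite yY andbT (le_trans _ y1)// invf_le1// ltW//.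
move=> /andP[y0 y1].
have [yY|Yy] := leP y^-1 Y; last first.
  by apply: small; have := H2 y^-1 (lt_trans Y2Y Yy); rewrite invrK.
apply: big => //; apply: HB; apply/andP; split.
  by rewrite -[leRHS]invrK lef_pV2 ?posrE ?invr_gt0.
by rewrite (le_trans y1)// ltW.
Qed.

Lemma growth_exp_decay (p : R -> C) (m : nat) (B : R) : 0 <= B ->
  (forall y, 1 <= y -> cabs (p y) <= B * expR (2 * pi * n0%:R * y)) ->
  (forall y, 0 < y <= 1 -> cabs (p y) <= B * y^-1 ^+ m * expR (2 * pi * n0%:R * y^-1)) ->
  exp_decay (fun y => p y * phi y).
Proof.
move=> B0 p1 p2; have [M M0 [h1 h2]] := bound_oo.
(* The surplus of decay over growth has rate 2 pi eps. For y < 1 half of it absorbs y^(-m), and the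
   other half, pi eps / y, is at least d (y + 1/y) since y <= 1/y. *)
pose d : R := pi * eps / 2.
have pe : 0 < pi * eps by rewrite mulr_gt0 ?pi_gt0.
have d0 : 0 < d by rewrite divr_gt0.
have [K K0 HK] := exprn_le_expR m pe.
have cE : c = 2 * pi * n0%:R + 2 * (pi * eps) by rewrite /c; ring.
exists (B * M * (1 + K)), d; split => //.
  by rewrite !mulr_ge0// addr_ge0// ltW.
move=> y y0; have yi : 0 < y^-1 by rewrite invr_gt0.
rewrite cabsM; have [y1|y1] := leP 1 y.
  apply: (le_trans (ler_pM (cabs_ge0 _) (cabs_ge0 _) (p1 y y1) (h1 y y1))).
  rewrite mulrACA -expRD -[leRHS]mulrA; apply: ler_wpM2l; first by rewrite mulr_ge0.
  apply: (@le_trans _ _ (1 * expR (- (d * (y + y^-1))))); last first.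
    by apply: ler_wpM2r; rewrite ?expR_ge0// lerDl ltW.
  rewrite mul1r ler_expR cE /d.
  have yi1 : y^-1 <= y by rewrite (le_trans _ y1)// invf_le1.
  have : pi * eps * y^-1 <= pi * eps * y by rewrite ler_wpM2l// ltW.
  have : 0 <= pi * eps * y by rewrite mulr_ge0// ltW.
  lra.
have y01 : 0 < y <= 1 by rewrite y0 ltW.
apply: (le_trans (ler_pM (cabs_ge0 _) (cabs_ge0 _) (p2 y y01) (h2 y y01))).
rewrite mulrACA -expRD.
have : y^-1 ^+ m <= K * expR (pi * eps * y^-1).
  apply: le_trans (HK _ (ltW yi)); rewrite lerXn2r ?nnegrE ?addr_ge0 ?(ltW yi)// lerDr//.
move=> Hm; apply: (@le_trans _ _ (B * M * (K * (expR (pi * eps * y^-1) *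
    expR (2 * pi * n0%:R * y^-1 - c * y^-1))))).
  rewrite (_ : B * _ * M = B * M * y^-1 ^+ m); last by ring.
  rewrite -[leLHS]mulrA; apply: ler_wpM2l; first by rewrite mulr_ge0.
  by rewrite mulrA; apply: ler_wpM2r => //; exact: expR_ge0.
rewrite -[leRHS]mulrA; apply: ler_wpM2l; first by rewrite mulr_ge0.
apply: ler_pM; rewrite ?mulr_ge0 ?expR_ge0 ?(ltW K0) ?lerDr//.
rewrite -expRD ler_expR cE /d.
have yi1 : y <= y^-1 by rewrite (le_trans (ltW y1))// invf_ge1// ltW.
have : pi * eps * y <= pi * eps * y^-1 by rewrite ler_wpM2l// ltW.
lra.
Qed.

(** For Re s >= -2 pi n0 the exponential grows at most like exp(2 pi n0 y), so [growth_exp_decay]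
    applies with m = 0 and B = 1. *)
Lemma phi_exp_decay (s : C) : - (2 * pi * n0%:R) <= Re s ->
  exp_decay (fun y => cexp (- s * y%:C) * phi y).
Proof.
move=> hs; have E y : cabs (cexp (- s * y%:C)) = expR (- Re s * y).
  by rewrite cabs_cexp mulrC Re_realM ReN mulrC.
have H y : 0 < y -> - Re s * y <= 2 * pi * n0%:R * y.
  by move=> y0; rewrite ler_wpM2r ?(ltW y0)// lerNl.
have n0p : 0 <= 2 * pi * n0%:R :> R by rewrite !mulr_ge0 ?pi_ge0.
apply: (@growth_exp_decay _ 0%N 1) => // y.
  move=> y1; rewrite E mul1r ler_expR H//; exact: lt_le_trans y1.
move=> /andP[y0 y1]; rewrite E expr0 !mul1r ler_expR (le_trans (H y y0))//.
by rewrite ler_wpM2l// (le_trans y1)// invf_ge1.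
Qed.

End TestFunction.
End Decay.

(** * The Cauchy-Schwarz estimate *)

Section Convergence.
Context {R : realType}.
Local Notation C := R[i].
Local Notation mu := (@lebesgue_measure R).
Local Notation D := (`]0%R, +oo[%classic : set (measurableTypeR R)).
Local Notation Re := complex.Re.

(** This is the integral of x^(-d-1), with primitive -x^(-d)/d, the powers being written through
    ln. *)
Lemma integral1y_power (d : R) : 0 < d ->
  (\int[mu]_(x in `[1%R, +oo[) (expR (- (d * ln x)) * x^-1)%:E = (d^-1)%:E)%E.
Proof.
move=> d0; pose G (x : R) := - d^-1 * expR (- (d * ln x)).
have dG (x : R) : 0 < x -> is_derive x (1 : R) G (expR (- (d * ln x)) * x^-1).
  move=> x0; have dl := is_deriveN (is_deriveZ d (is_derive1_ln x0)).
  have de := @is_derive1_comp _ expR _ x _ _ (is_derive_expR _) dl.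
  have := is_deriveZ (- d^-1) de; move/is_derive_eq; apply.
  rewrite /GRing.scale/=; change ((- (d \*: @ln R)) x) with (- (d * ln x)).
  by field; rewrite !gt_eqF.
have cG (x : R) : 0 < x -> {for x, continuous G}.
  move=> x0; apply: differentiable_continuous; apply/derivable1_diffP.
  exact: (@ex_derive _ _ _ _ _ _ _ (dG x x0)).
have cf (x : R) : 0 < x -> {for x, continuous (fun x => expR (- (d * ln x)) * x^-1)}.
  move=> x0; apply: cvgM; last by apply: cvgV; [rewrite gt_eqF|exact: cvg_id].
  apply: (@continuous_comp R R R (fun x => - (d * ln x)) (@expR R)); last exact: continuous_expR.
  by apply: cvgN; apply: cvgM; [exact: cvg_cst|exact: continuous_ln].
rewrite (@ge0_continuous_FTC2y _ _ G _ 0).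
- by rewrite /G ln1 mulr0 oppr0 expR0 mulr1 sub0e /= opprK.
- by move=> x x1; rewrite mulr_ge0 ?expR_ge0// invr_ge0 (le_trans ler01).
- apply/continuous_within_itvcyP; split.
    by move=> x; rewrite in_itv/= andbT => x1; apply: cf; exact: lt_trans x1.
  by apply: cvg_at_right_filter; exact: cf.
- apply/cvgrPdist_le => e e0; near=> x.
  have de0 : 0 < d * e by rewrite mulr_gt0.
  rewrite sub0r /G mulNr opprK ger0_norm ?mulr_ge0 ?invr_ge0 ?expR_ge0 ?(ltW d0)//.
  have x0 : 0 < x by near: x; exact: nbhs_pinfty_gt.
  have ex : expR (- ln (d * e) / d) <= x.
    by near: x; apply: nbhs_pinfty_ge; rewrite num_real.
  have lx : - ln (d * e) / d <= ln x by rewrite -ler_expR lnK ?posrE.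
  have lx' : - (d * ln x) <= ln (d * e).
    by rewrite lerNl (mulrC d (ln x)) -ler_pdivrMr.
  rewrite ler_pdivrMl//; apply: (@le_trans _ _ (expR (ln (d * e)))); first by rewrite ler_expR.
  by rewrite lnK ?posrE.
- move=> x x1; apply: (@ex_derive _ _ _ _ _ _ _ (dG x _)); exact: lt_trans x1.
- by apply: cvg_at_right_filter; exact: cG.
- move=> x; rewrite in_itv/= andbT => x1; rewrite derive1E.
  by have /(@derive_val _ _ _ _ _ _ _) := dG x (lt_trans ltr01 x1).
Unshelve. all: by end_near. Qed.

Lemma measurable_powRD (a : R) : measurable_fun D (fun t => t `^ a).
Proof. by apply: measurable_funTS; exact: measurable_powR. Qed.

Lemma measurable_power_near0 (a : R) :
  measurable_fun D (fun t : measurableTypeR R => (if t <= 1 then t `^ a else 0)%:E).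
Proof.
apply/measurable_EFinP; apply: (@measurable_fun_if _ _ _ _ (fun t : R => t `^ a) (fun=> 0)).
- exact: measurable_half_line.
- by apply: measurable_fun_ler.
- by apply: measurable_funTS; exact: measurable_powR.
- exact: measurable_cst.
Qed.

(** Inversion t = 1/x turns the integral of t^a over ]0, 1] into that of x^(-a-2) over [1, oo[,
    which is [integral1y_power] with d = a + 1. *)
Lemma integral_power_near0 (a : R) : -1 < a ->
  (\int[mu]_(t in D) (if t <= 1 then t `^ a else 0)%:E < +oo)%E.
Proof.
move=> a1; have d0 : 0 < a + 1 by rewrite -ltrBlDr sub0r.
have mh := measurable_power_near0 a.
rewrite (ge0_integral_inversion ltr01 mh); last first.
  by move=> x x0; rewrite lee_fin; case: ifP => // _; exact: powR_ge0.
rewrite (_ : integral _ _ _ = ((a + 1)^-1)%:E) ?ltey// -integral1y_power//.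
rewrite integral_mkcond [RHS]integral_mkcond; apply: eq_integral => x _.
rewrite !patchE !mem_setE !in_itv/= !andbT /inversion /inversion_weight !mul1r.
have [x0|x0] := ltP 0 x; last by rewrite ifN// -ltNge (le_lt_trans x0).
rewrite -EFinM invf_le1//; case: ifP => // x1; last by rewrite mulr0.
congr (_%:E); rewrite /powR gt_eqF ?invr_gt0// lnV ?posrE//.
rewrite -[x in LHS](lnK (x := x)) ?posrE// -[x in RHS](lnK (x := x)) ?posrE// !expRK.
by rewrite -expRM_natl -!expRN -!expRD; congr expR; ring.
Qed.

(** A Gamma integral of which only finiteness matters: t^a is the majorant for t <= 1, and (1 + t)^n
    exp(-ct) for t > 1. *)
Lemma integral_exp_power (c a : R) : 0 < c -> -1 < a ->
  (\int[mu]_(t in D) (expR (- (c * t)) * t `^ a)%:E < +oo)%E.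
Proof.
move=> c0 a1; pose n := (Num.truncn `|a|).+1.
have an : a <= n%:R by rewrite (le_trans (ler_norm _))// ltW// truncnS_gt.
have [M M0 HM] := exprn_le_expR (n + 2) c0.
have me := measurable_expRM c.
have mp : measurable_fun D (fun t : measurableTypeR R => (1 + t) ^+ n).
  by apply: measurable_funX; apply: measurable_funD => //; exact: measurable_cst.
have i2 : mu.-integrable D (fun t => (expR (- (c * t)) * (1 + t) ^+ n)%:E).
  apply: (@integrable_bounded_oneDsqr _ _ M); first exact: measurable_funM.
  move=> t t0; rewrite ger0_norm ?mulr_ge0 ?expR_ge0 ?exprn_ge0 ?addr_ge0 ?(ltW t0)//.
  apply: (@le_trans _ _ (expR (- (c * t)) * (M * expR (c * t)))).
    rewrite -mulrA; apply: ler_wpM2l; first exact: expR_ge0.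
    apply: le_trans (HM t (ltW t0)); rewrite exprD; apply: ler_wpM2l.
      by rewrite exprn_ge0 ?addr_ge0 ?(ltW t0).
    by rewrite sqrrD expr1n mul1r lerD2r lerDl mulrn_wge0// ltW.
  by rewrite mulrCA -expRD addNr expR0 mulr1.
have mh := measurable_power_near0 a.
apply: (@le_lt_trans _ _ (\int[mu]_(t in D) ((if t <= 1 then t `^ a else 0)%:E +
    (expR (- (c * t)) * (1 + t) ^+ n)%:E))%E).
  apply: ge0_le_integral => //.
  - by move=> t _; rewrite lee_fin mulr_ge0 ?expR_ge0 ?powR_ge0.
  - by apply/measurable_EFinP; apply: measurable_funM => //; exact: measurable_powRD.
  - by apply: emeasurable_funD => //; exact: measurable_int i2.
  - move=> t; rewrite in_half_line => t0; rewrite lee_fin; case: ifPn => t1.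
      rewrite ler_wpDr ?mulr_ge0 ?expR_ge0 ?exprn_ge0 ?addr_ge0 ?(ltW t0)//.
      by rewrite ler_piMl ?powR_ge0// -[leRHS]expR0 ler_expR oppr_le0 mulr_ge0 ?(ltW c0) ?(ltW t0).
    rewrite add0r; apply: ler_wpM2l; first exact: expR_ge0.
    have t1' : 1 <= t by rewrite ltW// ltNge.
    apply: (@le_trans _ _ (t `^ n%:R)); first exact: ler_powR.
    by rewrite powR_mulrn ?(ltW t0)// lerXn2r ?nnegrE ?addr_ge0 ?(ltW t0)// lerDr.
rewrite ge0_integralD//; last 3 first.
- by move=> t _; rewrite lee_fin; case: ifP => // _; exact: powR_ge0.
- by move=> t; rewrite in_half_line => t0;
    rewrite lee_fin mulr_ge0 ?expR_ge0 ?exprn_ge0 ?addr_ge0 ?(ltW t0).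
- exact: measurable_int i2.
rewrite lte_add_pinfty//; first exact: integral_power_near0.
have /integrableP[_] := i2; apply: le_lt_trans; rewrite le_eqVlt; apply/orP; left; apply/eqP.
by apply: eq_integral => t; rewrite inE in_half_line => t0;
  rewrite gee0_abs// lee_fin mulr_ge0 ?expR_ge0 ?exprn_ge0 ?addr_ge0 ?(ltW t0).
Qed.

(* The Cauchy-Schwarz inequality, from [2ab <= l a^2 + b^2 / l] with [l = P^(-1/2)]. *)
Lemma elaplace_twist_le (s : C) : 2^-1 < Re s -> exists2 K : R, 0 <= K &
  forall (p : R -> C) (x : R), cmeasurable p -> 2 * pi <= x ->
  (elaplace (fun t => cabs (twist s p t)) x <=
   K%:E * elaplace (fun t => cabs (p t) ^+ 2)%R x `^ 2^-1)%E.
Proof.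
move=> hs; pose a := 2 * (Re s - 1).
(* Here Re s > 1/2 enters: it makes t^a integrable at 0. *)
have a1 : -1 < a by rewrite /a; lra.
have pi2 : 0 < 2 * pi :> R by rewrite mulr_gt0 ?pi_gt0.
have finQ := integral_exp_power pi2 a1.
set Q := (\int[mu]_(t in D) _)%E in finQ.
have Q0 : (0 <= Q)%E by apply: integral_ge0 => t _; rewrite lee_fin mulr_ge0 ?expR_ge0 ?powR_ge0.
pose q := fine Q; have QE : Q = q%:E by rewrite /q fineK// ge0_fin_numE.
have q0 : 0 <= q by rewrite -lee_fin -QE.
exists ((1 + q) / 2) => [|p x mp hx]; first by rewrite divr_ge0// addr_ge0.
set P := elaplace (fun t => cabs (p t) ^+ 2)%R x.
have mcp := measurable_cabs mp; have me := measurable_expRM x.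
have mP : measurable_fun D (fun t : measurableTypeR R => (expR (- (x * t)) * cabs (p t) ^+ 2)%:E).
  by apply/measurable_EFinP; apply: measurable_funM => //; exact: measurable_funX.
have mQ : measurable_fun D (fun t : measurableTypeR R => (expR (- (2 * pi * t)) * t `^ a)%:E).
  apply/measurable_EFinP; apply: measurable_funM; first exact: measurable_expRM.
  exact: measurable_powRD.
have amgm (l : R) : 0 < l ->
    (elaplace (fun t => cabs (twist s p t)) x <= (l / 2)%:E * P + (q / (2 * l))%:E)%E.
  move=> l0; have l2 : 0 <= l / 2 by rewrite divr_ge0// ltW.
  have l3 : 0 <= (2 * l)^-1 by rewrite invr_ge0 mulr_ge0// ltW.
  have -> : ((q / (2 * l))%:E = ((2 * l)^-1)%:E * Q)%E by rewrite QE -EFinM mulrC.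
  rewrite /P /elaplace -ge0_integralZl_EFin//; last first.
    by move=> t _; rewrite lee_fin mulr_ge0 ?expR_ge0 ?sqr_ge0.
  rewrite /Q -ge0_integralZl_EFin//; last first.
    by move=> t _; rewrite lee_fin mulr_ge0 ?expR_ge0 ?powR_ge0.
  rewrite -ge0_integralD//; last 4 first.
  - by move=> t _; rewrite -EFinM lee_fin; apply: mulr_ge0 => //; rewrite mulr_ge0 ?expR_ge0 ?sqr_ge0.
  - by apply: emeasurable_funM => //; exact: measurable_cst.
  - by move=> t _; rewrite -EFinM lee_fin; apply: mulr_ge0 => //; rewrite mulr_ge0 ?expR_ge0 ?powR_ge0.
  - by apply: emeasurable_funM => //; exact: measurable_cst.
  apply: ge0_le_integral => //.
  - by move=> t _; rewrite lee_fin mulr_ge0 ?expR_ge0 ?cabs_ge0.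
  - apply/measurable_EFinP; apply: measurable_funM => //; apply: measurable_cabs.
    by apply: cmeasurableM => //; exact: cmeasurable_cpow.
  - by apply: emeasurable_funD; apply: emeasurable_funM => //; exact: measurable_cst.
  move=> t; rewrite in_half_line => t0; rewrite -!EFinM -EFinD lee_fin.
  rewrite /twist cabsM cabs_cpow// ReD ReN /=.
  have -> : t `^ a = (t `^ (Re s - 1)) ^+ 2.
    by rewrite expr2 -powRD ?(gt_eqF t0) ?implybT// /a mulr_natl mulr2n.
  set A := cabs (p t); set B := t `^ _; set e1 := expR _; set e2 := expR _.
  (* Only the first summand keeps exp(-xt); in the second it is relaxed to exp(-2 pi t), so that q,
     and hence the constant, does not depend on x. *)
  have e12 : e1 <= e2 by rewrite ler_expR lerN2 ler_wpM2r// ltW.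
  have e10 : 0 <= e1 by exact: expR_ge0.
  have H : A * B <= l / 2 * A ^+ 2 + (2 * l)^-1 * B ^+ 2.
    rewrite -subr_ge0 (_ : _ - _ = (2 * l)^-1 * (l * A - B) ^+ 2).
      by rewrite mulr_ge0 ?sqr_ge0.
    by field; rewrite gt_eqF.
  apply: (@le_trans _ _ (e1 * (l / 2 * A ^+ 2 + (2 * l)^-1 * B ^+ 2))); first exact: ler_wpM2l.
  rewrite mulrDr mulrCA lerD2l mulrCA; apply: ler_wpM2l => //.
  by apply: ler_wpM2r => //; exact: sqr_ge0.
have P0 : (0 <= P)%E by apply: integral_ge0 => t _; rewrite lee_fin mulr_ge0 ?expR_ge0 ?sqr_ge0.
have h2 : 2^-1 != 0 :> R by rewrite invr_neq0.
have k0 : 0 < (1 + q) / 2 by rewrite divr_gt0// ltr_pwDl.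
move: P P0 amgm => [r| |] P0 amgm;
  [|by rewrite poweRyr// gt0_muley ?leey// lte_fin|by []].
rewrite poweR_EFin powR12_sqrt//.
move: P0; rewrite lee_fin le_eqVlt => /orP[/eqP r0|r0].
  rewrite -r0 sqrtr0 mule0; apply/lee_addgt0Pr => e e0; rewrite add0e.
  (* For P = 0 there is no optimal l; this choice makes the remaining term e q/(q + 1), below the
     arbitrary e. *)
  have l0 : 0 < (q + 1) / (2 * e) by rewrite divr_gt0 ?mulr_gt0// ltr_wpDl.
  apply: (le_trans (amgm _ l0)); rewrite -r0 mule0 add0e lee_fin.
  rewrite (_ : q / _ = e * (q / (q + 1))); last by field; rewrite !gt_eqF// ltr_wpDl.
  by rewrite ler_piMr ?(ltW e0)// ler_pdivrMr ?ltr_wpDl// mul1r lerDl.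
have s0 : 0 < Num.sqrt r by rewrite sqrtr_gt0.
have l0 : 0 < (Num.sqrt r)^-1 by rewrite invr_gt0.
apply: (le_trans (amgm _ l0)); rewrite -!EFinM -EFinD lee_fin.
rewrite -{2}[r](sqr_sqrtr (ltW r0)) le_eqVlt; apply/orP; left; apply/eqP.
by field; rewrite gt_eqF.
Qed.

End Convergence.

(** * Smooth extension of the powers x^(s-1) *)

Section SmoothFunctions.
Context {R : realType}.
Local Notation C := R[i].
Local Notation Re := complex.Re.
Local Notation Im := complex.Im.
Implicit Types (f g : R -> R) (p : {poly R}).

Definition smooth_real f := forall (n : nat) (x : R), derivable (derive1n n f) x 1.

Lemma poly_le_pow p : exists K : R, exists n : nat,
  0 <= K /\ forall y : R, 0 <= y -> `|p.[y]| <= K * (1 + y) ^+ n.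
Proof.
elim/poly_ind: p => [|p c [K [n [K0 HK]]]].
  by exists 0; exists 0%N; split => // y _; rewrite horner0 normr0 mul0r.
exists (K + `|c|); exists n.+1; split; first by rewrite addr_ge0.
move=> y y0; rewrite hornerMXaddC; apply: (le_trans (ler_normD _ _)).
have y1 : 1 <= 1 + y by rewrite lerDl.
have y10 : 0 <= 1 + y by rewrite addr_ge0.
rewrite mulrDl; apply: lerD.
  rewrite normrM exprSr mulrA; apply: ler_pM => //; first exact: HK.
  by rewrite ger0_norm// lerDr.
by rewrite -[leLHS]mulr1; apply: ler_wpM2l => //; rewrite exprn_ege1.
Qed.

(** Allowing a polynomial in 1/x in front of exp(-1/x) gives a class closed under derivation, so
    smoothness at 0 reduces to one first-order computation. *)
Definition flat p (x : R) : R := if 0 < x then p.[x^-1] * expR (- x^-1) else 0.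

(** Half of the exponential absorbs the polynomial, and the other half satisfies exp(-1/(2x)) <= 2x.
    This linear bound is what the derivative at 0 requires. *)
Lemma flat_le p : exists2 K : R, 0 <= K & forall x, `|flat p x| <= K * `|x|.
Proof.
have [K [n [K0 HK]]] := poly_le_pow p.
have h0 : (0 : R) < 2^-1 by rewrite invr_gt0.
have [M M0 HM] := exprn_le_expR n h0.
exists (K * M * 2) => [|x]; first by rewrite !mulr_ge0// ltW.
rewrite /flat; case: ifPn => [x0|_]; last by rewrite normr0 !mulr_ge0// ltW.
have xi : 0 <= x^-1 by rewrite invr_ge0 ltW.
rewrite normrM [`|expR _|]ger0_norm ?expR_ge0//.
apply: (@le_trans _ _ (K * (M * expR (2^-1 * x^-1)) * expR (- x^-1))).
  apply: ler_wpM2r; first exact: expR_ge0.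
  by apply: (le_trans (HK _ xi)); apply: ler_wpM2l => //; exact: HM.
rewrite -mulrA -mulrA -expRD -!mulrA; apply: ler_wpM2l => //.
apply: ler_wpM2l; first exact: ltW.
rewrite (_ : _ + _ = - (2 * x)^-1); last by field; rewrite gt_eqF.
rewrite expRN gtr0_norm// -[2 * x in leRHS]invrK lef_pV2 ?posrE ?expR_gt0 ?invr_gt0 ?mulr_gt0//.
by apply: le_trans (expR_ge1Dx _); rewrite lerDr.
Qed.

(** For x > 0 the derivative of p(1/x) exp(-1/x) is x^(-2) (p(1/x) - p'(1/x)) exp(-1/x), the source
    of X^2 (p - p'). At 0 the difference quotient is [flat ('X * p)], which tends to 0 by
    [flat_le]. *)
Lemma is_derive_flat p (x : R) :
  is_derive x (1 : R) (flat p) (flat ('X^2 * (p - p^`())) x).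
Proof.
have [x0|x0|<-] := ltgtP 0 x.
- pose q (y : R) := p.[y^-1] * expR (- y^-1).
  have near_eq : {near x, q =1 flat p}.
    near=> y; rewrite /q /flat ifT//; near: y; exact: lt_nbhsr.
  apply: (near_eq_is_derive near_eq).
  have xn0 : x != 0 by rewrite gt_eqF.
  have dV : is_derive x (1 : R) (fun y : R => y^-1) (- x ^- 2).
    have := is_deriveV xn0 (is_derive_id x (1 : R)).
    by move/is_derive_eq; apply; rewrite /GRing.scale/= mulr1.
  have dp : is_derive x (1 : R) (fun y : R => p.[y^-1]) (- x ^- 2 * p^`().[x^-1]).
    have := @is_derive1_comp _ (fun y => p.[y]) (fun y : R => y^-1) x _ _ (is_derive_poly p _) dV.
    by move/is_derive_eq; apply; rewrite mulrC.
  have de : is_derive x (1 : R) (fun y : R => expR (- y^-1)) (x ^- 2 * expR (- x^-1)).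
    have dN := is_deriveN dV.
    have := @is_derive1_comp _ expR (fun y : R => - y^-1) x _ _ (is_derive_expR _) dN.
    by move/is_derive_eq; apply; rewrite opprK mulrC.
  have := is_deriveM dp de; move/is_derive_eq; apply.
  rewrite /flat x0 /GRing.scale/= hornerM hornerXn hornerD hornerN -exprVn; ring.
- have near_eq : {near x, cst 0 =1 flat p}.
    near=> y; rewrite /flat ifN//= -leNgt ltW//; near: y; exact: lt_nbhsl.
  apply: (near_eq_is_derive near_eq).
  by rewrite /flat ifN -?leNgt ?ltW//; exact: is_derive_cst.
- have [K K0 HK] := flat_le ('X * p).
  have F0 (q : {poly R}) : flat q 0 = 0 by rewrite /flat ltxx.
  rewrite F0.
  have cv : h^-1 *: (flat p (h *: (1 : R) + 0) - flat p 0) @[h --> 0^'] --> (0 : R).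
    apply/cvgrPdist_le => e e0; near=> h.
    have hn0 : h != 0 by near: h; exact: nbhs_dnbhs_neq.
    rewrite sub0r normrN F0 subr0 addr0 /GRing.scale/= mulr1.
    have -> : h^-1 * flat p h = flat ('X * p) h.
      by rewrite /flat; case: ifP => _; rewrite ?mulr0// hornerM hornerX mulrA.
    apply: (le_trans (HK h)); apply: (@le_trans _ _ ((K + 1) * `|h|)).
      by rewrite ler_wpM2r// lerDl.
    rewrite mulrC -ler_pdivlMr ?ltr_pwDr//; near: h; apply: dnbhs0_le.
    by rewrite divr_gt0// ltr_pwDr.
  by split; [apply/cvg_ex; exists 0 | exact: (cvg_lim _ cv)].
Unshelve. all: by end_near. Qed.

(** Each member has a derivative in the class again, so all iterated derivatives exist by induction.
    The constructors are the operations that build the real and imaginary parts of f(x)^(s-1) and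
    their derivatives. *)
Inductive smooth_expr : (R -> R) -> Prop :=
| Smooth_base f : smooth_real f -> smooth_expr f
| Smooth_add f g : smooth_expr f -> smooth_expr g -> smooth_expr (fun x => f x + g x)
| Smooth_mul f g : smooth_expr f -> smooth_expr g -> smooth_expr (fun x => f x * g x)
| Smooth_inv f : (forall x, f x != 0) -> smooth_expr f -> smooth_expr (fun x => (f x)^-1)
| Smooth_exp f : smooth_expr f -> smooth_expr (fun x => expR (f x))
| Smooth_cos f : smooth_expr f -> smooth_expr (fun x => cos (f x))
| Smooth_sin f : smooth_expr f -> smooth_expr (fun x => sin (f x))
| Smooth_ln f : (forall x, 0 < f x) -> smooth_expr f -> smooth_expr (fun x => ln (f x))
| Smooth_flat p (c d : R) : smooth_expr (fun x => flat p (c * x + d)).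

Lemma smooth_real_cst (c : R) : smooth_real (cst c).
Proof.
have E n : derive1n n (cst c : R -> R) = cst (if n is 0%N then c else 0).
  elim: n => [//|n IH]; rewrite derive1nS IH.
  by apply/funext => x; rewrite derive1_cst.
by move=> n x; rewrite E; exact: derivable_cst.
Qed.

Lemma smooth_real_id : smooth_real (@id R).
Proof.
move=> [|n] x; first exact: derivable_id.
have -> : derive1n n.+1 (@id R) = derive1n n (cst 1 : R -> R).
  rewrite derive1Sn; congr (derive1n n _).
  by apply/funext => y; rewrite derive1_id.
exact: smooth_real_cst.
Qed.

Lemma smooth_expr_derive f : smooth_expr f ->
  exists2 g, smooth_expr g & forall x : R, is_derive x (1 : R) f (g x).
Proof.
elim=> {f} [f sf|f g sf [f' sf' df] sg [g' sg' dg]|f g sf [f' sf' df] sg [g' sg' dg]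
  |f f0 sf [f' sf' df]|f sf [f' sf' df]|f sf [f' sf' df]|f sf [f' sf' df]
  |f f0 sf [f' sf' df]|p c d].
- exists (derive1 f).
    by apply: Smooth_base => n x; have := sf n.+1 x; rewrite derive1Sn.
  by move=> x; split; [exact: (sf 0%N x)|rewrite derive1E].
- exists (fun x => f' x + g' x); first exact: Smooth_add.
  by move=> x; exact: is_deriveD.
- exists (fun x => f x * g' x + g x * f' x); first by apply: Smooth_add; exact: Smooth_mul.
  by move=> x; exact: is_deriveM.
- exists (fun x => - 1 * ((f x)^-1 * (f x)^-1) * f' x).
    do 2 apply: Smooth_mul => //; last by apply: Smooth_mul; exact: Smooth_inv.
    by apply: Smooth_base; exact: smooth_real_cst.
  move=> x; have := is_deriveV (f0 x) (df x); move/is_derive_eq; apply.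
  by rewrite /GRing.scale/= mulN1r -exprVn expr2.
- exists (fun x => expR (f x) * f' x); first by apply: Smooth_mul => //; exact: Smooth_exp.
  by move=> x; have := @is_derive1_comp _ expR f x _ _ (is_derive_expR _) (df x).
- exists (fun x => (- 1 * sin (f x)) * f' x).
    apply: Smooth_mul => //; apply: Smooth_mul; last exact: Smooth_sin.
    by apply: Smooth_base; exact: smooth_real_cst.
  move=> x; have := @is_derive1_comp _ cos f x _ _ (is_derive_cos _) (df x).
  by move/is_derive_eq; apply; rewrite mulN1r.
- exists (fun x => cos (f x) * f' x); first by apply: Smooth_mul => //; exact: Smooth_cos.
  by move=> x; have := @is_derive1_comp _ sin f x _ _ (is_derive_sin _) (df x).
- exists (fun x => (f x)^-1 * f' x).
    by apply: Smooth_mul => //; apply: Smooth_inv => // x; rewrite gt_eqF.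
  by move=> x; have := @is_derive1_comp _ (@ln R) f x _ _ (is_derive1_ln (f0 x)) (df x).
- exists (fun x => flat ('X^2 * (p - p^`())) (c * x + d) * c).
    by apply: Smooth_mul; [exact: Smooth_flat|apply: Smooth_base; exact: smooth_real_cst].
  move=> x; have dl : is_derive x (1 : R) (fun x : R => c * x + d) c.
    have := is_deriveD (is_deriveZ c (is_derive_id x (1 : R))) (is_derive_cst d x (1 : R)).
    by move/is_derive_eq; apply; rewrite addr0 /GRing.scale/= mulr1.
  exact: (@is_derive1_comp _ (flat p) (fun x : R => c * x + d) x _ _ (is_derive_flat p _) dl).
Qed.

Lemma smooth_expr_smooth f : smooth_expr f -> smooth_real f.
Proof.
move=> sf n; have : smooth_expr (derive1n n f).
  elim: n => [//|n /smooth_expr_derive[g sg dg]].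
  rewrite derive1nS (_ : derive1 _ = g)//; apply/funext => x; rewrite derive1E.
  exact: (@derive_val _ _ _ _ _ _ _ (dg x)).
move=> /smooth_expr_derive[g _ dg] x; exact: (@ex_derive _ _ _ _ _ _ _ (dg x)).
Qed.

(* [exp (-1/x)] glued with [0] gives a smooth step from [0] at [a/2] to [1] at [a]. *)
Lemma smooth_positive_extension (a : R) : 0 < a ->
  exists f, [/\ smooth_expr f, forall x, 0 < f x & forall x, a <= x -> f x = x].
Proof.
move=> a0.
pose U x := flat 1 (1 * x + - (a / 2)).
pose V x := flat 1 (- 1 * x + a).
have E0 y : 0 <= flat 1 y.
  by rewrite /flat; case: ifP => // _; rewrite hornerC mul1r expR_ge0.
have Ep y : 0 < y -> 0 < flat 1 y by rewrite /flat => ->; rewrite hornerC mul1r expR_gt0.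
have Ez y : y <= 0 -> flat 1 y = 0 by move=> y0; rewrite /flat ltNge y0.
have UV x : 0 < U x + V x.
  have [ax|xa] := ltP (a / 2) x.
    by rewrite ltr_pwDl ?E0// Ep// mul1r subr_gt0.
  by rewrite ltr_wpDl ?E0// Ep//; lra.
(* An average of x and a with weights U, positive only for x > a/2, and V, positive only for x < a.
   It is positive since x is weighted only where x > a/2, and it equals x where V = 0. *)
exists (fun x => (x * U x + a * V x) * (U x + V x)^-1).
have sU : smooth_expr U by exact: Smooth_flat.
have sV : smooth_expr V by exact: Smooth_flat.
split.
- apply: Smooth_mul; last by apply: Smooth_inv; [move=> x; rewrite gt_eqF|exact: Smooth_add].
  apply: Smooth_add; apply: Smooth_mul => //; apply: Smooth_base.
    exact: smooth_real_id.
  exact: smooth_real_cst.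
- move=> x; rewrite mulr_gt0 ?invr_gt0//.
  have [ax|xa] := ltP (a / 2) x.
    rewrite ltr_pwDl//; first by rewrite mulr_gt0 ?(lt_trans _ ax) ?divr_gt0// Ep// mul1r subr_gt0.
    by rewrite mulr_ge0 ?E0// ltW.
  have -> : U x = 0 by apply: Ez; rewrite mul1r subr_le0.
  rewrite mulr0 add0r mulr_gt0// Ep//; lra.
- move=> x ax; have -> : V x = 0 by apply: Ez; lra.
  have Ux : U x != 0 by rewrite gt_eqF// Ep//; lra.
  by rewrite mulr0 !addr0 mulfK.
Qed.

(** On each piece x^(s-1) is replaced by f(x)^(s-1), which is smooth on all of R, with f(x) = x for
    x >= alpha. The partition is kept. *)
Lemma piecewise_smooth_twist (s : C) (phi : R -> C) :
  piecewise_smooth phi -> piecewise_smooth (twist s phi).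
Proof.
move=> ps alpha beta a0 ab; have [t [pt H]] := ps _ _ a0 ab.
exists t; split => // i it; have [u [su Hu]] := H i it.
have [f [sf f0 fE]] := smooth_positive_extension a0.
exists (fun x => u x * cpow (f x) (s - 1)); split; last first.
  move=> x xi; rewrite /twist (Hu x xi) fE//.
  (* A point of a piece lies beyond its left end, which is alpha or a later point of the increasing
     partition. *)
  apply: le_trans (ltW (andP xi).1).
  case: i it xi {H Hu} => [|i] it xi //=.
  have /(order_path_min (@lt_trans _ _))/allP at_ := pt.1.
  by apply/ltW/at_; rewrite mem_nth// ltnW.
have sL : smooth_expr (fun x => ln (f x)) by exact: Smooth_ln.
have scst (c : R) : smooth_expr (fun=> c) by apply: Smooth_base; exact: smooth_real_cst.
have sR : smooth_expr (fun x => Re (u x)) by apply: Smooth_base => n x; exact: (su n x).1.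
have sI : smooth_expr (fun x => Im (u x)) by apply: Smooth_base => n x; exact: (su n x).2.
have sE : smooth_expr (fun x => expR (Re (s - 1) * ln (f x))).
  by apply: Smooth_exp; apply: Smooth_mul.
have sc : smooth_expr (fun x => expR (Re (s - 1) * ln (f x)) * cos (Im (s - 1) * ln (f x))).
  by apply: Smooth_mul => //; apply: Smooth_cos; apply: Smooth_mul.
have ss : smooth_expr (fun x => expR (Re (s - 1) * ln (f x)) * sin (Im (s - 1) * ln (f x))).
  by apply: Smooth_mul => //; apply: Smooth_sin; apply: Smooth_mul.
have cE x : cpow (f x) (s - 1) =
    (expR (Re (s - 1) * ln (f x)) * cos (Im (s - 1) * ln (f x))) +i*
    (expR (Re (s - 1) * ln (f x)) * sin (Im (s - 1) * ln (f x))).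
  rewrite /cpow (mulrC (s - 1)) /cexp !Re_realM !Im_realM.
  rewrite (mulrC _ (Re (s - 1))) (mulrC _ (Im (s - 1))).
  by apply: complexP; rewrite ?Re_realM ?Im_realM.
have sN (f1 g1 : R -> R) : smooth_expr f1 -> smooth_expr g1 -> smooth_expr (fun x => f1 x + - 1 * g1 x).
  by move=> sf1 sg1; apply: Smooth_add => //; exact: Smooth_mul.
move=> n x; split; apply: smooth_expr_smooth.
  have := sN _ _ (Smooth_mul sR sc) (Smooth_mul sI ss).
  by congr smooth_expr; apply/funext => y; rewrite cE Re_mul /= mulN1r.
have := Smooth_add (Smooth_mul sR ss) (Smooth_mul sI sc).
by congr smooth_expr; apply/funext => y; rewrite cE Im_mul /=.
Qed.

End SmoothFunctions.

(** * The imaginary axis under W_N *)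

Section Inversion.
Context {R : realType}.
Local Notation C := R[i].
Local Notation mu := (@lebesgue_measure R).
Local Notation D := (`]0%R, +oo[%classic : set (measurableTypeR R)).
Local Notation Re := complex.Re.
Local Notation Im := complex.Im.

(** The nonnegative case is applied to the positive and negative parts, so both sides are [fine] of
    the same extended real, whether finite or not. *)
Lemma Rintegral_inversion (c : R) (f : R -> R) : 0 < c -> measurable_fun D f ->
  \int[mu]_(x in D) f x = \int[mu]_(x in D) (inversion_weight c x * f (inversion c x)).
Proof.
move=> c0 mf; rewrite /Rintegral; congr fine.
have mf' : measurable_fun D (EFin \o f) by apply/measurable_EFinP; exact: mf.
rewrite [LHS]integralE [RHS]integralE; congr (_ - _)%E.
  rewrite (ge0_integral_inversion c0 (measurable_funepos mf'))//.
  apply: eq_integral => x _; rewrite !funeposE /= -!EFin_max -EFinM.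
  by rewrite maxr_pMr ?inversion_weight_ge0// mulr0.
rewrite (ge0_integral_inversion c0 (measurable_funeneg mf'))//.
apply: eq_integral => x _; rewrite !funenegE /= -!EFin_max -EFinM.
by rewrite maxr_pMr ?inversion_weight_ge0// mulr0 mulrN.
Qed.

Lemma cintegral_inversion (c : R) (u : R -> C) : 0 < c -> cmeasurable u ->
  cintegral D u = cintegral D (fun x => (inversion_weight c x)%:C * u (inversion c x)).
Proof.
move=> c0 [mr mi]; rewrite /cintegral; congr (_ +i* _).
  by rewrite (Rintegral_inversion c0 mr); apply: eq_Rintegral => x _; rewrite Re_realM.
by rewrite (Rintegral_inversion c0 mi); apply: eq_Rintegral => x _; rewrite Im_realM.
Qed.

Lemma cmeasurable_inversion (c : R) (u : R -> C) : 0 < c -> cmeasurable u ->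
  cmeasurable (fun x => u (inversion c x)).
Proof.
move=> c0 [mr mi]; have sub : inversion c @` D `<=` D.
  by move=> _ [x + <-]; rewrite !in_half_line => x0; exact: inversion_gt0.
split.
  by apply: (measurable_comp (F := D) (f := fun x => Re (u x))) => //; exact: measurable_inversion.
by apply: (measurable_comp (F := D) (f := fun x => Im (u x))) => //; exact: measurable_inversion.
Qed.

Lemma exp_decay_inversion (c : R) (w : R -> C) : 1 <= c -> exp_decay w ->
  exp_decay (fun x => w (inversion c x)).
Proof.
move=> c1 [M [d [M0 d0 H]]]; have c0 : 0 < c := lt_le_trans ltr01 c1.
(* The loss of c comes from 1/(cy), which is only 1/c times 1/y; the other summand cy is at least
   y/c as c >= 1. *)
exists M, (d / c); split => // [|y y0]; first exact: divr_gt0.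
apply: (le_trans (H _ (inversion_gt0 c0 y0))); apply: ler_wpM2l => //.
rewrite ler_expR lerN2 /inversion invrK.
rewrite (_ : d / c * (y + y^-1) = d * ((c * y)^-1 + y / c)); last by field; rewrite !gt_eqF.
apply: ler_wpM2l; first exact: ltW.
by rewrite lerD2l ler_pdivrMr// mulrC mulrA ler_peMl ?(ltW y0)// -[leLHS]mulr1 ler_pM.
Qed.

Lemma ler_pM_norm (M x y : R) : 0 <= x -> x <= y -> M * x <= `|M| * y.
Proof.
move=> x0 xy; apply: (@le_trans _ _ (`|M| * x)); first by apply: ler_wpM2r => //; exact: ler_norm.
exact: ler_wpM2l.
Qed.

Section ImaginaryAxis.
Variables (f : C -> C) (fs : smooth_on_H f).

Lemma imag_continuous (y : R) : 0 < y ->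
  {for y, continuous (fun y : R => Re (f (0 +i* y)))} /\
  {for y, continuous (fun y : R => Im (f (0 +i* y)))}.
Proof.
(* The empty word of derivatives gives the continuity of f itself. *)
move=> y0; have [_ _ cf] := fs [::] (z := 0 +i* y) y0.
have path : (fun y' : R => (0 +i* y' : C^o)) @ y --> (0 +i* y : C^o).
  apply/cvgrPdist_lt => e; rewrite ltcE /= => /andP[/eqP e0 ep]; near=> y'.
  rewrite normCE ltcE /= e0 eqxx /= cabsE /= subrr expr0n add0r sqrtr_sqr.
  by near: y'; apply: cvgr_dist_lt.
have cfp : (fun y' : R => (f (0 +i* y') : C^o)) @ y --> (f (0 +i* y) : C^o).
  exact: (@continuous_comp R C^o C^o (fun y' : R => (0 +i* y' : C^o)) f y path cf).
split; apply/cvgrPdist_lt => e e0.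
  have /cvgrPdist_lt/(_ e%:C) := cfp; rewrite ltcR => /(_ e0); apply: filterS => y'.
  by rewrite normCE ltcR; apply: le_lt_trans; rewrite -ReN -ReD; exact: Re_le_cabs.
have /cvgrPdist_lt/(_ e%:C) := cfp; rewrite ltcR => /(_ e0); apply: filterS => y'.
by rewrite normCE ltcR; apply: le_lt_trans; rewrite -ImN -ImD; exact: Im_le_cabs.
Unshelve. all: by end_near. Qed.

Lemma imag_measurable : cmeasurable (fun y => f (0 +i* y)).
Proof. by split; apply: measurable_continuous => y /imag_continuous[]. Qed.

Lemma imag_bounded (a b : R) : 0 < a -> a <= b ->
  exists M : R, forall y, a <= y <= b -> cabs (f (0 +i* y)) <= M.
Proof.
move=> a0 ab.
have bnd (g : R -> R) : (forall y : R, 0 < y -> {for y, continuous g}) ->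
    exists M : R, forall y, a <= y <= b -> `|g y| <= M.
  move=> cg; have cn : {within `[a, b], continuous (fun y => `|g y|)}.
    apply: continuous_in_subspaceT => y /[!inE]/=; rewrite in_itv/= => /andP[ay _].
    by apply: cvg_norm; apply: cg; exact: lt_le_trans ay.
  have [x _ Hx] := EVT_max ab cn.
  by exists `|g x| => y yab; apply: Hx; rewrite in_itv.
have [M1 H1] := bnd _ (fun y y0 => (imag_continuous y0).1).
have [M2 H2] := bnd _ (fun y y0 => (imag_continuous y0).2).
exists (M1 + M2) => y yab; apply: (le_trans (cabs_le_ReIm _)).
by rewrite lerD ?H1 ?H2.
Qed.

(** W_N sends it to i/(Nt), and its automorphy factor there is i sqrt(N) t. *)
Lemma slash_W_imag (k : int) (N : nat) (t : R) : (0 < N)%N -> 0 < t ->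
  slash k (W N) f (0 +i* t) =
  'i ^ (- k) * ((Num.sqrt N%:R * t) ^ (- k))%:C * f (0 +i* (N%:R * t)^-1).
Proof.
move=> N0 t0; have n0 : (0 : R) < N%:R by rewrite ltr0n.
have r0 : 0 < Num.sqrt N%:R :> R by rewrite sqrtr_gt0.
rewrite /slash !mxE /= !mul0r add0r addr0.
have jE : (Num.sqrt N%:R)%:C * (0 +i* t) = 'i * (Num.sqrt N%:R * t)%:C :> C.
  by apply: complexP; rewrite ?Re_mul ?Im_mul /=; ring.
rewrite jE expfzMl expz_real; congr (_ * _ * f _).
have j0 : 'i * (Num.sqrt N%:R * t)%:C != 0 :> C.
  by rewrite -cabs_eq0 cabsM cabsi mul1r cabs_real normr_eq0 mulf_neq0 ?gt_eqF.
apply: (canLR (mulfK j0)).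
have nE : N%:R = Num.sqrt N%:R ^+ 2 :> R by rewrite sqr_sqrtr// ltW.
apply: complexP; rewrite ?Re_mul ?Im_mul /=; last by ring.
move: r0 nE; set r := Num.sqrt _ => r0 nE.
by rewrite nE; field; rewrite !gt_eqF.
Qed.

(** Near 0, |f(iy)| = N^(-k/2) y^(-k) |g(it)| with g the transform of f under W_N and t = 1/(Ny); as
    t <= 1/y, the growth of g at infinity controls f at 0. Continuity covers the compact range in
    between. *)
Lemma modular_growth (k : int) (N n0 : nat) : (0 < N)%N ->
  bigO_im f (fun y => expR (2 * pi * n0%:R * y)) ->
  bigO_im (slash k (W N) f) (fun y => expR (2 * pi * n0%:R * y)) ->
  exists2 B : R, 0 <= B &
    (forall y, 1 <= y -> cabs (f (0 +i* y)) <= B * expR (2 * pi * n0%:R * y)) /\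
    (forall y, 0 < y <= 1 ->
       cabs (f (0 +i* y)) <= B * y^-1 ^+ `|k|%N * expR (2 * pi * n0%:R * y^-1)).
Proof.
move=> N0 [M1 [Y1 [_ H1]]] [M2 [Y2 [_ H2]]].
have n1 : (1 : R) <= N%:R by rewrite ler1n.
have n0p : (0 : R) < N%:R by rewrite ltr0n.
have r0 : 0 < Num.sqrt N%:R :> R by rewrite sqrtr_gt0.
(* Large enough that y > Z exceeds Y1, and that 1/y > Z makes t = 1/(Ny) exceed Y2. *)
pose Z := Num.max (Num.max Y1 (N%:R * Num.max Y2 0)) 1 + 1.
have Z1 : Y1 < Z by rewrite ltr_pwDr// !le_max lexx.
have Z2 : N%:R * Num.max Y2 0 < Z by rewrite ltr_pwDr// !le_max lexx orbT.
have Z3 : 1 < Z by rewrite ltr_pwDr// !le_max lexx orbT.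
have Z0 : 0 < Z := lt_trans ltr01 Z3.
have Zi0 : 0 < Z^-1 by rewrite invr_gt0.
have ZiZ : Z^-1 <= Z by rewrite (@le_trans _ _ 1)// ?ltW// invf_lt1.
have [M3 H3] := imag_bounded Zi0 ZiZ.
have M30 : 0 <= M3.
  by apply: le_trans (H3 1 _); rewrite ?cabs_ge0// invf_le1// !ltW.
pose ck : R := (Num.sqrt N%:R) ^ (- k).
have ck0 : 0 <= ck by rewrite exprz_ge0// ltW.
have p0 : 0 <= 2 * pi * n0%:R :> R by rewrite !mulr_ge0 ?pi_ge0.
have e1 (y : R) : 0 < y -> 1 <= expR (2 * pi * n0%:R * y).
  by move=> y0; rewrite -[leLHS]expR0 ler_expR mulr_ge0// ltW.
exists (`|M1| + M3 + ck * `|M2|); first by rewrite !addr_ge0 ?mulr_ge0.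
split=> y.
  move=> y1; have y0 : 0 < y := lt_le_trans ltr01 y1.
  have [yZ|Zy] := leP y Z.
    apply: (@le_trans _ _ (M3 * 1)).
      by rewrite mulr1 H3// yZ andbT (le_trans _ y1)// invf_le1// ltW.
    apply: ler_pM => //; last exact: e1.
    by rewrite -addrA addrCA lerDl addr_ge0 ?mulr_ge0.
  apply: (le_trans (H1 y (lt_trans Z1 Zy) 0)); apply: ler_wpM2r; first exact: expR_ge0.
  by rewrite (le_trans (ler_norm _))// -addrA lerDl addr_ge0 ?mulr_ge0.
move=> /andP[y0 y1]; have yi0 : 0 < y^-1 by rewrite invr_gt0.
have yi1 : 1 <= y^-1 by rewrite invf_ge1.
have pk : 1 <= y^-1 ^+ `|k|%N by rewrite exprn_ege1.
rewrite -mulrA; have [yZ|Zy] := leP y^-1 Z.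
  apply: (@le_trans _ _ (M3 * 1)).
    rewrite mulr1 H3//; apply/andP; split; last by rewrite (le_trans y1)// ltW.
    by rewrite -[leRHS]invrK lef_pV2 ?posrE.
  apply: ler_pM => //; first by rewrite -addrA addrCA lerDl addr_ge0 ?mulr_ge0.
  by rewrite -[leLHS]mulr1; apply: ler_pM => //; exact: e1.
pose t := (N%:R * y)^-1; have t0 : 0 < t by rewrite invr_gt0 mulr_gt0.
have Yt : Y2 < t.
  apply: (@le_lt_trans _ _ (Num.max Y2 0)); first by rewrite le_max lexx.
  by rewrite /t invfM mulrC ltr_pdivlMr// mulrC (lt_trans Z2).
have ft : cabs (f (0 +i* y)) = ck * y^-1 ^ k * cabs (slash k (W N) f (0 +i* t)).
  have nE : N%:R = Num.sqrt N%:R ^+ 2 :> R by rewrite sqr_sqrtr// ltW.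
  rewrite slash_W_imag// cabsM cabsM cabsXz cabsi exp1rz mul1r cabs_real.
  have -> : (N%:R * t)^-1 = y by rewrite /t; field; rewrite !gt_eqF.
  have -> : Num.sqrt N%:R * t = (Num.sqrt N%:R)^-1 * y^-1.
    rewrite /t; move: r0 nE; set r := Num.sqrt _ => r0 nE.
    by rewrite nE; field; rewrite !gt_eqF.
  have q0 : 0 < (Num.sqrt N%:R)^-1 * y^-1 :> R by rewrite mulr_gt0 ?invr_gt0.
  rewrite ger0_norm ?exprz_ge0 ?(ltW q0)// /ck -exprz_inv -expfzMl mulrA.
  by rewrite -expfzDr ?gt_eqF// subrr expr0z mul1r.
rewrite ft -[leLHS]mulrA.
have ty : t <= y^-1.
  by rewrite lef_pV2 ?posrE ?mulr_gt0// ler_peMl// ltW.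
have st : cabs (slash k (W N) f (0 +i* t)) <= `|M2| * expR (2 * pi * n0%:R * y^-1).
  apply: (le_trans (H2 t Yt 0)); apply: ler_pM_norm.
    exact: expR_ge0.
  by rewrite ler_expR ler_wpM2l.
apply: (@le_trans _ _ (ck * (y^-1 ^+ `|k|%N * (`|M2| * expR (2 * pi * n0%:R * y^-1))))).
  apply: ler_wpM2l => //; apply: ler_pM; rewrite ?exprz_ge0 ?cabs_ge0 ?(ltW yi0)//.
  exact: exprz_le_exprn.
rewrite (_ : ck * _ = ck * `|M2| * (y^-1 ^+ `|k|%N * expR (2 * pi * n0%:R * y^-1))); last by ring.
apply: ler_wpM2r; first by rewrite mulr_ge0 ?expR_ge0// exprn_ge0// ltW.
by rewrite lerDr addr_ge0.
Qed.

End ImaginaryAxis.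

(** The powers collect as (sqrt(N) y)^(-k) (Ny)^(k-1) = N^(k/2-1) y^(-1): with the weight 1 - k the
    exponent of y is free of k. *)
Lemma slashW_imag (k : int) (N : nat) (f : C -> C) (phi : R -> C) (y : R) : (0 < N)%N -> 0 < y ->
  slash k (W N) f (0 +i* y) * slashW (1 - k) N phi y =
  'i ^ (- k) * cpow N%:R (k%:~R / 2 - 1) *
  ((f (0 +i* inversion N%:R y) * phi (inversion N%:R y)) * cpow y (- 1)).
Proof.
move=> N0 y0; have n0 : (0 : R) < N%:R by rewrite ltr0n.
have r0 : 0 < Num.sqrt N%:R :> R by rewrite sqrtr_gt0.
have nE : N%:R = Num.sqrt N%:R ^+ 2 :> R by rewrite sqr_sqrtr// ltW.
rewrite slash_W_imag// /slashW expz_real /inversion.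
have -> : cpow N%:R (k%:~R / 2 - 1) = (Num.sqrt N%:R ^ k * N%:R ^ (-1))%:C :> C.
  rewrite cpowD rmorphM /= -cpow_int// -cpow_int//; congr (_ * cpow _ _).
  move: r0 nE; set r := Num.sqrt _ => r0 nE.
  by rewrite nE expr2 cpowM// -cpowD; congr cpow; field.
have -> : cpow y (- 1) = (y ^ (-1))%:C :> C by rewrite -cpow_int.
have E : (Num.sqrt N%:R * y) ^ (- k) * (N%:R * y) ^ (- (1 - k)) =
    Num.sqrt N%:R ^ k * N%:R ^ (-1) * y ^ (-1) :> R.
  move: r0 nE; set r := Num.sqrt _ => r0 nE; rewrite nE.
  have ze (x : R) : 0 < x -> x ^ (- (1 - k)) = x ^ k * x^-1.
    by move=> x0; rewrite opprB expfzDr ?gt_eqF.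
  have yk : y ^ k != 0 by rewrite expfz_neq0 ?gt_eqF.
  have rk : r ^ k != 0 by rewrite expfz_neq0 ?gt_eqF.
  rewrite expr2 !expfzMl !ze// -!invr_expz !expr1z.
  by field; rewrite yk rk !gt_eqF.
have EC := congr1 (real_complex R) E; rewrite !rmorphM /= in EC.
rewrite !rmorphM /=.
transitivity ('i ^ (- k) * ((((Num.sqrt N%:R * y) ^ (- k))%:C * ((N%:R * y) ^ (- (1 - k)))%:C) *
   (f (0 +i* (N%:R * y)^-1) * phi (N%:R * y)^-1))); first by ring.
by rewrite EC; ring.
Qed.

End Inversion.

(** * Twists of phi as test functions *)

Section TwistedTestFunction.
Context {R : realType}.
Local Notation C := R[i].
Local Notation mu := (@lebesgue_measure R).
Local Notation D := (`]0%R, +oo[%classic : set (measurableTypeR R)).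
Local Notation Re := complex.Re.

Lemma twistC (s s' : C) (phi : R -> C) : twist s (twist s' phi) = twist s' (twist s phi).
Proof. by apply/funext => x; rewrite /twist mulrAC. Qed.

(** [elaplace_twist_le] is uniform for x >= 2 pi: this covers n >= 1 and, as 2 pi |n| (2t + 1) >= 2
    pi, every n < 0. The finitely many terms with -n0 <= n <= 0 are finite by hypothesis. *)
Lemma majorant_twist (k : int) (n0 : nat) (a b : int -> C) (phi : R -> C) (s : C) :
  2^-1 < Re s -> cmeasurable phi ->
  (forall x : R, - (2 * pi * n0%:R) <= x ->
     (elaplace (fun t => cabs (twist s phi t)) x < +oo)%E) ->
  majorant_cvg k n0 a b
    (fun x => (elaplace (fun t => cabs (phi t) ^+ 2)%R x `^ 2^-1)%E)
    (fun x => (elaplace (fun t => cabs (twist (2 - k)%:~R phi t) ^+ 2)%R x `^ 2^-1)%E) ->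
  majorant_cvg k n0 a b
    (elaplace (fun t => cabs (twist s phi t)))
    (elaplace (fun t => cabs (twist (2 - k)%:~R (twist s phi) t))).
Proof.
move=> hs mphi fin; have [K K0 HK] := elaplace_twist_le hs.
pose A x := (elaplace (fun t => cabs (phi t) ^+ 2)%R x `^ 2^-1)%E.
pose B x := (elaplace (fun t => cabs (twist (2 - k)%:~R phi t) ^+ 2)%R x `^ 2^-1)%E.
pose A' := elaplace (fun t => cabs (twist s phi t)).
pose B' := elaplace (fun t => cabs (twist (2 - k)%:~R (twist s phi) t)).
pose w1 (m : nat) : R := cabs (a (idx_ge n0 m)).
pose w2 (m : nat) : R := cabs (b (idx_neg m)) * `|4 * pi * (idx_neg m)%:~R| ^ (1 - k).
pose x1 (m : nat) : R := 2 * pi * (idx_ge n0 m)%:~R.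
pose x2 (m : nat) (t : R) : R := - (2 * pi * (idx_neg m)%:~R * (2 * t + 1)).
pose M1 (m : nat) : \bar R := ((w1 m)%:E * A (x1 m))%E.
pose M2 (m : nat) : \bar R :=
  ((w2 m)%:E * \int[mu]_(t in D) (B (x2 m t) * (((1 + t) ^ k)^-1)%:E))%E.
pose T1 (m : nat) : \bar R := ((w1 m)%:E * A' (x1 m))%E.
pose T2 (m : nat) : \bar R :=
  ((w2 m)%:E * \int[mu]_(t in D) (B' (x2 m t) * (((1 + t) ^ k)^-1)%:E))%E.
change ((\sum_(0 <= m <oo) M1 m + \sum_(0 <= m <oo) M2 m < +oo)%E ->
  (\sum_(0 <= m <oo) T1 m + \sum_(0 <= m <oo) T2 m < +oo)%E).
have w0 (t : R) : D t -> 0 <= ((1 + t) ^ k)^-1.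
  by rewrite in_half_line => t0; rewrite invr_ge0 exprz_ge0// addr_ge0// ltW.
have e0 (p : R -> R) x : (forall t, 0 <= p t) -> (0 <= elaplace p x)%E.
  by move=> p0; apply: integral_ge0 => t _; rewrite lee_fin mulr_ge0 ?expR_ge0.
have c1 m : 0 <= w1 m by exact: cabs_ge0.
have c2 m : 0 <= w2 m.
  by rewrite /w2 mulr_ge0 ?cabs_ge0 ?exprz_ge0.
have M10 m : (0 <= M1 m)%E by rewrite mule_ge0 ?poweR_ge0// lee_fin.
have M20 m : (0 <= M2 m)%E.
  rewrite mule_ge0 ?lee_fin//; apply: integral_ge0 => t tD.
  by rewrite mule_ge0 ?poweR_ge0// lee_fin w0.
have T10 m : (0 <= T1 m)%E.
  by rewrite mule_ge0 ?lee_fin// e0// => t; exact: cabs_ge0.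
have T20 m : (0 <= T2 m)%E.
  rewrite mule_ge0 ?lee_fin//; apply: integral_ge0 => t tD.
  by rewrite mule_ge0 ?lee_fin ?w0// e0// => y; exact: cabs_ge0.
move=> finM.
have S1 : (0 <= \sum_(0 <= m <oo) M1 m)%E by apply: nneseries_ge0.
have S2 : (0 <= \sum_(0 <= m <oo) M2 m)%E by apply: nneseries_ge0.
have fin1 : (\sum_(0 <= m <oo) M1 m < +oo)%E by apply: le_lt_trans finM; rewrite leeDl.
have fin2 : (\sum_(0 <= m <oo) M2 m < +oo)%E by apply: le_lt_trans finM; rewrite leeDr.
have pi2 : 0 < 2 * pi :> R by rewrite mulr_gt0 ?pi_gt0.
apply: lte_add_pinfty.
  (* Indices m <= n0 are those with n = m - n0 <= 0, kept as they are; the others are bounded by K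
     times the assumed majorant. *)
  pose G m := if (m <= n0)%N then T1 m else 0%E.
  have G0 m : (0 <= G m)%E by rewrite /G; case: ifP.
  apply: (@le_lt_trans _ _ (\sum_(0 <= m <oo) (G m + K%:E * M1 m))%E).
    apply: lee_nneseries => // m _; rewrite /G; case: leqP => mn.
      by rewrite leeDl// mule_ge0.
    rewrite add0e /T1 /M1 muleCA; apply: lee_wpmul2l; first by rewrite lee_fin.
    apply: HK => //; rewrite /x1 -[leLHS]mulr1 ler_wpM2l ?(ltW pi2)//.
    by rewrite (_ : 1 = 1%:~R)// ler_int /idx_ge; lia.
  rewrite nneseriesD//; last by move=> m _ _; rewrite mule_ge0.
  rewrite nneseriesZl// lte_add_pinfty ?lte_mul_pinfty//.
  rewrite (nneseries_split 0 n0.+1)// [X in (_ + X)%E]eseries0; last first.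
    by move=> m; rewrite add0n => mn _; rewrite /G leqNgt mn.
  rewrite adde0 add0n lte_sum_pinfty// => m _; rewrite /G; case: ifP => // _.
  rewrite /T1 lte_mul_pinfty ?lee_fin//; apply: fin.
  rewrite /x1 -mulrN ler_wpM2l ?(ltW pi2)// pmulrn -mulrNz ler_int /idx_ge; lia.
apply: (@le_lt_trans _ _ (\sum_(0 <= m <oo) (K%:E * M2 m))%E); last first.
  by rewrite nneseriesZl// lte_mul_pinfty.
apply: lee_nneseries => // m _; rewrite /T2 /M2 muleCA.
apply: lee_wpmul2l; first by rewrite lee_fin.
have f0 := freq_gt0 (R := R) m.
have mtw : cmeasurable (twist (2 - k)%:~R phi).
  by apply: cmeasurableM => //; exact: cmeasurable_cpow.
have mtws : cmeasurable (twist (2 - k)%:~R (twist s phi)).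
  by apply: cmeasurableM; [apply: cmeasurableM|] => //; exact: cmeasurable_cpow.
have mel (p : R -> R) : measurable_fun D p -> (forall t, 0 <= p t) ->
    measurable_fun D (fun t : measurableTypeR R =>
      elaplace p (x2 m t)).
  move=> mp p0; have := measurable_kern_integral_fst (freq m) 0 mp p0.
  apply: eq_measurable_fun => t _; apply: eq_integral => y _; congr (_%:E).
  rewrite /kern expr0z invr1 mulr1; congr (expR _ * _).
  by rewrite /x2 idx_negE /freq; ring.
have mw : measurable_fun D (fun t : measurableTypeR R => (((1 + t) ^ k)^-1)%:E).
  apply/measurable_EFinP; have := measurable_kern (R := R) 0 k 0.
  by apply: eq_measurable_fun => t _; rewrite /kern mulr0 oppr0 expR0 mul1r.
have m1 := mel _ (measurable_cabs mtws) (fun t => cabs_ge0 _).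
have m2 := mel _ (measurable_funX 2 (measurable_cabs mtw)) (fun t => sqr_ge0 _).
have m3 : measurable_fun D (fun t : measurableTypeR R => B (x2 m t)).
  by apply: (@measurableT_comp _ _ _ _ _ _ (fun x => (x `^ 2^-1)%E)) => //; exact: measurable_poweR.
rewrite -ge0_integralZl//; last 2 first.
- exact: emeasurable_funM.
- by move=> t tD; rewrite mule_ge0 ?poweR_ge0// lee_fin w0.
apply: ge0_le_integral => //.
- by move=> t tD; rewrite mule_ge0 ?lee_fin ?w0// e0// => y; exact: cabs_ge0.
- exact: emeasurable_funM.
- by apply: emeasurable_funM; [exact: measurable_cst|exact: emeasurable_funM].
move=> t tD; rewrite muleA; apply: lee_wpmul2r; first by rewrite lee_fin w0.
(* The two twists commute, so the inequality applies to phi_(2-k), twisted by s. *)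
rewrite /B' twistC; apply: HK => //.
rewrite (_ : x2 m t = freq m * (2 * t + 1)); last by rewrite /x2 idx_negE /freq; ring.
move: tD; rewrite in_half_line => t0.
rewrite /freq -mulrA -[leLHS]mulr1 ler_wpM2l ?(ltW pi2)//.
have m1' : 1 <= m.+1%:R :> R by rewrite ler1n.
nra.
Qed.

(** Decay of phi at both ends absorbs any power of t, which settles the Laplace conditions; Re s >
    1/2 enters through the majorant series. *)
Lemma test_function_twist (k : int) (n0 : nat) (a b : int -> C) (phi : R -> C) (eps : R) :
  piecewise_smooth phi -> 0 < eps ->
  littleo_pinfty phi (fun x => expR (- (2 * pi * (n0%:R + eps) * x))) ->
  littleo_pinfty (fun x => phi x^-1) (fun x => expR (- (2 * pi * (n0%:R + eps) * x))) ->
  majorant_cvg k n0 a b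
    (fun x => (elaplace (fun t => cabs (phi t) ^+ 2)%R x `^ 2^-1)%E)
    (fun x => (elaplace (fun t => cabs (twist (2 - k)%:~R phi t) ^+ 2)%R x `^ 2^-1)%E) ->
  forall s : C, 2^-1 < Re s -> test_function k n0 a b (twist s phi).
Proof.
move=> ps e0 hoo h0 fin s hs; have mphi := piecewise_smooth_measurable ps.
have cint (s' w : C) : - (2 * pi * n0%:R) <= Re s' ->
    cintegrable (fun t => cexp (- s' * t%:C) * phi t * cpow t w).
  move=> hs'; apply: exp_decay_cintegrable; last exact: (phi_exp_decay e0 ps hoo h0 hs').
  apply: cmeasurableM => //; apply: cmeasurable_cexp; apply: cmeasurableM.
    exact: cmeasurable_cst.
  by apply: cmeasurable_real; exact: measurable_id.
have n0p : 0 <= 2 * pi * n0%:R :> R by rewrite !mulr_ge0 ?pi_ge0.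
split.
- exact: piecewise_smooth_twist.
- move=> s' hs'; apply: eq_integrable (cintegrable_cabs (cint s' (s - 1) hs')) => // t _.
  by rewrite /twist mulrA.
- move=> s' hs'; have hs'' : - (2 * pi * n0%:R) <= Re s'.
    by apply: le_trans (ltW hs'); rewrite oppr_le0.
  apply: eq_integrable (cintegrable_cabs (cint s' ((s - 1) + ((2 - k)%:~R - 1)) hs'')) => // t _.
  by rewrite /twist cpowD !mulrA.
- apply: majorant_twist => // x hx.
  have [_] := cint x%:C (s - 1) hx; apply: le_lt_trans; rewrite le_eqVlt.
  apply/orP; left; apply/eqP; apply: eq_integral => t _; congr (_%:E).
  rewrite -mulrA [RHS]cabsM -rmorphN -rmorphM /= cexp_real cabs_real.
  by rewrite ger0_norm ?expR_ge0// mulNr.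
Qed.

End TwistedTestFunction.

(** * Analytic continuation and functional equation *)

Unset Implicit Arguments.
Set Strict Implicit.

Theorem theorem4p6 (R : realType) (k : int) (N : nat) (N_gt0 : (0 < N)%N)
    (psi : int -> R[i]) (psiP : dirichlet_character N psi)
    (f : R[i] -> R[i]) (fP : harmonic_form k N psi f)
    (n0' : nat) (a b : int -> R[i]) (fE : fourier_expansion k n0' a b f)
    (n0 : nat)
    (f_growth : bigO_im f (fun y => expR (2 * pi * n0%:R * y)))
    (g_growth : bigO_im (slash k (W N) f) (fun y => expR (2 * pi * n0%:R * y)))
    (phi : R -> R[i]) (phi_neq0 : exists2 x : R, 0 < x & phi x != 0)
    (phi_smooth : piecewise_smooth phi)
    (eps : R) (eps_gt0 : 0 < eps)
    (phi_decay_oo : littleo_pinfty phi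
       (fun x => expR (- (2 * pi * (n0%:R + eps) * x))))
    (phi_decay_0 : littleo_pinfty (fun x => phi x^-1)
       (fun x => expR (- (2 * pi * (n0%:R + eps) * x))))
    (phi_cvg : majorant_cvg k n0 a b
       (fun x => (elaplace (fun t => cabs (phi t) ^+ 2)%R x `^ 2^-1)%E)
       (fun x => (elaplace (fun t => cabs (twist (2 - k)%:~R phi t) ^+ 2)%R x
                  `^ 2^-1)%E)) :
  (forall s : R[i], 2^-1 < complex.Re s -> test_function k n0 a b (twist s phi)) /\
  exists F : R[i] -> R[i], L_continuation k n0 a b phi F /\
    forall (n1 : nat) (a' b' : int -> R[i]),
      fourier_expansion k n1 a' b' (slash k (W N) f) ->
      exists G : R[i] -> R[i],
        L_continuation k n0 a' b' (slashW (1 - k) N phi) G /\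
        forall s : R[i],
          F s = cpow N%:R (- s - k%:~R / 2 + 1) * 'i%C ^ k * G (1 - s).
Proof.
have mphi := piecewise_smooth_measurable phi_smooth.
split.
  exact: (test_function_twist phi_smooth eps_gt0 phi_decay_oo phi_decay_0 phi_cvg).
have n0R : 0 < N%:R :> R by rewrite ltr0n.
have fs := harmonic_form_smooth fP.
pose w (y : R) : R[i] := f (0 +i* y) * phi y.
have mw : cmeasurable w by apply: cmeasurableM => //; exact: imag_measurable.
have dw : exp_decay w.
  have [B B0 [B1 B2]] := modular_growth fs N_gt0 f_growth g_growth.
  exact: (growth_exp_decay eps_gt0 phi_smooth phi_decay_oo phi_decay_0 B0 B1 B2).
have iw (s : R[i]) := exp_decay_cintegrable s mw dw.
pose F (s : R[i]) := cintegral `]0, +oo[ (fun y => w y * cpow y (s - 1)).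
exists F; split.
  split; first exact: entire_mellin.
  move=> s ts; rewrite (L_integral fE (fourier_support fE f_growth) ts).
  by apply: eq_cintegral => y _; rewrite /w /twist mulrA.
move=> n1 a' b' gE.
(* The constant that [slashW_imag] puts in front of y^(-1) w(1/(Ny)); its i^(-k) comes from the
   automorphy factor. *)
pose c0 : R[i] := 'i%C ^ (- k) * cpow N%:R (k%:~R / 2 - 1).
pose v (y : R) : R[i] := w (inversion N%:R y).
have mv : cmeasurable v by exact: cmeasurable_inversion.
have iv (s : R[i]) : cintegrable (fun y => v y * cpow y s).
  apply: exp_decay_cintegrable => //; apply: exp_decay_inversion => //.
  by rewrite ler1n.
pose w' (y : R) : R[i] := slash k (W N) f (0 +i* y) * slashW (1 - k) N phi y.
have w'E (y : R) : 0 < y -> w' y = c0 * (v y * cpow y (- 1)) by exact: slashW_imag.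
have mw' : cmeasurable w'.
  apply: (@eq_cmeasurable _ (fun y => c0 * (v y * cpow y (- 1)))) => [y y0|].
    by rewrite w'E.
  by apply: cmeasurableM; [exact: cmeasurable_cst|exact: (iv _).1].
have w'sE (s : R[i]) (y : R) : 0 < y -> w' y * cpow y (s - 1) = c0 * (v y * cpow y (s - 2)).
  move=> y0; rewrite w'E// (_ : s - 2 = - 1 + (s - 1)); last by ring.
  by rewrite [in RHS]cpowD; ring.
have iw' (s : R[i]) : cintegrable (fun y => w' y * cpow y s).
  split; first by apply: cmeasurableM => //; exact: cmeasurable_cpow.
  have [_] := cintegrableZ c0 (iv (s - 1)); apply: le_lt_trans; rewrite le_eqVlt.
  apply/orP; left; apply/eqP; apply: eq_integral => y; rewrite inE in_half_line => y0.
  have := w'sE (s + 1) y y0; rewrite addrK => ->.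
  by rewrite (_ : s + 1 - 2 = s - 1)//; ring.
exists (fun s => cintegral `]0, +oo[ (fun y => w' y * cpow y (s - 1))); split.
  split; first exact: entire_mellin.
  move=> s ts; rewrite (L_integral gE (fourier_support gE g_growth) ts).
  by apply: eq_cintegral => y _; rewrite /w' /twist mulrA.
move=> s.
(* Substituting y -> 1/(Ny): the power gives (Ny)^(-(s-1)) and the Jacobian N^(-1) y^(-2), in all
   N^(-s) y^(-s-1). *)
have -> : F s = cpow N%:R (- s) * cintegral `]0, +oo[ (fun y => v y * cpow y (- s - 1)).
  rewrite -cintegralZ// /F (cintegral_inversion n0R (iw _).1).
  apply: eq_cintegral => y y0; rewrite -/(v y).
  have -> : (inversion_weight N%:R y)%:C = cpow N%:R (- 1) * cpow y (- 2).
    rewrite -[- 1]/((-1)%:~R) cpow_int// -[- 2]/((-2)%:~R) cpow_int// -rmorphM /=.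
    by rewrite /inversion_weight invfM -exprnN.
  rewrite /inversion cpowV ?mulr_gt0// cpowM//.
  have -> : cpow N%:R (- s) = cpow N%:R (- 1) * cpow N%:R (- (s - 1)).
    by rewrite -cpowD; congr cpow; ring.
  have -> : cpow y (- s - 1) = cpow y (- 2) * cpow y (- (s - 1)).
    by rewrite -cpowD; congr cpow; ring.
  ring.
(* At 1 - s the exponent (1 - s) - 2 is -s - 1, so both sides of the functional equation involve the
   same integral. *)
have -> : cintegral `]0, +oo[ (fun y => w' y * cpow y (1 - s - 1)) =
    c0 * cintegral `]0, +oo[ (fun y => v y * cpow y (- s - 1)).
  rewrite -cintegralZ//; apply: eq_cintegral => y y0; rewrite w'sE//.
  by rewrite (_ : 1 - s - 2 = - s - 1)//; ring.
rewrite mulrA; congr (_ * _); rewrite /c0.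
have i0 : 'i%C != 0 :> R[i] by rewrite -cabs_eq0 cabsi oner_eq0.
(* i^k cancels the i^(-k) of c0, and the two powers of N multiply to N^(-s). *)
rewrite (_ : _ * _ * _ = ('i%C ^ k * 'i%C ^ (- k)) *
  (cpow N%:R (- s - k%:~R / 2 + 1) * cpow N%:R (k%:~R / 2 - 1))); last by ring.
rewrite -expfzDr// subrr expr0z mul1r -cpowD; congr cpow; ring.
Qed.
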